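(* Let $E$ be a smooth, strictly convex complex Banach space. Then $T:\mathcal{B}_*(\triangle,E)\to\mathcal{B}_*(\triangle,E)$ is a surjective linear isometry if and only if there exist surjective linear isometries $U$ and $V$ on $E$ and a disc automorphism $\sigma$ such that for every $f\in\mathcal{B}_*(\triangle,E)$ and $z\in\triangle$, \[ Tf(z)=U[f(0)]+V[f(\sigma(z))-f(\sigma(0))].\]
   Context: $\triangle=\{z\in\mathbb{C}:|z|<1\}$. $\mathcal{B}_*(\triangle,E)$ is the Banach space of all analytic functions $f:\triangle\to E$ with $\lim_{|z|\to1}(1-|z|^2)\|f'(z)\|_E=0$, with norm $\|f\|_{\mathcal{B}}=\|f(0)\|_E+\sup_{z\in\triangle}(1-|z|^2)\|f'(z)\|_E$. A disc automorphism is a bijective analytic map of $\triangle$ onto itself. *)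

(* Defs.v *)
From HB Require Import structures.
From mathcomp Require Import all_boot all_order all_algebra complex.
From mathcomp Require Import all_classical all_reals all_analysis.
Set Implicit Arguments.
Unset Strict Implicit.
Unset Printing Implicit Defensive.
Import Order.TTheory GRing.Theory Num.Theory numFieldNormedType.Exports.
Local Open Scope classical_set_scope.
Local Open Scope ring_scope.

(* [R[i]^o] rather than [R[i]]: only the former carries the canonical
   topology and the structure of normed module over [R[i]]. *)
Notation CC R := ((R%type)[i]^o)%type (only parsing).

Section Geometry.
Context {R : realType} {E : normedModType R[i]}.

Definition support_functional (x : E) (phi : E -> CC R) : Prop :=
  [/\ linear phi, (forall y, `|phi y| <= `|y|) & phi x = `|x|].

Definition smooth_space : Prop :=
  forall x : E, `|x| = 1 -> exists! phi : E -> CC R, support_functional x phi.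

Definition strictly_convex_space : Prop :=
  forall x y : E, `|x| = 1 -> `|y| = 1 -> x <> y -> `|x + y| < 2.

End Geometry.
Arguments smooth_space {R} E.
Arguments strictly_convex_space {R} E.

Definition surjective_linear_isometry {K : pzRingType} {V : lmodType K}
    {N : Type} (norm : V -> N) (T : V -> V) : Prop :=
  [/\ linear T, forall y, exists x, T x = y & forall x, norm (T x) = norm x].

Section Analytic.
Context {K : numFieldType} {V : normedModType K}.
Implicit Types (f g : K^o -> V) (z : K^o).

Definition analytic_at f z : Prop :=
  exists a : nat -> V, \forall w \near z,
    series (fun n => (w - z) ^+ n *: a n) @ \oo --> f w.

Lemma analytic_at_cst0 z : analytic_at (fun=> 0) z.
Proof.
exists (fun=> 0); near=> w.
rewrite (_ : series _ = fun=> 0); first exact: cvg_cst.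
by apply/funext => n; rewrite /series /= big1// => i _; rewrite scaler0.
Unshelve. all: by end_near. Qed.

Lemma analytic_at_linear (c : K) f g z : analytic_at f z -> analytic_at g z ->
  analytic_at (c *: f + g) z.
Proof.
move=> [a fa] [b gb]; exists (fun n => c *: a n + b n).
near=> w.
have fw : series (fun n => (w - z) ^+ n *: a n) @ \oo --> f w by near: w.
have gw : series (fun n => (w - z) ^+ n *: b n) @ \oo --> g w by near: w.
rewrite (_ : series _ = c *: series (fun n => (w - z) ^+ n *: a n) +
                             series (fun n => (w - z) ^+ n *: b n)).
  exact: cvgD (cvgZl_tmp fw) gw.
rewrite -seriesZ -seriesD; congr series; apply/funext => n.
by rewrite scalerDr scalerA mulrC -scalerA.
Unshelve. all: by end_near. Qed.

Lemma geo2_le2 (q : K) n : 0 <= q -> q <= 2^-1 -> \sum_(0 <= k < n) q ^+ k <= 2.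
Proof.
move=> q0 q2; rewrite big_mkord.
have h : (1 - q) * \sum_(k < n) q ^+ k <= 1.
  by rewrite mulrC -opprB mulrN mulrC -subrX1 opprB gerBl exprn_ge0.
have S0 : 0 <= \sum_(k < n) q ^+ k by apply: sumr_ge0 => i _; rewrite exprn_ge0.
have h2 : 2^-1 <= 1 - q.
  by rewrite lerBrDr -lerBrDl (le_trans q2)// {2}(splitr 1) mul1r addrK.
have : 2^-1 * \sum_(k < n) q ^+ k <= 1 by apply: le_trans h; rewrite ler_wpM2r.
by rewrite ler_pdivrMl// mulr1.
Qed.

Lemma le_norm_lim (u : nat -> V) (l : V) (M : K) :
  u @ \oo --> l -> (\forall n \near \oo, `|u n| <= M) -> `|l| <= M.
Proof.
move=> ul uM; apply/ler_addgt0Pr => e e0.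
have /cvgrPdist_le /(_ e e0) le := ul.
near \oo => n.
rewrite -[l](subrK (u n)) (le_trans (ler_normD _ _))// addrC lerD//; near: n => //.
Unshelve. all: by end_near. Qed.

Lemma analytic_at_derivable f z : analytic_at f z -> derivable f z 1.
Proof.
move=> [a /nbhs_normP[e /= e0 fa]].
have {}fa h : `|h| < e -> series (fun n => h ^+ n *: a n) @ \oo --> f (h + z).
  move=> he; have /= := fa (h + z).
  by rewrite addrK; apply; rewrite opprD addrCA subrr addr0 normrN.
have r0 : 0 < e / 2 by rewrite divr_gt0.
have re : `|e / 2| < e by rewrite gtr0_norm// gtr_pMr// invf_lt1// ltr1n.
move: r0 re; move: (e / 2) => r r0 re.
have fz : f z = a 0.
  have /fa : `|0 : K^o| < e by rewrite normr0.
  rewrite add0r => fz; apply: cvg_unique fz _ => //.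
  apply: cvg_near_cst; exists 1%N => //= n n0.
  rewrite /series /= big_ltn// big_nat_cond big1 ?addr0 ?expr0 ?scale1r// => i.
  by rewrite andbT => /andP[i0 _]; rewrite expr0n gtn_eqF// scale0r.
have [M M0 aM] : exists2 M, 0 < M & forall n, `|r ^+ n *: a n| <= M.
  have /cvg_seq_bounded/pinfty_ex_gt0[M M0 /= aM] :
      cvgn (fun n => r ^+ n *: a n).
    by apply: cvgP (cvg_series_cvg_0 (cvgP _ (fa _ re))).
  by exists M => // n; exact: aM.
pose c := r ^- 2 * (M * 2).
have c0 : 0 < c by rewrite mulr_gt0 ?invr_gt0 ?exprn_gt0// mulr_gt0.
have est h : `|h| <= r / 2 -> `|f (h + z) - f z - h *: a 1| <= `|h| ^+ 2 * c.
  move=> hr.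
  have he : `|h| < e.
    rewrite (le_lt_trans hr)// (le_lt_trans _ re)// gtr0_norm//.
    by rewrite ler_piMr ?(ltW r0)// invf_le1// ler1n.
  apply: (@le_norm_lim
      (fun n => series (fun n => h ^+ n *: a n) n - f z - h *: a 1)).
    by apply: cvgB; [apply: cvgB; [exact: fa|exact: cvg_cst]|exact: cvg_cst].
  exists 2 => //= -[|[|n]]// _.
  rewrite /series /= big_ltn// big_ltn// expr0 scale1r expr1 fz.
  rewrite [X in X - _ - _]addrC addrK [X in X - _]addrC addrK.
  pose q := `|h| / r.
  have q0 : 0 <= q by rewrite divr_ge0// ltW.
  have q2 : q <= 2^-1 by rewrite ler_pdivrMr// mulrC.
  have -> : `|h| ^+ 2 * c = q ^+ 2 * M * 2 by rewrite /c /q expr_div_n !mulrA.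
  rewrite (le_trans (ler_norm_sum _ _ _))//.
  apply: (@le_trans _ _ (q ^+ 2 * M * \sum_(0 <= i < n) q ^+ i)).
    rewrite -[X in \sum_(X <= _ < _) _]add0n big_addn subn2 /= mulr_sumr.
    rewrite ler_sum// => i _.
    rewrite mulrAC -exprD (_ : h ^+ _ *: _ =
        (h / r) ^+ (i + 2) *: (r ^+ (i + 2) *: a (i + 2)%N)).
      rewrite normrZ normrX normf_div (gtr0_norm r0) [(2 + i)%N]addnC.
      by rewrite ler_wpM2l ?exprn_ge0.
    by rewrite scalerA expr_div_n mulfVK// expf_neq0// gt_eqF.
  by rewrite ler_wpM2l ?geo2_le2// mulr_ge0 ?exprn_ge0// ltW.
apply/cvg_ex; exists (a 1%N); apply/cvgrPdist_le => d d0.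
near=> h.
have h0 : h != 0 by near: h; exact: nbhs_dnbhs_neq.
have hr : `|h| <= r / 2 by near: h; apply: dnbhs0_le; rewrite divr_gt0.
have hd : `|h| <= d / c by near: h; apply: dnbhs0_le; rewrite divr_gt0.
rewrite distrC (_ : _ - _ = h^-1 *: (f (h + z) - f z - h *: a 1%N)); last first.
  by rewrite [RHS]scalerBr scalerA mulVf// scale1r /= [h *: 1]mulr1.
rewrite normrZ normfV ler_pdivrMl ?normr_gt0//.
rewrite (le_trans (est _ hr))// expr2 -mulrA ler_wpM2l//.
by rewrite -ler_pdivlMr.
Unshelve. all: by end_near. Qed.

End Analytic.

(* The norms of [E] and [CC R] take values in [R[i]]; [normR] is the same
   norm as an element of [R]. *)
Definition normR {R : rcfType} {V : normedZmodType R[i]} (x : V) : R :=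
  complex.Re `|x|.

Section NormR.
Context {R : realType}.

Lemma normRE (V : normedZmodType R[i]) (x : V) : (normR x)%:C%C = `|x|.
Proof. by rewrite /normR RRe_real// normr_real. Qed.

Lemma normR_ge0 (V : normedZmodType R[i]) (x : V) : 0 <= normR x.
Proof. by rewrite -lecR normRE normr_ge0. Qed.

Lemma normRD (V : normedZmodType R[i]) (x y : V) :
  normR (x + y) <= normR x + normR y.
Proof. by rewrite -lecR rmorphD /= !normRE ler_normD. Qed.

Lemma normRZ (V : normedModType R[i]) (c : CC R) (x : V) :
  normR ((c : R[i]) *: x) = normR c * normR x.
Proof. by apply: complexI; rewrite rmorphM /= !normRE normrZ. Qed.

End NormR.

Definition disc {R : rcfType} : set (CC R) := [set z | `|z| < 1].

Section LittleBloch.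
Context {R : realType} {E : normedModType R[i]}.
Implicit Types (f g : CC R -> E) (z : CC R).

Definition bloch_weight f z : R :=
  (1 - normR z ^+ 2) * normR (derive1 f z).

(* A function on the disc is represented by its extension by zero to the
   plane, so that equality of functions on the disc is Leibniz equality. *)
Definition little_bloch : {pred CC R -> E} :=
  mem [set f | [/\ forall z, disc z -> analytic_at f z,
                   forall e : R, 0 < e -> exists2 r : R, r < 1 &
                     forall z, r < normR z < 1 -> bloch_weight f z < e &
                   forall z, ~ disc z -> f z = 0]].

Lemma discE z : disc z = (normR z < 1) :> Prop.
Proof. by rewrite /disc /= -normRE -[1]/(1%:C%C) ltcR. Qed.

Lemma bloch_weight_linear (c : R[i]) f g z : disc z ->
  analytic_at f z -> analytic_at g z ->
  bloch_weight (c *: f + g) z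
    <= normR (c : CC R) * bloch_weight f z + bloch_weight g z.
Proof.
rewrite discE => z1 /analytic_at_derivable df /analytic_at_derivable dg.
rewrite /bloch_weight !derive1E deriveD//; last exact: derivableZ.
rewrite deriveZ// mulrCA -mulrDr ler_wpM2l//.
  by rewrite subr_ge0 expr_le1 ?normR_ge0// ltW.
by rewrite -normRZ normRD.
Qed.

Lemma little_bloch_submod_closed : submod_closed little_bloch.
Proof.
split=> [|c f g].
  rewrite inE; split=> // [z _|e e0]; first exact: analytic_at_cst0.
  exists 0 => // z _; rewrite /bloch_weight derive1E derive_cst.
  by rewrite /normR normr0 mulr0.
rewrite !inE => -[fa fb f0] [ga gb g0]; split=> [z dz|e e0|z dz].
- by apply: analytic_at_linear; [exact: fa|exact: ga].
- have c1 : 0 < normR (c : CC R) + 1 by rewrite ltr_wpDl// normR_ge0.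
  have e2 : 0 < e / 2 by rewrite divr_gt0.
  have [r r1 fr] := fb _ (divr_gt0 e2 c1).
  have [s s1 gs] := gb _ e2.
  exists (Num.max r s) => [|z /andP[]]; first by rewrite gt_max r1.
  rewrite gt_max => /andP[rz sz] z1.
  have {}fr := fr z; rewrite rz z1 in fr; have {}fr := fr isT.
  have {}gs := gs z; rewrite sz z1 in gs; have {}gs := gs isT.
  have dz : disc z by rewrite discE.
  apply: le_lt_trans (bloch_weight_linear c dz (fa _ dz) (ga _ dz)) _.
  rewrite [ltRHS](splitr e) ler_ltD//.
  set n := normR _ in c1 fr *.
  apply: (@le_trans _ _ (n * (e / 2 / (n + 1)))).
    by rewrite ler_wpM2l ?normR_ge0// ltW.
  by rewrite mulrCA ler_piMr ?ltW// ltr_pdivrMr// mul1r ltrDl.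
- by rewrite -[LHS]/(c *: f z + g z) f0// g0// scaler0 addr0.
Qed.

HB.instance Definition _ :=
  GRing.isSubmodClosed.Build _ _ little_bloch little_bloch_submod_closed.

End LittleBloch.

Record Bstar (R : realType) (E : normedModType R[i]) := MkBstar {
  Bstar_fun :> CC R -> E;
  Bstar_funP : Bstar_fun \in little_bloch
}.

Section Bstar_lmodType.
Context {R : realType} {E : normedModType R[i]}.
Implicit Type f : Bstar E.

HB.instance Definition _ := [isSub for @Bstar_fun R E].
HB.instance Definition _ := [Choice of Bstar E by <:].
HB.instance Definition _ := [SubChoice_isSubLmodule of Bstar E by <:].

(* [bloch_weight f] is continuous on the disc and tends to 0 at the boundary,
   so this is finite; taking the supremum in [\bar R] avoids having to prove
   it before the norm can be defined. *)
Definition bloch_norm f : \bar R :=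
  ((normR (f 0))%:E + ereal_sup [set (bloch_weight f z)%:E | z in disc])%E.

End Bstar_lmodType.

Definition disc_automorphism {R : realType} (s : CC R -> CC R) : Prop :=
  (forall z, disc z -> analytic_at s z) /\ set_bij disc disc s.

(* Main.v *)
Require Import Defs.
From mathcomp Require Import all_boot all_order all_algebra complex.
From mathcomp Require Import all_classical all_reals all_analysis.
From mathcomp Require Import ring lra.
Import Order.TTheory GRing.Theory Num.Theory numFieldNormedType.Exports.
Set Implicit Arguments.
Unset Strict Implicit.
Unset Printing Implicit Defensive.
Local Open Scope classical_set_scope.
Local Open Scope ring_scope.

(** The norm of the space is [nB f = |f 0| + beta f], where [beta f] is the maximum
over the disc of the weight [(1 - |z|^2) |f'(z)|]; it is attained because the
weight tends to 0 at the boundary.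

The converse implication rests on the invariance of the weight under Moebius
maps, and on the Schwarz lemma, by which every disc automorphism is a Moebius map
([quot_bij_moeb]).

For the direct one, the idea is that an isometry permutes support functionals, and
that at suitable points there is only one. As [E] is smooth, each [y <> 0] in [E]
has a unique support functional [phi y]. The function [mu z b], which is [b] times
an automorphism of the disc vanishing at [z], normalized at 0, has a weight with a
strict maximum at [z]; hence [cstB a + mu z b] has exactly one support functional,
  [Lam a z b g = phi a (g 0) + (1 - |z|^2) phi b (g'(z))]   ([supp_uniq]),
and composition with an isometry [T] maps this family of functionals to itself
([isometry_Lam]).

The two terms are then separated. Evaluations of the derivative at distinct points
are linearly independent, so [Lam a z b] and [Lam a z (- b)] go to the same point
([same_point]); from this [T] preserves the functions vanishing at 0
([vanishing_preserved]), and the additivity of the norm makes it preserve the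
constants ([constants_preserved]), on which it acts as [U].

There remain the functionals [Lz z b g = (1 - |z|^2) phi b (g'(z))], which [T] permutes.
The image of [Lz z b] lives at a point that could depend on [b]. If it is
[kappa b], the derivatives [u] and [v] at [z] of the inverse images of [y w^2 / 2] and
[y w] satisfy [phi b u = kappa b * phi b v] for all [b]; approximating [u] at best by
multiples of [v] shows that [u] is such a multiple ([proportional_of_ratio]), so
[kappa] is constant ([image_point_cst]). Thus there is a bijection [sigma] of the
disc such that the weight of [T f] at [z] is that of [f] at [sigma z]
([isometry_weight]), and [(T f)'(z)] is the image of [f'(sigma z)] under a linear map
[A z]. The map [sigma] is a quotient of two analytic functions, the derivatives of the
images of [y w^2 / 2] and [y w], so it is a Moebius map. Finally [A z / sigma'(z)]
is an isometry of [E] depending analytically on [z]; strict convexity and the maximum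
principle make it a constant [V] ([constant_norm]). Integrating
[(T f)'(z) = sigma'(z) V (f'(sigma z))] gives the formula.

The complex analysis used on the way is derived from Taylor expansions with
geometric remainders and from the behaviour of a function near a point, to
leading order ([quot_extremum]). *)

(** * Linear identities in a module *)

(** Syntax for linear combinations of vectors with scalars in [K]; variables are
    positions in a list of atoms. *)
Inductive mexpr (K : Type) : Type :=
| MVar of nat
| MZero
| MAdd of mexpr K & mexpr K
| MOpp of mexpr K
| MScale of K & mexpr K.
Arguments MVar {K}.
Arguments MZero {K}.

Section ModuleIdentities.
Context {K : comNzRingType} {V : lmodType K}.
Implicit Types (env : seq V) (e : mexpr K).

Fixpoint meval env e : V :=
  match e with
  | MVar n => env`_n
  | MZero => 0
  | MAdd a b => meval env a + meval env b
  | MOpp a => - meval env a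
  | MScale c a => c *: meval env a
  end.

Fixpoint mcoef e (i : nat) : K :=
  match e with
  | MVar n => if n == i then 1 else 0
  | MZero => 0
  | MAdd a b => mcoef a i + mcoef b i
  | MOpp a => - mcoef a i
  | MScale c a => c * mcoef a i
  end.

Lemma meval_coef env e :
  meval env e = \sum_(i < size env) mcoef e i *: env`_i.
Proof.
elim: e => [n||a IHa b IHb|a IHa|c a IHa] /=.
- have [ns|sn] := ltnP n (size env).
    rewrite (bigD1 (Ordinal ns))//= eqxx scale1r big1 ?addr0// => i ni.
    by rewrite ifN ?scale0r// eq_sym.
  rewrite nth_default// big1// => i _.
  by rewrite gtn_eqF ?scale0r// (leq_trans _ sn).
- by rewrite big1// => i _; rewrite scale0r.
- by rewrite IHa IHb -big_split; apply: eq_bigr => i _; rewrite scalerDl.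
- by rewrite IHa -sumrN; apply: eq_bigr => i _; rewrite scaleNr.
- by rewrite IHa scaler_sumr; apply: eq_bigr => i _; rewrite scalerA.
Qed.

Fixpoint mcoef_eq n e1 e2 : Prop :=
  if n is n'.+1 then mcoef e1 n' = mcoef e2 n' /\ mcoef_eq n' e1 e2 else True.

(** Two linear expressions agree when all their coefficients do; the tactic
    [lmod_eq] reduces an identity between vectors to ring identities in the scalars. *)
Lemma meval_eq env e1 e2 : mcoef_eq (size env) e1 e2 ->
  meval env e1 = meval env e2.
Proof.
move=> h; rewrite !meval_coef; apply: eq_bigr => -[i /= i_n] _; congr (_ *: _).
elim: (size env) h i_n => [//|n IH] [hn /IH{}IH].
by rewrite ltnS leq_eqVlt => /orP[/eqP->|/IH].
Qed.

End ModuleIdentities.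

Ltac mod_mem x l :=
  lazymatch l with
  | nil => constr:(false)
  | cons x _ => constr:(true)
  | cons _ ?l' => mod_mem x l'
  end.

Ltac mod_index x l :=
  lazymatch l with
  | cons x _ => constr:(0%N)
  | cons _ ?l' => let n := mod_index x l' in constr:(S n)
  end.

Ltac mod_atoms t l :=
  lazymatch t with
  | (?a + ?b)%R => let l1 := mod_atoms a l in mod_atoms b l1
  | (- ?a)%R => mod_atoms a l
  | (_ *: ?a)%R => mod_atoms a l
  | 0%R => l
  | _ => let b := mod_mem t l in
         lazymatch b with true => l | false => constr:(cons t l) end
  end.

Ltac mod_reify K t l :=
  lazymatch t with
  | (?a + ?b)%R => let x := mod_reify K a l in let y := mod_reify K b l in
                   constr:(@MAdd K x y)
  | (- ?a)%R => let x := mod_reify K a l in constr:(@MOpp K x)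
  | (?c *: ?a)%R => let x := mod_reify K a l in constr:(@MScale K c x)
  | 0%R => constr:(@MZero K)
  | _ => let n := mod_index t l in constr:(@MVar K n)
  end.

Ltac lmod_reduce K :=
  lazymatch goal with
  | |- @eq ?V ?a ?b =>
    let l0 := mod_atoms a (@nil V) in
    let l := mod_atoms b l0 in
    let x := mod_reify K a l in
    let y := mod_reify K b l in
    refine (@meval_eq _ _ l x y _); cbn [mcoef_eq mcoef size eq_op];
    rewrite /=; repeat split
  end.

Ltac lmod_eq K := lmod_reduce K; ring.

(** * Real-valued norms and the extreme value theorem *)

Section NormRTheory.
Context {R : realType}.

Lemma normR0 (V : normedZmodType R[i]) : normR (0 : V) = 0.
Proof. by apply: complexI; rewrite normRE normr0. Qed.

Lemma normR_eq0 (V : normedZmodType R[i]) (x : V) : (normR x == 0) = (x == 0).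
Proof. by rewrite -(inj_eq (@complexI R)) normRE normr_eq0. Qed.

Lemma normR_gt0 (V : normedZmodType R[i]) (x : V) : (0 < normR x) = (x != 0).
Proof. by rewrite lt_def normR_ge0 andbT normR_eq0. Qed.

Lemma normRN (V : normedZmodType R[i]) (x : V) : normR (- x) = normR x.
Proof. by rewrite /normR normrN. Qed.

Lemma normR_distC (V : normedZmodType R[i]) (x y : V) :
  normR (x - y) = normR (y - x).
Proof. by rewrite /normR distrC. Qed.

Lemma normRB (V : normedZmodType R[i]) (x y : V) :
  normR (x - y) <= normR x + normR y.
Proof. by rewrite (le_trans (normRD _ _))// normRN. Qed.

Lemma normR_sub (V : normedZmodType R[i]) (x y : V) :
  normR x - normR y <= normR (x - y).
Proof. by rewrite lerBlDr (le_trans _ (normRD _ _))// subrK. Qed.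

Lemma normR_dist (V : normedZmodType R[i]) (x y : V) :
  `|normR x - normR y| <= normR (x - y).
Proof. by rewrite ler_norml lerNl opprB {1}normR_distC !normR_sub. Qed.

Lemma normR_sum (V : normedZmodType R[i]) n (u : nat -> V) :
  normR (\sum_(i < n) u i) <= \sum_(i < n) normR (u i).
Proof.
elim: n => [|n IH]; first by rewrite !big_ord0 normR0.
by rewrite !big_ord_recr /= (le_trans (normRD _ _))// lerD.
Qed.

Implicit Types z w : CC R.

Lemma normRM z w : normR (z * w) = normR z * normR w.
Proof. by apply: complexI; rewrite rmorphM /= !normRE normrM. Qed.

Lemma normR1 : normR (1 : CC R) = 1.
Proof. by apply: complexI; rewrite normRE normr1. Qed.

Lemma normRX z n : normR (z ^+ n) = normR z ^+ n.
Proof.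
by elim: n => [|n IH]; rewrite ?expr0 ?normR1// !exprS normRM IH.
Qed.

Lemma normRV z : normR (z^-1) = (normR z)^-1.
Proof. by apply: complexI; rewrite fmorphV /= !normRE normfV. Qed.

Lemma normR_real (x : R) : normR (x%:C%C : CC R) = `|x|.
Proof. by rewrite /normR normc_def /= expr0n addr0 sqrtr_sqr. Qed.

Lemma normR_ge_Re z : `|complex.Re z| <= normR z.
Proof. by rewrite -lecR normRE normc_ge_Re. Qed.

Lemma Re_le_normR z : complex.Re z <= normR z.
Proof. by rewrite (le_trans (ler_norm _))// normR_ge_Re. Qed.

Lemma normR_sqr z : normR z ^+ 2 = complex.Re z ^+ 2 + complex.Im z ^+ 2.
Proof.
by apply: complexI; rewrite rmorphXn /= normRE -add_Re2_Im2.
Qed.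

Lemma normR_le_ReIm z : normR z <= `|complex.Re z| + `|complex.Im z|.
Proof.
rewrite -(@ler_pXn2r _ 2)// ?nnegrE ?normR_ge0 ?addr_ge0//.
rewrite normR_sqr sqrrD !real_normK ?num_real//.
by rewrite addrAC lerDl mulrn_wge0// mulr_ge0.
Qed.

(** The imaginary part vanishes since [|z|^2 = (Re z)^2 + (Im z)^2]. *)
Lemma Re_eq_normR z : normR z <= complex.Re z -> z = (normR z)%:C%C.
Proof.
move=> h; have e : complex.Re z = normR z.
  by apply/eqP; rewrite eq_le h Re_le_normR.
have /eqP := normR_sqr z; rewrite -e -{1}[_ ^+ 2]addr0 => /eqP/addrI/esym/eqP.
rewrite sqrf_eq0 => /eqP i0.
by rewrite [LHS]complexE i0 mulr0 addr0.
Qed.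

Lemma nbhs_normR (V : normedModType R[i]) (x : V) (A : set V) :
  nbhs x A <-> exists2 e : R, 0 < e & forall y, normR (y - x) < e -> A y.
Proof.
split=> [/nbhs_normP[e /= e0 eA]|[e e0 eA]].
  have eR : (complex.Re e)%:C%C = e by rewrite RRe_real// gtr0_real.
  exists (complex.Re e); first by rewrite -ltcR eR.
  by move=> y; rewrite -ltcR eR normRE distrC; exact: eA.
apply/nbhs_normP; exists (e%:C)%C => /=; first by rewrite ltcR.
by move=> y /=; rewrite -normRE ltcR normR_distC; exact: eA.
Qed.

Lemma cvg_seq_normR (V : normedModType R[i]) (u : nat -> V) (l : V) :
  u @ \oo --> l <->
  forall e : R, 0 < e -> exists n0, forall n, (n0 <= n)%N -> normR (u n - l) < e.
Proof.
split=> [ul e e0|h].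
  have /ul[n0 _ h] : nbhs l [set y | normR (y - l) < e].
    by apply/nbhs_normR; exists e.
  by exists n0 => n; exact: h.
move=> A /nbhs_normR[e e0 eA]; have [n0 hn] := h _ e0.
by exists n0 => // n /= /hn /eA.
Qed.

(** An error term that is geometric along a subsequence disappears; all limits of
    Taylor expansions below are taken through this lemma. *)
Lemma le_geometric (q x y c : R) : 0 <= q < 1 ->
  (forall n0, exists2 n, (n0 <= n)%N & x <= y + c * q ^+ n) -> x <= y.
Proof.
move=> /andP[q0 q1] h; apply/ler_addgt0Pr => e e0.
have c1 : 0 < `|c| + 1 by rewrite ltr_wpDl.
have /cvgrPdist_lt/(_ _ (divr_gt0 e0 c1))[n0 _ hn] : (q ^+ n) @[n --> \oo] --> 0.
  by apply: cvg_expr; rewrite ger0_norm.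
have [n /hn /=] := h n0; rewrite sub0r normrN ger0_norm ?exprn_ge0// => qn.
move/le_trans; apply; rewrite lerD2l.
apply: (le_trans (ler_wpM2r _ (ler_norm c))); first exact: exprn_ge0.
apply: (@le_trans _ _ (`|c| * (e / (`|c| + 1)))).
  by rewrite ler_wpM2l// ltW.
by rewrite mulrCA ler_piMr ?ltW// ltr_pdivrMr// mul1r ltrDl.
Qed.

(** Continuity at a point in real terms: the topology of the plane is stated with
    radii in [R[i]]. *)
Definition ctsR (h : CC R -> R) z := forall e : R, 0 < e ->
  exists2 d : R, 0 < d & forall w, normR (w - z) < d -> `|h w - h z| < e.

Lemma ctsRP h z : ctsR h z <-> {for z, continuous h}.
Proof.
split=> [hz|hz e e0].
  rewrite /prop_for /continuous_at; move=> A /nbhs_ballP[e /= /hz[d d0 hd] eA].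
  apply/nbhs_normR; exists d => // w /hd hw.
  by apply: eA; rewrite /ball /= distrC.
have /nbhs_normR[d d0 hd] := hz _ (nbhsx_ballx (h z) e e0).
by exists d => // w /hd; rewrite /ball /= distrC.
Qed.

(** A square is the image of a product of two compact segments. *)
Lemma compact_square (r : R) :
  compact [set z : CC R | `|complex.Re z| <= r /\ `|complex.Im z| <= r].
Proof.
pose f (p : R * R) : CC R := (p.1 +i* p.2)%C.
have -> : [set z : CC R | `|complex.Re z| <= r /\ `|complex.Im z| <= r] =
    f @` (`[- r, r] `*` `[- r, r]).
  apply/seteqP; split=> [[a b] /= [ha hb]|_ [[a b] /= [ha hb] <-]].
    exists (a, b) => //=; split; rewrite /= in_itv /=.
      by rewrite -ler_norml.
    by rewrite -ler_norml.
  by move: ha hb; rewrite !in_itv /= !ler_norml.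
apply: continuous_compact; last first.
  by apply: compact_setX; exact: segment_compact.
apply: continuous_subspaceT => -[a b] A /nbhs_normR[e e0 eA].
have e2 : 0 < e / 2 by rewrite divr_gt0.
exists (ball a (e / 2), ball b (e / 2)); first by split; exact: nbhsx_ballx.
move=> [c d] /= [ac bd]; apply: eA.
rewrite (le_lt_trans (normR_le_ReIm _))//= (splitr e) ltrD//.
  by rewrite distrC.
by rewrite distrC.
Qed.

(** The maximum is taken on the part of a closed ball where [0 <= k]; with
    [k = 0] this is the ball itself, and other choices of [k] give circles, annuli and
    superlevel sets. *)
Lemma EVT_ball c (r : R) (k h : CC R -> R) :
  (forall z, normR (z - c) <= r -> ctsR k z /\ ctsR h z) ->
  (exists2 z, normR (z - c) <= r & 0 <= k z) ->
  exists2 z, normR (z - c) <= r /\ 0 <= k z &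
    forall w, normR (w - c) <= r -> 0 <= k w -> h w <= h z.
Proof.
move=> kh [z0 z0r kz0].
pose A := [set z : CC R | normR (z - c) <= r /\ 0 <= k z].
have cA : compact A.
  pose r' := r + normR c.
  apply: (subclosed_compact _ (@compact_square r')).
    rewrite -openC openE => z /= Az; rewrite /interior.
    have [zr|rz] := leP (normR (z - c)) r.
      have [kz|kz] := leP 0 (k z); first by exfalso; apply: Az.
      have [kc _] := kh _ zr.
      have [|d d0 hd] := kc (- k z); first by rewrite oppr_gt0.
      apply/nbhs_normR; exists d => // w /hd wd /= [_ kw].
      move: wd; apply/negP; rewrite -leNgt (le_trans _ (ler_norm _))//.
      by rewrite lerDr.
    apply/nbhs_normR; exists (normR (z - c) - r); first by rewrite subr_gt0.
    move=> w wz [wr _]; have := normRB (w - c) (w - z).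
    have -> : w - c - (w - z) = z - c by ring.
    by move: wz wr; lra.
  move=> z [zr _].
  have zr' : normR z <= r'.
    by rewrite -[z](subrK c) (le_trans (normRD _ _))// lerD2r.
  split; first by rewrite (le_trans (normR_ge_Re _)).
  rewrite (le_trans _ zr')//.
  rewrite -(@ler_pXn2r _ 2)// ?nnegrE ?normR_ge0//.
  by rewrite normR_sqr real_normK ?num_real// lerDr sqr_ge0.
have [||x] := @compact_EVT_max _ R h A _ cA.
- by exists z0.
- apply: continuous_in_subspaceT => z; rewrite inE => -[zr _].
  by have [_ /ctsRP] := kh _ zr.
- by rewrite inE => -[xr kx] hx; exists x => // w wr kw; apply: hx; rewrite inE.
Qed.

End NormRTheory.

(** * Taylor expansions with geometric remainders *)

Section Taylor.
Context {R : realType} {V : normedModType R[i]}.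
Implicit Types (f g : CC R -> V) (z w h : CC R) (a : nat -> V) (M K d e : R).

Definition psum a n h : V := \sum_(i < n) h ^+ i *: a i.

Definition coef_bound a (M K : R) := forall n, normR (a n) <= M * K ^+ n.

(** The form in which analyticity is used: the [n]-th remainder is bounded by
    a geometric sequence on a whole disc around the center, so that operations on
    power series become estimates on finite sums, for each [n]. *)
Definition taylor f z a (M K : R) := forall h n, K * normR h <= 1 ->
  normR (f (z + h) - psum a n h) <= M * (K * normR h) ^+ n.

Definition taylor_at f z a := exists M K : R, [/\ 0 <= M, 0 < K & taylor f z a M K].

Lemma psumS a n h : psum a n.+1 h = psum a n h + h ^+ n *: a n.
Proof. by rewrite /psum big_ord_recr. Qed.

Lemma psumSl a n h : psum a n.+1 h = a 0%N + h *: psum (fun i => a i.+1) n h.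
Proof.
rewrite /psum big_ord_recl /= expr0 scale1r scaler_sumr; congr (_ + _).
by apply: eq_bigr => i _; rewrite scalerA -exprS.
Qed.

Lemma psum0 a h : psum a 0 h = 0.
Proof. by rewrite /psum big_ord0. Qed.

Lemma psum_at0 a n : (0 < n)%N -> psum a n 0 = a 0%N.
Proof. by case: n => // n _; rewrite psumSl scale0r addr0. Qed.

(** With ratio at most 1/2, a geometric tail is at most twice its first term. *)
Lemma psum_tail a M K n m h : 0 <= M -> 0 < K -> coef_bound a M K ->
  K * normR h <= 2^-1 ->
  normR (psum a (n + m) h - psum a n h) <= 2 * M * (K * normR h) ^+ n.
Proof.
move=> M0 K0 aM hK; set q := K * normR h.
have q0 : 0 <= q by rewrite mulr_ge0 ?normR_ge0// ltW.
suff : normR (psum a (n + m) h - psum a n h) <= M * q ^+ n * \sum_(0 <= i < m) q ^+ i.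
  move/le_trans; apply; rewrite mulrC mulrA ler_wpM2r ?exprn_ge0// ler_wpM2r//.
  exact: geo2_le2.
elim: m => [|m IH]; first by rewrite addn0 subrr normR0 big_geq ?mulr0.
rewrite addnS psumS addrAC big_nat_recr//= mulrDr (le_trans (normRD _ _))// lerD//.
rewrite normRZ normRX -mulrA -exprD.
apply: (le_trans (ler_wpM2l _ (aM _))); first by rewrite exprn_ge0 ?normR_ge0.
by rewrite /q exprMn mulrCA [X in M * X]mulrC.
Qed.

(** Convergence with bounded coefficients upgrades to geometric remainders. *)
Lemma taylorI f z a M K d : 0 <= M -> 0 < K -> coef_bound a M K -> 0 < d ->
  (forall h, normR h < d -> psum a ^~ h @ \oo --> f (z + h)) -> taylor_at f z a.
Proof.
move=> M0 K0 aM d0 af.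
(* so that [K' |h| <= 1] gives both [K |h| <= 1/2] and [|h| < d] *)
pose K' := 2 * K + 2 / d.
have K'0 : 0 < K' by rewrite addr_gt0 ?mulr_gt0 ?invr_gt0.
exists (2 * M), K'; split => //; first by rewrite mulr_ge0.
move=> h n hK'; have h0 := normR_ge0 h.
have hd : normR h < d.
  have : 2 / d * normR h <= 1.
    by rewrite (le_trans _ hK')// ler_wpM2r// lerDr mulr_ge0// ltW.
  by rewrite mulrAC ler_pdivrMr// mul1r; move: h0; lra.
have hK : K * normR h <= 2^-1.
  have : 2 * K * normR h <= 1.
    by rewrite (le_trans _ hK')// ler_wpM2r// lerDl divr_ge0// ltW.
  by rewrite -mulrA mulrC -ler_pdivlMr// mul1r.
have KK' : K * normR h <= K' * normR h.
  have d2 : 0 <= 2 / d by rewrite divr_ge0// ltW.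
  by rewrite ler_wpM2r// /K'; move: K0 d2; lra.
apply: (@le_trans _ _ (2 * M * (K * normR h) ^+ n)); last first.
  rewrite ler_wpM2l ?mulr_ge0// lerXn2r// nnegrE mulr_ge0// ltW//.
apply/ler_addgt0Pr => e e0.
have /cvg_seq_normR/(_ _ e0)[n0 hn] := af _ hd.
have := hn (n + n0)%N (leq_addl _ _); rewrite normR_distC => h1.
have h2 := psum_tail n n0 M0 K0 aM hK.
rewrite (_ : f (z + h) - psum a n h = (psum a (n + n0) h - psum a n h) +
    (f (z + h) - psum a (n + n0) h)); last by lmod_eq R[i].
by rewrite (le_trans (normRD _ _))// lerD// ltW.
Qed.

Lemma analytic_taylor f z : analytic_at f z -> exists a, taylor_at f z a.
Proof.
move=> [a /nbhs_normR[e /= e0 fa]]; exists a.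
have {}fa h : normR h < e -> psum a ^~ h @ \oo --> f (z + h).
  move=> he; have := fa (z + h); rewrite addrAC subrr add0r => /(_ he).
  by apply: cvg_trans; apply: near_eq_cvg; near=> n; rewrite /psum /series /= big_mkord.
pose r : R := e / 2.
have r0 : 0 < r by rewrite divr_gt0.
have rC : normR (r%:C%C : CC R) = r by rewrite normR_real gtr0_norm.
have re : normR (r%:C%C : CC R) < e by rewrite rC /r ltr_pdivrMr// ltr_pMr// ltr1n.
have [M M0 aM] : exists2 M : R, 0 <= M & forall n, normR (((r%:C)%C : CC R) ^+ n *: a n) <= M.
  have /cvg_seq_bounded/pinfty_ex_gt0[M M0 /= aM] :
      cvgn (fun n => ((r%:C)%C : CC R) ^+ n *: a n).
    apply: cvgP; apply: cvg_series_cvg_0; apply: cvgP.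
    have := fa _ re; apply: cvg_trans; apply: near_eq_cvg; near=> n.
    by rewrite /psum /series /= big_mkord.
  exists (complex.Re M); first by rewrite -lecR RRe_real ?gtr0_real// ltW.
  by move=> n; rewrite -lecR normRE RRe_real ?gtr0_real//; exact: aM.
apply: (@taylorI _ _ _ M r^-1 e) => //; first by rewrite invr_gt0.
move=> n; have := aM n; rewrite normRZ normRX rC exprVn.
by rewrite -ler_pdivlMl ?exprn_gt0// mulrC.
Unshelve. all: by end_near. Qed.

Lemma taylor_cvg f z a M K h : 0 <= M -> 0 < K -> taylor f z a M K -> K * normR h < 1 ->
  psum a ^~ h @ \oo --> f (z + h).
Proof.
move=> M0 K0 fa hK; apply/cvg_seq_normR => e e0.
set q := K * normR h in hK.
have q0 : 0 <= q by rewrite mulr_ge0 ?normR_ge0// ltW.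
have M1 : 0 < M + 1 by rewrite ltr_wpDl.
have /cvgrPdist_lt/(_ _ (divr_gt0 e0 M1))[n0 _ hn] : (q ^+ n) @[n --> \oo] --> 0.
  by apply: cvg_expr; rewrite ger0_norm.
exists n0 => n /hn /=; rewrite sub0r normrN ger0_norm ?exprn_ge0// => qn.
rewrite normR_distC; apply: (le_lt_trans (fa _ _ (ltW hK))).
apply: (@le_lt_trans _ _ ((M + 1) * q ^+ n)).
  by rewrite ler_wpM2r ?exprn_ge0// lerDl.
by rewrite mulrC -ltr_pdivlMr.
Qed.

Lemma taylor_analytic f z a : taylor_at f z a -> analytic_at f z.
Proof.
move=> [M [K [M0 K0 fa]]]; exists a; apply/nbhs_normR.
exists K^-1; first by rewrite invr_gt0.
move=> w wz; have hK : K * normR (w - z) < 1 by rewrite mulrC -ltr_pdivlMr ?div1r.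
have := taylor_cvg M0 K0 fa hK; rewrite [z + _]addrC subrK; apply: cvg_trans.
by apply: near_eq_cvg; near=> n; rewrite /psum /series /= big_mkord.
Unshelve. all: by end_near. Qed.

Lemma taylor_value f z a : taylor_at f z a -> f z = a 0%N.
Proof.
move=> [M [K [M0 K0 fa]]]; have := fa 0 1%N.
rewrite normR0 mulr0 ler01 => /(_ isT); rewrite expr1 mulr0 addr0 psum_at0//.
by move=> h; apply/eqP; rewrite -subr_eq0 -normR_eq0 eq_le h normR_ge0.
Qed.

(** Two consecutive remainders differ by one term of the series, evaluated here
    on the circle of radius [1 / K]. *)
Lemma taylor_coef_bound f z a M K : 0 <= M -> 0 < K -> taylor f z a M K ->
  coef_bound a (2 * M) K.
Proof.
move=> M0 K0 fa n; pose h : CC R := (K^-1)%:C%C.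
have hR : normR h = K^-1 by rewrite normR_real gtr0_norm// invr_gt0.
have hK : K * normR h = 1 by rewrite hR divff// gt_eqF.
have h1 := fa h n; have h2 := fa h n.+1; rewrite hK !expr1n mulr1 lexx in h1 h2.
have := normRB (f (z + h) - psum a n h) (f (z + h) - psum a n.+1 h).
rewrite (_ : _ - _ = h ^+ n *: a n); last by rewrite psumS; lmod_eq R[i].
rewrite normRZ normRX hR exprVn => h3.
rewrite mulrC -ler_pdivrMl ?exprn_gt0//.
by move: h3 (h1 isT) (h2 isT); lra.
Qed.

End Taylor.

(** * Complex derivatives *)

Section Derivative.
Context {R : realType} {V : normedModType R[i]}.
Implicit Types (f g : CC R -> V) (z w h : CC R) (a : nat -> V) (M K d e : R).

Definition ctsV f z := forall e, 0 < e ->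
  exists2 d, 0 < d & forall w, normR (w - z) < d -> normR (f w - f z) < e.

Lemma ctsV_normR f z : ctsV f z -> ctsR (fun w => normR (f w)) z.
Proof.
move=> fz e /fz[d d0 hd]; exists d => // w /hd; apply: le_lt_trans.
by rewrite ler_norml lerNl opprB [X in _ - _ <= X]normR_distC !normR_sub.
Qed.

(** The first order expansion of [f] at [z], with radii in [R]: it is stable under
    the operations below without any discussion of limits. *)
Definition derR f z (D : V) := forall e, 0 < e -> exists2 d, 0 < d &
  forall h, normR h < d -> normR (f (z + h) - f z - h *: D) <= e * normR h.

Lemma derR_derive1 f z D : derR f z D -> derive1 f z = D.
Proof.
move=> fD; rewrite /derive1; apply: cvg_lim => //.
move=> A /nbhs_normR[e e0 eA]; have [d d0 hd] := fD _ (divr_gt0 e0 (ltr0Sn _ 1)).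
apply/nbhs_normR; exists d => // h; rewrite subr0 => /hd + h0.
have hp : 0 < normR h by rewrite normR_gt0.
move=> hh; apply: eA => /=.
rewrite (_ : _ - D = h^-1 *: (f (z + h) - f z - h *: D)); last first.
  by rewrite [RHS]scalerBr scalerA mulVf// scale1r addrC [h + z]addrC addrC.
rewrite normRZ normRV -ltr_pdivlMl ?invr_gt0// invrK (le_lt_trans hh)//.
by rewrite mulrC ltr_pM2l// ltr_pdivrMr// ltr_pMr// ltr1n.
Qed.

Lemma derivable_derR f z : derivable f z 1 -> derR f z (derive1 f z).
Proof.
rewrite derive1E => fz e e0.
have /nbhs_normR[d d0 hd] : (\forall h \near (0 : CC R)^',
   normR (h^-1 *: ((f \o shift z) (h *: 1) - f z) - 'D_1 f z) < e).
  have {}fz : (fun h => h^-1 *: ((f \o shift z) (h *: 1) - f z)) @ (0 : CC R)^' --> 'D_1 f z.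
    exact: fz.
  by apply: (fz [set v | normR (v - 'D_1 f z) < e]); apply/nbhs_normR; exists e.
exists d => // h hd'.
have [->|h0] := eqVneq h 0.
  by rewrite addr0 subrr scale0r subr0 !normR0 mulr0.
have := hd h; rewrite subr0 => /(_ hd' h0) /= hh.
have hp : 0 < normR h by rewrite normR_gt0.
rewrite (_ : _ - _ = h *: (h^-1 *: (f (h *: 1 + z) - f z) - 'D_1 f z)); last first.
  rewrite scalerBr scalerA mulfV// scale1r; congr (f _ - _ - _).
  by rewrite addrC; congr (_ + _); rewrite [RHS]mulr1.
by rewrite normRZ mulrC ler_wpM2r ?normR_ge0// ltW.
Qed.

Lemma analytic_derR f z : analytic_at f z -> derR f z (derive1 f z).
Proof. by move=> /analytic_at_derivable/derivable_derR. Qed.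

Lemma derR_cts f z D : derR f z D -> ctsV f z.
Proof.
move=> /(_ 1 ltr01)[d d0 hd] e e0.
pose C := 1 + normR D; have C0 : 0 < C by rewrite ltr_pwDl// normR_ge0.
exists (Num.min d (e / C)); first by rewrite lt_min d0 divr_gt0.
move=> w; rewrite lt_min => /andP[wd we]; have := hd _ wd.
rewrite [z + _]addrC subrK mul1r => h1.
have := normRD (f w - f z - (w - z) *: D) ((w - z) *: D).
rewrite subrK normRZ => h2.
apply: (@le_lt_trans _ _ (C * normR (w - z))).
  by rewrite /C mulrDl mul1r [normR D * _]mulrC; move: h1 h2; lra.
by rewrite mulrC -ltr_pdivlMr.
Qed.

Lemma analytic_cts f z : analytic_at f z -> ctsV f z.
Proof. by move=> /analytic_derR/derR_cts. Qed.

Lemma derR_lin (c : CC R) f g z D D' : derR f z D -> derR g z D' ->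
  derR (fun w => c *: f w + g w) z (c *: D + D').
Proof.
move=> fD gD e e0; have c1 : 0 < normR c + 1 by rewrite ltr_wpDl ?normR_ge0.
have [d1 d10 h1] := fD _ (divr_gt0 e0 (mulr_gt0 (ltr0Sn _ 1) c1)).
have [d2 d20 h2] := gD _ (divr_gt0 e0 (ltr0Sn _ 1)).
exists (Num.min d1 d2) => [|h]; first by rewrite lt_min d10.
rewrite lt_min => /andP[/h1 {}h1 /h2 {}h2].
rewrite (_ : _ - _ = c *: (f (z + h) - f z - h *: D) +
   (g (z + h) - g z - h *: D')); last by lmod_eq R[i].
rewrite (le_trans (normRD _ _))// (splitr e) mulrDl lerD// normRZ.
apply: (@le_trans _ _ ((normR c + 1) * (e / (2 * (normR c + 1)) * normR h))).
  by rewrite ler_pM ?normR_ge0// lerDl.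
by rewrite mulrA; rewrite le_eqVlt; apply/orP; left; apply/eqP; field; rewrite gt_eqF.
Qed.

(** It suffices to bound the remainders by [C / 2^n] on some fixed disc, which
    is what the estimates on composed and differentiated series provide. *)
Lemma taylor_of_geometric f z a C d : 0 < d ->
  (forall h n, normR h <= d -> normR (f (z + h) - psum a n h) <= C * 2^-1 ^+ n) ->
  taylor_at f z a.
Proof.
move=> d0 hC; have C0 : 0 <= C.
  have := hC 0 0%N; rewrite normR0 (ltW d0) expr0 mulr1 => /(_ isT).
  by apply: le_trans; exact: normR_ge0.
apply: (@taylorI _ _ _ _ _ (2 * C) d^-1 d) => //.
- by rewrite mulr_ge0.
- by rewrite invr_gt0.
- move=> n; pose h : CC R := d%:C%C.
  have hR : normR h = d by rewrite normR_real gtr0_norm.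
  have h1 := hC h n; have h2 := hC h n.+1; rewrite hR lexx in h1 h2.
  have := normRB (f (z + h) - psum a n h) (f (z + h) - psum a n.+1 h).
  rewrite (_ : _ - _ = h ^+ n *: a n); last by rewrite psumS; lmod_eq R[i].
  rewrite normRZ normRX hR exprVn => h3.
  rewrite mulrC -ler_pdivrMl ?invr_gt0 ?exprn_gt0// invrK (le_trans h3)//.
  have q0 : 0 <= C * 2^-1 ^+ n by rewrite mulr_ge0 ?exprn_ge0.
  have q1 : C * 2^-1 ^+ n <= C.
    by rewrite ler_piMr// exprn_ile1// invf_le1// ler1n.
  by move: (h1 isT) (h2 isT) q0 q1; rewrite exprS mulrCA; lra.
- move=> h hd; apply/cvg_seq_normR => e e0.
  have C1 : 0 < C + 1 by rewrite ltr_wpDl.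
  have /cvgrPdist_lt/(_ _ (divr_gt0 e0 C1))[n0 _ hn] : ((2^-1 : R) ^+ n) @[n --> \oo] --> 0.
    by apply: cvg_expr; rewrite ger0_norm// invf_lt1// ltr1n.
  exists n0 => n /hn /=; rewrite sub0r normrN ger0_norm ?exprn_ge0// => qn.
  rewrite normR_distC; apply: (le_lt_trans (hC _ _ (ltW hd))).
  apply: (@le_lt_trans _ _ ((C + 1) * 2^-1 ^+ n)).
    by rewrite ler_wpM2r ?exprn_ge0// lerDl.
  by rewrite mulrC -ltr_pdivlMr.
Qed.

End Derivative.

(** * Linear maps and operations on Taylor expansions *)

Section LinearMaps.
Context {K : pzRingType} {V W : lmodType K} (A : V -> W).
Hypothesis lA : linear A.

Lemma lin0 : A 0 = 0.
Proof. by have := lA (-1) 0 0; rewrite scaleN1r oppr0 addr0 scaleN1r addNr. Qed.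

Lemma linD x y : A (x + y) = A x + A y.
Proof. by have := lA 1 x y; rewrite !scale1r. Qed.

Lemma linZ c x : A (c *: x) = c *: A x.
Proof. by have := lA c x 0; rewrite !addr0 lin0 addr0. Qed.

Lemma linN x : A (- x) = - A x.
Proof. by rewrite -scaleN1r linZ scaleN1r. Qed.

Lemma linB x y : A (x - y) = A x - A y.
Proof. by rewrite linD linN. Qed.

Lemma lin_sum n (u : nat -> V) : A (\sum_(i < n) u i) = \sum_(i < n) A (u i).
Proof.
by elim: n => [|n IH]; rewrite ?big_ord0 ?lin0// !big_ord_recr /= linD IH.
Qed.

End LinearMaps.

Section TaylorOps.
Context {R : realType} {V : normedModType R[i]}.
Implicit Types (f g : CC R -> V) (z w h : CC R) (a : nat -> V) (M K d e : R).

Lemma analytic_linear (W : normedModType R[i]) (A : V -> W) c f z : 0 <= c ->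
  linear A -> (forall x, normR (A x) <= c * normR x) ->
  analytic_at f z -> analytic_at (A \o f) z.
Proof.
move=> c0 lA bA /analytic_taylor[a [M [K [M0 K0 fa]]]].
apply: (@taylor_analytic _ _ _ _ (A \o a)); exists (c * M), K; split => //.
  by rewrite mulr_ge0.
move=> h n hK; rewrite (_ : _ - _ = A (f (z + h) - psum a n h)); last first.
  rewrite linB// /psum (lin_sum lA _ (fun i => h ^+ i *: a i)); congr (_ - _).
  by apply: eq_bigr => i _; rewrite linZ.
by rewrite (le_trans (bA _))// -mulrA ler_wpM2l// fa.
Qed.

(** Multiplication by [c + d w = c' + d (w - z)] acts on the coefficients by
    [b_n = c' a_n + d a_(n-1)]. *)
Lemma analytic_mul_affine (c d : CC R) f z : analytic_at f z ->
  analytic_at (fun w => (c + d * w) *: f w) z.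
Proof.
move=> /analytic_taylor[a [M [K [M0 K0 fa]]]].
pose c' := c + d * z.
pose b n := if n is n'.+1 then c' *: a n'.+1 + d *: a n' else c' *: a 0%N.
have bE n h : psum b n.+1 h = c' *: psum a n.+1 h + (d * h) *: psum a n h.
  elim: n => [|n IH].
    by rewrite !psumS !psum0 expr0 /b /=; lmod_eq R[i].
  rewrite psumS IH /b [in RHS]psumS (psumS a n h) exprS.
  by lmod_eq R[i].
pose M' := (normR c' + normR d / K) * M.
apply: (@taylor_analytic _ _ _ _ b); exists M', K; split => //.
  by rewrite mulr_ge0// addr_ge0 ?divr_ge0 ?normR_ge0// ltW.
move=> h n hK; pose q := K * normR h.
have q0 : 0 <= q by rewrite mulr_ge0 ?normR_ge0// ltW.
have hq : normR h = q / K by rewrite /q mulrC mulKf// gt_eqF.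
have key m : normR ((c + d * (z + h)) *: f (z + h) - psum b m.+1 h) <= M' * q ^+ m.+1.
  rewrite (_ : _ - _ = c' *: (f (z + h) - psum a m.+1 h) +
      (d * h) *: (f (z + h) - psum a m h)); last by rewrite bE /c'; lmod_eq R[i].
  rewrite (le_trans (normRD _ _))// !normRZ /M' !mulrDl lerD//.
    by rewrite -mulrA ler_wpM2l ?normR_ge0// fa.
  rewrite hq exprS.
  rewrite (_ : _ * M * _ = normR d * (q / K) * (M * q ^+ m)); last by ring.
  by rewrite ler_wpM2l ?fa// mulr_ge0 ?normR_ge0// divr_ge0// ltW.
case: n => [|m]; last exact: key.
rewrite psum0 subr0 expr0 mulr1 normRZ /M'.
have := fa h 0%N hK; rewrite psum0 subr0 expr0 mulr1 => fM.
apply: ler_pM; rewrite ?normR_ge0//.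
rewrite (_ : _ + _ = c' + d * h); last by rewrite /c'; ring.
rewrite (le_trans (normRD _ _))// lerD2l normRM ler_wpM2l ?normR_ge0//.
by rewrite -[K^-1]mulr1 ler_pdivlMl.
Qed.

Lemma analytic_eq_near f g z (e : R) : 0 < e ->
  (forall w, normR (w - z) < e -> f w = g w) -> analytic_at f z -> analytic_at g z.
Proof.
move=> e0 fg [a /nbhs_normR[d d0 ha]]; exists a; apply/nbhs_normR.
exists (Num.min e d); first by rewrite lt_min e0.
by move=> w; rewrite lt_min => /andP[/fg <- /ha].
Qed.

Lemma analytic_cst (x : V) z : analytic_at (fun=> x) z.
Proof.
apply: (@taylor_analytic _ _ _ _ (fun n => if n is 0%N then x else 0)).
exists (normR x), 1; split; rewrite ?normR_ge0//.
move=> h [|n] _; first by rewrite psum0 subr0 expr0 mulr1.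
rewrite psumSl /psum big1 => [|i _]; last by rewrite scaler0.
by rewrite scaler0 addr0 subrr normR0 mulr_ge0 ?exprn_ge0 ?mul1r ?normR_ge0.
Qed.

Lemma taylor_zero f z a : taylor_at f z a -> (forall n, a n = 0) ->
  exists2 d, 0 < d & forall w, normR (w - z) < d -> f w = 0.
Proof.
move=> [M [K [M0 K0 fa]]] a0; exists (2^-1 / K); first by rewrite divr_gt0.
move=> w wK; apply/eqP; rewrite -normR_eq0 eq_le normR_ge0 andbT.
apply: (@le_geometric _ 2^-1 _ _ M); first by rewrite invr_ge0 ler0n invf_lt1// ltr1n.
move=> n; exists n => //; rewrite add0r.
have wK' : K * normR (w - z) <= 2^-1 by rewrite mulrC -ler_pdivlMr// ltW.
have := fa (w - z) n (le_trans wK' _); rewrite invf_le1// ler1n => /(_ isT).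
rewrite [z + _]addrC subrK /psum big1 ?subr0 => [|i _]; last by rewrite a0 scaler0.
move/le_trans; apply; rewrite ler_wpM2l// lerXn2r// nnegrE ?invr_ge0//.
by rewrite mulr_ge0 ?normR_ge0// ltW.
Qed.

(** The quotient by [(w - z)^k] of a function vanishing to order [k], completed at
    [z], is again analytic: its coefficients are shifted by [k]. *)
Lemma taylor_div f z a k : taylor_at f z a -> (forall i, (i < k)%N -> a i = 0) ->
  taylor_at (fun w => if w == z then a k else (w - z) ^- k *: f w) z
    (fun n => a (k + n)%N).
Proof.
move=> [M [K [M0 K0 fa]]] ak.
have E n h : psum a (k + n) h = h ^+ k *: psum (fun n => a (k + n)%N) n h.
  elim: n => [|n IH]; last first.
    by rewrite addnS !psumS IH scalerDr scalerA exprD.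
  rewrite addn0 psum0 scaler0 /psum big1// => -[i ik] _ /=.
  by rewrite ak// scaler0.
have M20 : 0 <= 2 * M * K ^+ k by rewrite !mulr_ge0 ?exprn_ge0// ltW.
exists (2 * M * K ^+ k), K; split => //.
move=> h n hK /=; rewrite (_ : z + h - z = h); last by ring.
have [hz|hz] := eqVneq (z + h) z.
  have h0 : h = 0 by apply: (@addrI _ z); rewrite addr0.
  case: n => [|n].
    by rewrite psum0 subr0 expr0 mulr1; apply: (taylor_coef_bound M0 K0 fa).
  rewrite h0 psum_at0// addn0 subrr normR0 mulr_ge0// exprn_ge0// mulr_ge0 ?normR_ge0//.
  exact: ltW.
have h0 : h != 0 by apply: contraNneq hz => ->; rewrite addr0.
have hp : 0 < normR h by rewrite normR_gt0.
have := fa h (k + n)%N hK; rewrite E => fk.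
rewrite (_ : _ - _ = h ^- k *: (f (z + h) - h ^+ k *: psum (fun n => a (k + n)%N) n h)).
  rewrite normRZ normRV normRX mulrC ler_pdivrMr ?exprn_gt0//.
  apply: (le_trans fk); rewrite exprD exprMn.
  rewrite (_ : _ * K ^+ k * _ * _ = 2 * (M * (K ^+ k * normR h ^+ k * (K * normR h) ^+ n))).
    by rewrite ler_peMl ?ler1n// !mulr_ge0 ?exprn_ge0 ?mulr_ge0 ?normR_ge0// ltW.
  by ring.
by rewrite scalerBr scalerA mulVf ?expf_neq0// scale1r.
Qed.

End TaylorOps.

(** * The derivative of an analytic function *)

Section TaylorDerivative.
Context {R : realType} {V : normedModType R[i]}.
Implicit Types (f g : CC R -> V) (z w h k : CC R) (a : nat -> V) (M K d e s : R).

Lemma normR_nat n : normR (n%:R : CC R) = n%:R.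
Proof. by apply: complexI; rewrite normRE normr_nat rmorph_nat. Qed.

Definition mono_rem h k n : CC R := (h + k) ^+ n - h ^+ n - k * (n%:R * h ^+ n.-1).

(** Induction on [n] from
    [(h + k)^(n+1) - h^(n+1) - (n+1) k h^n = (h + k) mono_rem h k n + n k^2 h^(n-1)]. *)
Lemma mono_rem_le h k s n : 0 <= s -> normR h <= s -> normR k <= s ->
  normR (mono_rem h k n) * s ^+ 2 <= normR k ^+ 2 * (4 * s) ^+ n.
Proof.
move=> s0 hs ks; elim: n => [|n IH].
  rewrite /mono_rem !expr0 mul0r mulr0 !subrr normR0 mul0r mulr1.
  by rewrite exprn_ge0 ?normR_ge0.
have -> : mono_rem h k n.+1 = (h + k) * mono_rem h k n + k ^+ 2 * (n%:R * h ^+ n.-1).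
  rewrite /mono_rem; case: n {IH} => [|n] /=; rewrite ?expr0 ?exprS ?expr0 -?natr1; ring.
have ts : normR (n%:R * h ^+ n.-1) * s ^+ 2 <= n%:R * s ^+ n.+1.
  rewrite normRM normRX normR_nat -mulrA.
  case: n {IH} => [|n] /=; first by rewrite !mul0r.
  rewrite ler_wpM2l// -[n.+2]addn2 exprD ler_wpM2r ?exprn_ge0//.
  by rewrite lerXn2r// nnegrE normR_ge0.
apply: (@le_trans _ _ (2 * s * (normR k ^+ 2 * (4 * s) ^+ n) +
    normR k ^+ 2 * (n%:R * s ^+ n.+1))).
  apply: (le_trans (ler_wpM2r (exprn_ge0 2 s0) (normRD _ _))).
  rewrite mulrDl (normRM (h + k)) (normRM (k ^+ 2)) normRX -!mulrA lerD//.
    rewrite [leRHS]mulrA ler_pM ?normR_ge0 ?mulr_ge0 ?normR_ge0 ?exprn_ge0//.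
    by rewrite (le_trans (normRD _ _))// mulr_natl mulr2n lerD.
    by rewrite mulrA; exact: IH.
  by rewrite 2?ler_wpM2l ?normR_ge0.
have n4 : (n%:R : R) <= 2 * 4 ^+ n.
  apply: (@le_trans _ _ (4 ^+ n)); last by rewrite ler_peMl ?ler1n// exprn_ge0.
  by rewrite -natrX ler_nat ltnW// ltn_expl.
rewrite [X in X + _](_ : _ = normR k ^+ 2 * s ^+ n.+1 * (2 * 4 ^+ n)); last first.
  by rewrite exprMn (exprS s); ring.
rewrite [X in _ + X](_ : _ = normR k ^+ 2 * s ^+ n.+1 * n%:R); last by ring.
rewrite [leRHS](_ : _ = normR k ^+ 2 * s ^+ n.+1 * (4 * 4 ^+ n)); last first.
  by rewrite (exprS (4 * s)) exprMn (exprS s); ring.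
rewrite -mulrDr ler_wpM2l ?mulr_ge0 ?exprn_ge0 ?normR_ge0//.
by move: n4; lra.
Qed.

(** The coefficients lose the factor [4^n] of [mono_rem_le] against
    [(4 K s)^n = 2^-n]. *)
Lemma psum_remainder a M K s h k n : 0 <= M -> 0 < K -> coef_bound a M K ->
  8 * K * s = 1 -> normR h <= s -> normR k <= s ->
  normR (psum a n.+1 (h + k) - psum a n.+1 h -
         k *: psum (fun i => i.+1%:R *: a i.+1) n h) <= 2 * M / s ^+ 2 * normR k ^+ 2.
Proof.
move=> M0 K0 aM Ks hs ks.
have s0 : 0 < s by rewrite -(pmulr_rgt0 _ (_ : 0 < 8 * K)) ?Ks ?mulr_gt0.
suff : normR (psum a n.+1 (h + k) - psum a n.+1 h -
         k *: psum (fun i => i.+1%:R *: a i.+1) n h) <=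
       M / s ^+ 2 * normR k ^+ 2 * \sum_(0 <= i < n.+1) 2^-1 ^+ i.
  move/le_trans; apply.
  rewrite [leRHS](_ : _ = M / s ^+ 2 * normR k ^+ 2 * 2); last by ring.
  rewrite ler_wpM2l ?geo2_le2 ?invr_ge0//.
  by rewrite mulr_ge0 ?divr_ge0 ?exprn_ge0 ?normR_ge0// ltW.
elim: n => [|n IH].
  rewrite !psumS !psum0 !expr0 big_nat1 expr0 mulr1.
  rewrite (_ : _ - _ = 0) ?normR0; last by lmod_eq R[i].
  by rewrite mulr_ge0 ?divr_ge0 ?exprn_ge0 ?normR_ge0// ltW.
rewrite big_nat_recr//= mulrDr.
rewrite [X in normR X](_ : _ = (psum a n.+1 (h + k) - psum a n.+1 h -
         k *: psum (fun i => i.+1%:R *: a i.+1) n h) + mono_rem h k n.+1 *: a n.+1); last first.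
  rewrite (psumS a n.+1 (h + k)) (psumS a n.+1 h) (psumS (fun i => i.+1%:R *: a i.+1) n h) /mono_rem /=.
  by lmod_eq R[i].
rewrite (le_trans (normRD _ _))// lerD// normRZ.
apply: (le_trans (ler_wpM2l (normR_ge0 _) (aM _))).
have := mono_rem_le n.+1 (ltW s0) hs ks; rewrite -ler_pdivlMr ?exprn_gt0// => h1.
apply: (le_trans (ler_wpM2r _ h1)); first by rewrite mulr_ge0 ?exprn_ge0// ltW.
rewrite le_eqVlt; apply/orP; left; apply/eqP.
have -> : (2^-1 : R) = 4 * s * K by move: Ks; lra.
by rewrite !exprMn; ring.
Qed.

(** The derivative exists near [z] by assumption, so only its expansion has to be
    found: at [z + h] the difference quotient with increment [k] is compared with the
    partial sums of the differentiated series, up to [O(k)] and to the tail of that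
    series; then [k] tends to 0. *)
Lemma analytic_derive1 f z d : 0 < d ->
  (forall w, normR (w - z) < d -> analytic_at f w) -> analytic_at (derive1 f) z.
Proof.
move=> d0 af.
have [a [M1 [K [M10 K0 fa]]]] : exists a, taylor_at f z a.
  by apply/analytic_taylor/af; rewrite subrr normR0.
pose M := 2 * M1; have M0 : 0 <= M by rewrite mulr_ge0.
have aM : coef_bound a M K := taylor_coef_bound M10 K0 fa.
pose b n := n.+1%:R *: a n.+1.
have bM : coef_bound b (M * K) (2 * K).
  move=> n; rewrite /b normRZ normR_nat.
  apply: (@le_trans _ _ (2 ^+ n * (M * K ^+ n.+1))); last first.
    by rewrite exprMn exprS le_eqVlt; apply/orP; left; apply/eqP; ring.
  by rewrite ler_pM ?normR_ge0// -natrX ler_nat ltn_expl.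
(* increments up to [s] keep [K |h + k|] below 1/4 *)
pose s := (8 * K)^-1; have Ks : 8 * K * s = 1 by rewrite divff// gt_eqF// mulr_gt0.
have s0 : 0 < s by rewrite invr_gt0 mulr_gt0.
pose T := 2 * (M * K).
have T0 : 0 <= T by rewrite !mulr_ge0// ltW.
apply: (@taylor_analytic _ _ _ _ b).
pose d' := Num.min s (d / 2); have d'0 : 0 < d' by rewrite lt_min s0 divr_gt0.
apply: (@taylor_of_geometric _ _ _ _ _ T d') => // h n; rewrite le_min => /andP[hs hd].
have hd2 : normR h < d by rewrite (le_lt_trans hd)// ltr_pdivrMr// ltr_pMr// ltr1n.
have hK : 2 * K * normR h <= 2^-1.
  apply: (@le_trans _ _ (2 * K * s)); first by rewrite ler_wpM2l// mulr_ge0// ltW.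
  by move: Ks; lra.
set Tn := T * _.
have tail m : normR (psum b (n + m) h - psum b n h) <= Tn.
  have := @psum_tail _ _ b (M * K) (2 * K) n m h _ _ bM hK.
  rewrite !mulr_ge0 ?mulr_gt0 ?(ltW K0)// => /(_ isT isT)/le_trans; apply.
  rewrite /Tn ler_wpM2l// lerXn2r// nnegrE ?mulr_ge0 ?normR_ge0 ?invr_ge0//.
  exact: ltW.
pose C := 2 * M / s ^+ 2.
have C0 : 0 <= C by rewrite divr_ge0 ?mulr_ge0 ?exprn_ge0// ltW.
have key k : normR k <= s -> normR (f (z + h + k) - f (z + h) - k *: psum b n h) <=
    C * normR k ^+ 2 + normR k * Tn.
  move=> ks.
  apply: (@le_geometric _ 4^-1 _ _ (2 * M1)).
    by rewrite invr_ge0 ler0n invf_lt1// ltr1n.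
  move=> m; exists (n + m).+1; first by rewrite leqW// leq_addl.
  have hk : K * normR (h + k) <= 4^-1.
    apply: (@le_trans _ _ (K * (s + s))).
      by rewrite ler_wpM2l ?(ltW K0)// (le_trans (normRD _ _))// lerD.
    by move: Ks; lra.
  have hh : K * normR h <= 4^-1 by move: hK; lra.
  have q1 : 4^-1 <= 1 :> R by rewrite invf_le1// ler1n.
  have t1 := fa _ (n + m).+1 (le_trans hk q1).
  have t2 := fa _ (n + m).+1 (le_trans hh q1).
  have t3 := psum_remainder (n + m) M0 K0 aM Ks hs ks.
  have e1 := ler_wpM2l M10 (lerXn2r (n + m).+1 _ _ hk).
  have e2 := ler_wpM2l M10 (lerXn2r (n + m).+1 _ _ hh).
  rewrite !nnegrE !mulr_ge0 ?normR_ge0 ?(ltW K0)// in e1 e2.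
  have q0 : 0 <= 4^-1 :> R by rewrite invr_ge0.
  have {e1}t1 := le_trans t1 (e1 isT q0); have {e2}t2 := le_trans t2 (e2 isT q0).
  have t4 := ler_wpM2l (normR_ge0 k) (tail m); rewrite -normRZ in t4; rewrite [z + (h + k)]addrA in t1.
  rewrite (_ : _ - _ = (f (z + h + k) - psum a (n + m).+1 (h + k)) -
    (f (z + h) - psum a (n + m).+1 h) +
    (psum a (n + m).+1 (h + k) - psum a (n + m).+1 h - k *: psum b (n + m) h) +
    k *: (psum b (n + m) h - psum b n h)); last by lmod_eq R[i].
  set A1 := f _ - _ in t1 *; set A2 := f _ - _ in t2 *.
  set A3 := _ - k *: _ in t3 *; set A4 := k *: _ in t4 *.
  have n1 := normRD (A1 - A2 + A3) A4; have n2 := normRD (A1 - A2) A3.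
  by have n3 := normRB A1 A2; move: n1 n2 n3 t1 t2 t3 t4; rewrite -/C; lra.
have := @analytic_derR _ _ f (z + h) (af (z + h) _); rewrite addrAC subrr add0r.
move=> /(_ hd2) fD.
apply/ler_addgt0Pr => e e0.
have e2 : 0 < e / 2 by rewrite divr_gt0.
have [r r0 hr] := fD _ e2.
have C1 : 0 < C + 1 by rewrite ltr_wpDl.
pose t := Num.min s (Num.min (r / 2) (e / 2 / (C + 1))).
have t0 : 0 < t by rewrite !lt_min s0 !divr_gt0.
pose k : CC R := t%:C%C.
have kt : normR k = t by rewrite normR_real gtr0_norm.
have ks : normR k <= s by rewrite kt ge_min lexx.
have kr : normR k < r.
  apply: (@le_lt_trans _ _ (r / 2)); first by rewrite kt !ge_min lexx !orbT.
  by rewrite ltr_pdivrMr// ltr_pMr// ltr1n.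
have kC : C * normR k <= e / 2.
  apply: (@le_trans _ _ ((C + 1) * normR k)).
    by rewrite ler_wpM2r ?normR_ge0// lerDl.
  by rewrite mulrC -ler_pdivlMr// kt !ge_min lexx !orbT.
have h1 := key k ks; have h2 := hr k kr.
have h3 := normRB (f (z + h + k) - f (z + h) - k *: psum b n h)
  (f (z + h + k) - f (z + h) - k *: derive1 f (z + h)).
rewrite -(ler_pM2l t0) -{1}kt -normRZ.
rewrite (_ : k *: _ = (f (z + h + k) - f (z + h) - k *: psum b n h) -
  (f (z + h + k) - f (z + h) - k *: derive1 f (z + h))); last by lmod_eq R[i].
apply: (le_trans h3); have h4 := ler_wpM2r (ltW t0) kC.
by move: h1 h2 h4; rewrite kt expr2; lra.
Qed.

End TaylorDerivative.

(** * Composition with fractional linear maps *)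

Section NegativeBinomial.
Context {R : realType}.
Implicit Types x : CC R.

(** [negbin n j] is the coefficient of [x^j] in [(1 - x)^(-n)]. The recursion
    says that multiplication by [1 / (1 - x)] sums coefficients. *)
Fixpoint negbin n j : nat :=
  if n is n'.+1 then \sum_(i < j.+1) negbin n' i else (j == 0).

Definition negbin_sum n J x : CC R := \sum_(j < J) (negbin n j)%:R * x ^+ j.

Lemma negbin_sumS n J x : negbin_sum n J.+1 x = negbin_sum n J x + (negbin n J)%:R * x ^+ J.
Proof. by rewrite /negbin_sum big_ord_recr. Qed.

Lemma negbin_sum_rec n J x :
  negbin_sum n.+1 J.+1 x = x * negbin_sum n.+1 J x + negbin_sum n J.+1 x.
Proof.
elim: J => [|J IH].
  by rewrite !negbin_sumS /negbin_sum !big_ord0 /= big_ord_recr big_ord0 /= mulr0 !add0r.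
rewrite negbin_sumS {1}IH (negbin_sumS n.+1 J) (negbin_sumS n J.+1).
have -> : negbin n.+1 J.+1 = (negbin n.+1 J + negbin n J.+1)%N.
  by rewrite /= big_ord_recr.
by rewrite natrD exprS; ring.
Qed.

(** By the recurrence for the partial sums, the remainders satisfy
    [r (n+1) (J+1) = x * r (n+1) J + r n (J+1)]. *)
Lemma negbin_rem_le n J x : normR x <= 4^-1 ->
  normR ((1 - x) ^- n - negbin_sum n J x) <= 2^-1 ^+ J * 2 ^+ n.
Proof.
move=> x4; have x1 : 3 / 4 <= normR (1 - x).
  by have := normR_sub 1 x; rewrite normR1; move: x4; lra.
have x0 : 1 - x != 0 by rewrite -normR_gt0 (lt_le_trans _ x1).
elim: n J => [|n IHn] J.
  case: J => [|J].
    by rewrite /negbin_sum big_ord0 subr0 !expr0 mulr1 invr1 normR1.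
  rewrite /negbin_sum big_ord_recl /= !expr0 invr1 mulr1 big1 ?addr0 => [|i _]; last first.
    by rewrite mul0r.
  by rewrite subrr normR0 mulr1 exprn_ge0.
elim: J => [|J IHJ].
  rewrite /negbin_sum big_ord0 subr0 expr0 mul1r normRV normRX -exprVn.
  rewrite lerXn2r ?nnegrE ?invr_ge0 ?normR_ge0//.
  rewrite invf_ple ?posrE//; first by move: x1; lra.
  exact: lt_le_trans x1.
have -> : (1 - x) ^- n.+1 - negbin_sum n.+1 J.+1 x =
   x * ((1 - x) ^- n.+1 - negbin_sum n.+1 J x) + ((1 - x) ^- n - negbin_sum n J.+1 x).
  rewrite negbin_sum_rec.
  have -> : (1 - x) ^- n = (1 - x) * (1 - x) ^- n.+1.
    by rewrite exprS invfM mulrA mulfV// mul1r.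
  by ring.
rewrite (le_trans (normRD _ _))// normRM.
apply: (@le_trans _ _ (4^-1 * (2^-1 ^+ J * 2 ^+ n.+1) + 2^-1 ^+ J.+1 * 2 ^+ n)).
  by rewrite lerD// ler_pM ?normR_ge0.
by rewrite !exprS le_eqVlt; apply/orP; left; apply/eqP; field.
Qed.

End NegativeBinomial.

Section FractionalComposition.
Context {R : realType} {V : normedModType R[i]}.
Implicit Types (f g : CC R -> V) (z w h c d k : CC R) (a : nat -> V) (M K e s : R).

(** The local form of a fractional linear map. Its powers expand explicitly:
    [(c h / (1 - d h))^n] is [(c h)^n] times a negative binomial series. *)
Definition frac_at (mu : CC R -> CC R) z c d := exists2 e : R, 0 < e &
  forall h, normR h < e -> 1 - d * h != 0 /\ mu (z + h) = mu z + c * h / (1 - d * h).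

(** The coefficients obtained by substituting [c h / (1 - d h)] in the power series
    [a], and collecting powers of [h]. *)
Definition comp_coef a c d n : V :=
  \sum_(i < n.+1) ((negbin i (n - i)%N)%:R * c ^+ i * d ^+ (n - i)) *: a i.

Lemma psum_comp_coef a c d n h : psum (comp_coef a c d) n h =
  \sum_(i < n) ((c * h) ^+ i * negbin_sum i (n - i)%N (d * h)) *: a i.
Proof.
elim: n => [|n IH]; first by rewrite psum0 big_ord0.
rewrite psumS IH /comp_coef !big_ord_recr /= scalerDr scaler_sumr addrA -big_split /=.
congr (_ + _); last first.
  rewrite subnn subSnn negbin_sumS /negbin_sum big_ord0 add0r scalerA.
  by congr (_ *: _); rewrite !expr0 exprMn; ring.
apply: eq_bigr => -[i /= i_n] _; rewrite scalerA -scalerDl; congr (_ *: _).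
rewrite subSn 1?ltnW// negbin_sumS mulrDr; congr (_ + _).
have -> : h ^+ n = h ^+ i * h ^+ (n - i) by rewrite -exprD subnKC// ltnW.
by rewrite !exprMn; ring.
Qed.

(** The [n]-th partial sum of the composed series differs from the composed
    partial sum by [sum_(i < n) a_i (c h)^i r_i], where [r_i] is the remainder of order
    [n - i] of a negative binomial series, at most [2^i / 2^(n - i)]. *)
Lemma analytic_comp_frac f (mu : CC R -> CC R) z c d :
  frac_at mu z c d -> analytic_at f (mu z) -> analytic_at (f \o mu) z.
Proof.
move=> [e e0 he] /analytic_taylor[a [M [K [M0 K0 fa]]]].
apply: (@taylor_analytic _ _ _ _ (comp_coef a c d)).
(* [B |h| <= 1] bounds [K |c h|] by 1/8 and [|d h|] by 1/4, and keeps [h] in range *)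
pose B := 8 * K * normR c + 4 * normR d + 2 / e.
have B0 : 0 < B by rewrite ltr_wpDl ?divr_gt0// addr_ge0 ?mulr_ge0 ?normR_ge0// ltW.
apply: (@taylor_of_geometric _ _ _ _ _ (5 * M) B^-1); first by rewrite invr_gt0.
move=> h n hB; have h0 := normR_ge0 h.
have {}hB : 8 * (K * normR c * normR h) + 4 * (normR d * normR h) + 2 / e * normR h <= 1.
  by move: hB; rewrite -[B^-1]mulr1 ler_pdivlMl// /B !mulrDl !mulrA.
have t1 : 0 <= K * normR c * normR h by rewrite !mulr_ge0 ?normR_ge0// ltW.
have t2 : 0 <= normR d * normR h by rewrite !mulr_ge0 ?normR_ge0.
have t3 : 0 <= 2 / e * normR h by rewrite !mulr_ge0 ?invr_ge0// ltW.
have hlt : normR h < e.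
  have : 2 / e * normR h <= 1 by move: hB t1 t2; lra.
  by rewrite mulrAC ler_pdivrMr// mul1r; move: h0 e0; lra.
have hd : normR (d * h) <= 4^-1 by rewrite normRM; move: hB t1 t3; lra.
have hc : K * normR c * normR h <= 8^-1 by move: hB t2 t3; lra.
have [dh0 /= ->] := he h hlt; set k := _ / _.
have dh : 3 / 4 <= normR (1 - d * h).
  by have := normR_sub 1 (d * h); rewrite normR1; move: hd; lra.
have kK : K * normR k <= 2^-1.
  rewrite /k normRM normRM normRV.
  apply: (@le_trans _ _ (K * (normR c * normR h * 2))); last by move: hc; lra.
  rewrite ler_wpM2l ?(ltW K0)// ler_wpM2l ?mulr_ge0 ?normR_ge0//.
  rewrite invf_ple ?posrE//; first by move: dh; lra.
  exact: lt_le_trans dh.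
have h1 := fa k n (le_trans kK _); rewrite invf_le1// ler1n in h1.
have {}h1 := h1 isT.
have h2 : M * (K * normR k) ^+ n <= M * 2^-1 ^+ n.
  by rewrite ler_wpM2l// lerXn2r// nnegrE ?mulr_ge0 ?normR_ge0 ?invr_ge0// ltW.
have aM := taylor_coef_bound M0 K0 fa.
have h3 : normR (psum a n k - psum (comp_coef a c d) n h) <= 4 * M * 2^-1 ^+ n.
  pose u i := ((c * h) ^+ i * ((1 - d * h) ^- i - negbin_sum i (n - i)%N (d * h))) *: a i.
  have -> : psum a n k - psum (comp_coef a c d) n h = \sum_(i < n) u i.
    rewrite psum_comp_coef /psum -sumrB; apply: eq_bigr => i _.
    by rewrite -scalerBl; congr (_ *: _); rewrite /k expr_div_n; ring.
  rewrite (le_trans (normR_sum _ _))//.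
  apply: (@le_trans _ _ (2 * M * 2^-1 ^+ n * \sum_(0 <= i < n) 2^-1 ^+ i)); last first.
    rewrite [leRHS](_ : _ = 2 * M * 2^-1 ^+ n * 2); last by ring.
    by rewrite ler_wpM2l ?geo2_le2 ?invr_ge0// !mulr_ge0 ?exprn_ge0 ?invr_ge0.
  rewrite big_mkord mulr_sumr; apply: ler_sum => -[i /= i_n] _.
  rewrite /u normRZ normRM normRX normRM.
  have r1 := @negbin_rem_le R i (n - i)%N (d * h) hd.
  apply: (@le_trans _ _ ((normR c * normR h) ^+ i * (2^-1 ^+ (n - i) * 2 ^+ i) *
      (2 * M * K ^+ i))).
    by rewrite ler_pM ?mulr_ge0 ?normR_ge0 ?exprn_ge0 ?mulr_ge0 ?normR_ge0// ler_wpM2l ?exprn_ge0 ?mulr_ge0 ?normR_ge0.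
  have -> : (2^-1 : R) ^+ (n - i) = 2^-1 ^+ n * 2 ^+ i.
    by rewrite -[n in RHS](subnK (ltnW i_n)) exprD -mulrA -exprMn mulVf// expr1n mulr1.
  have -> : (normR c * normR h) ^+ i * (2^-1 ^+ n * 2 ^+ i * 2 ^+ i) * (2 * M * K ^+ i) =
     2 * M * 2^-1 ^+ n * (4 * (K * normR c * normR h)) ^+ i.
    by rewrite (_ : 4 = 2 * 2) ?exprMn; ring.
  rewrite ler_wpM2l ?mulr_ge0 ?exprn_ge0 ?invr_ge0//.
  rewrite lerXn2r ?nnegrE ?mulr_ge0 ?invr_ge0 ?normR_ge0 ?(ltW K0)//.
  by move: hc; lra.
have h4 := normRD (f (mu z + k) - psum a n k) (psum a n k - psum (comp_coef a c d) n h).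
by rewrite subrKA in h4; move: h1 h2 h3 h4; lra.
Qed.

Lemma derR_frac (mu : CC R -> CC R) z c d : frac_at mu z c d -> derR mu z (c : CC R).
Proof.
move=> [e e0 he] eps eps0.
pose B := 2 * normR d + 2 * normR c * normR d / eps.
have cd : 0 <= normR c * normR d by rewrite mulr_ge0 ?normR_ge0.
have B0 : 0 <= B by rewrite addr_ge0 ?divr_ge0 -?mulrA ?mulr_ge0 ?normR_ge0// ltW.
have B1 : 0 < B + 1 by rewrite ltr_wpDl.
exists (Num.min e (B + 1)^-1); first by rewrite lt_min e0 invr_gt0.
move=> h; rewrite lt_min => /andP[/he[dh0 ->] hB].
have {}hB : B * normR h <= 1.
  move: hB; rewrite -[(B + 1)^-1]mulr1 ltr_pdivlMl// mulrDl mul1r.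
  by have := normR_ge0 h; lra.
have u1 : 0 <= normR d * normR h by rewrite mulr_ge0 ?normR_ge0.
have u2 : 0 <= normR c * normR d / eps * normR h.
  by rewrite !mulr_ge0 ?normR_ge0 ?invr_ge0// ltW.
have {}hB : 2 * (normR d * normR h) + 2 * (normR c * normR d / eps * normR h) <= 1.
  by move: hB; rewrite /B mulrDl !mulrA.
have dh : 2^-1 <= normR (1 - d * h).
  have := normR_sub 1 (d * h); rewrite normR1 normRM; move: hB u1 u2; lra.
rewrite (_ : _ - _ = c * d * h / (1 - d * h) * h); last by rewrite /GRing.scale /=; field.
rewrite normRM ler_wpM2r ?normR_ge0// !normRM normRV.
rewrite ler_pdivrMr; last by rewrite (lt_le_trans _ dh)// invr_gt0.
apply: (@le_trans _ _ (eps * 2^-1)); last by rewrite ler_wpM2l// ltW.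
have : normR c * normR d / eps * normR h <= 2^-1 by move: hB u1; lra.
by rewrite mulrAC ler_pdivrMr// [2^-1 * _]mulrC.
Qed.

Lemma derR_comp f (mu : CC R -> CC R) z m D :
  derR f (mu z) D -> derR mu z m -> derR (f \o mu) z ((m : CC R) *: D).
Proof.
move=> fD mum e e0.
pose C := normR m + 1; have C0 : 0 < C by rewrite ltr_wpDl ?normR_ge0.
have D0 : 0 < normR D + 1 by rewrite ltr_wpDl ?normR_ge0.
have [d1 d10 h1] := fD _ (divr_gt0 e0 (mulr_gt0 (ltr0Sn _ 1) C0)).
pose e2 := Num.min 1 (e / (2 * (normR D + 1))).
have e20 : 0 < e2 by rewrite lt_min ltr01 divr_gt0 ?mulr_gt0.
have [d2 d20 h2] := mum _ e20.
exists (Num.min d2 (d1 / C)); first by rewrite lt_min d20 divr_gt0.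
move=> h; rewrite lt_min => /andP[/h2 {}h2 hd].
set k := mu (z + h) - mu z in h2.
have hn := normR_ge0 h.
have kC : normR k <= C * normR h.
  have := normRD (k - h *: m) (h *: m); rewrite subrK normRZ.
  have : e2 * normR h <= normR h by rewrite ler_piMl// ge_min lexx.
  by rewrite /C; move: h2; lra.
have kd : normR k < d1.
  by rewrite (le_lt_trans kC)// mulrC -ltr_pdivlMr.
have := h1 k kd; rewrite {1}/k addrCA subrr addr0 => {}h1.
rewrite (_ : _ - _ = (f (mu (z + h)) - f (mu z) - k *: D) + (k - h * m) *: D); last first.
  by rewrite /=; lmod_eq R[i].
rewrite (le_trans (normRD _ _))// normRZ.
have h3 : normR (k - h * m) * normR D <= e / 2 * normR h.
  apply: (@le_trans _ _ (e / (2 * (normR D + 1)) * normR h * (normR D + 1))).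
    rewrite ler_pM ?normR_ge0 ?lerDl// (le_trans h2)// ler_wpM2r//.
    by rewrite ge_min lexx orbT.
  by rewrite le_eqVlt; apply/orP; left; apply/eqP; field; rewrite gt_eqF.
have h4 : e / (2 * C) * normR k <= e / 2 * normR h.
  apply: (@le_trans _ _ (e / (2 * C) * (C * normR h))).
    by rewrite ler_wpM2l// divr_ge0 ?mulr_ge0// ltW.
  by rewrite le_eqVlt; apply/orP; left; apply/eqP; field; rewrite gt_eqF.
by move: h1 h3 h4; lra.
Qed.

(** The mean value inequality: a maximum of [|F w - F 0| - e |w|] can only be at
    0, as elsewhere moving towards 0 decreases [e |w|] faster than [|F w - F 0|]. *)
Lemma zero_derivative_cst (F : CC R -> V) : (forall w, disc w -> derR F w 0) ->
  forall z, disc z -> F z = F 0.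
Proof.
move=> dF z; rewrite discE => z1.
apply/eqP; rewrite -subr_eq0 -normR_eq0 eq_le normR_ge0 andbT.
apply/ler_addgt0Pr => e e0; rewrite add0r.
pose H w : R := normR (F w - F 0) - e * normR w.
have HE : forall w, normR w <= normR z -> H w <= 0.
  have [||x [xz _] Hx] := @EVT_ball R 0 (normR z) (fun=> 0) H.
  - move=> w; rewrite subr0 => wz; split.
      by move=> eps eps0; exists 1 => // v _; rewrite subrr normr0.
    have /derR_cts Fc : derR F w 0 by apply: dF; rewrite discE (le_lt_trans wz).
    move=> eps eps0; have [d d0 hd] := Fc _ (divr_gt0 eps0 (ltr0Sn _ 1)).
    exists (Num.min d (eps / 2 / e)); first by rewrite lt_min d0 !divr_gt0.
    move=> v; rewrite lt_min => /andP[/hd + vw].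
    rewrite ltr_pdivlMr// in vw.
    have := normR_dist (F v - F 0) (F w - F 0).
    rewrite (_ : F v - F 0 - (F w - F 0) = F v - F w); last by lmod_eq R[i].
    have := normR_dist v w; rewrite /H; set A := normR (F v - F 0).
    set B := normR (F w - F 0); set D := normR (F v - F w).
    move=> h1 h2 h3; rewrite (_ : _ - _ = (A - B) - e * (normR v - normR w)); last by ring.
    rewrite (le_lt_trans (ler_normB _ _))// (splitr eps) ltrD//.
      by rewrite (le_lt_trans h2).
    by rewrite normrM gtr0_norm// mulrC (le_lt_trans _ vw)// ler_wpM2r// ltW.
  - by exists 0; rewrite ?subr0 ?normR0 ?normR_ge0.
  move=> w wz; have := Hx w; rewrite subr0 => /(_ wz (lexx 0)) /le_trans; apply.
  have [->|x0] := eqVneq x 0; first by rewrite /H subrr !normR0 mulr0 subrr.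
  exfalso.
  have xp : 0 < normR x by rewrite normR_gt0.
  rewrite subr0 in xz.
  have [|d d0 hd] := dF x _ _ (divr_gt0 e0 (ltr0Sn _ 1)).
    by rewrite discE (le_lt_trans xz).
  pose s := Num.min 1 (d / normR x / 2).
  have s0 : 0 < s by rewrite lt_min ltr01 !divr_gt0.
  have s1 : s <= 1 by rewrite ge_min lexx.
  pose h : CC R := - (s%:C%C * x).
  have hE : normR h = s * normR x by rewrite normRN normRM normR_real gtr0_norm.
  have hlt : normR h < d.
    rewrite hE -ltr_pdivlMr// (@le_lt_trans _ _ (d / normR x / 2))//.
      by rewrite ge_min lexx orbT.
    by rewrite ltr_pdivrMr// ltr_pMr ?divr_gt0// ltr1n.
  have xhE : normR (x + h) = (1 - s) * normR x.
    rewrite (_ : x + h = ((1 - s)%:C)%C * x); last by rewrite /h rmorphB /=; ring.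
    by rewrite normRM normR_real ger0_norm// subr_ge0.
  have xhz : normR (x + h) <= normR z.
    by rewrite xhE (le_trans _ xz)// ler_piMl ?normR_ge0// gerBl ltW.
  have := Hx (x + h); rewrite subr0 => /(_ xhz (lexx 0)).
  have := hd h hlt; rewrite scaler0 subr0 => h1.
  have := normR_dist (F x - F 0) (F (x + h) - F 0).
  rewrite (_ : F x - F 0 - _ = F x - F (x + h)); last by lmod_eq R[i].
  rewrite [X in _ <= X]normR_distC => h2; have := ler_norm (normR (F x - F 0) - normR (F (x + h) - F 0)).
  rewrite /H xhE; have := mulr_gt0 e0 (mulr_gt0 s0 xp).
  by rewrite hE in h1; move: h1 h2; lra.
have := HE z (lexx _); rewrite /H subr_le0 => /le_trans; apply.
by rewrite ler_piMr// ltW.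
Qed.

End FractionalComposition.

(** * Moebius maps of the disc *)

Section Moebius.
Context {R : realType}.
Implicit Types (a z w lam : CC R).

Definition conjC z : CC R := (z^*)%C.

Lemma conjCD z w : conjC (z + w) = conjC z + conjC w.
Proof. exact: rmorphD. Qed.
Lemma conjCN z : conjC (- z) = - conjC z.
Proof. exact: rmorphN. Qed.
Lemma conjCM z w : conjC (z * w) = conjC z * conjC w.
Proof. exact: rmorphM. Qed.
Lemma conjC1 : conjC 1 = 1.
Proof. exact: rmorph1. Qed.
Lemma conjCV z : conjC z^-1 = (conjC z)^-1.
Proof. exact: fmorphV. Qed.
Lemma conjCK z : conjC (conjC z) = z.
Proof. exact: conjcK. Qed.
Lemma conjC_eq0 z : (conjC z == 0) = (z == 0).
Proof. exact: conjc_eq0. Qed.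

Lemma normRJ z : normR (conjC z) = normR z.
Proof. by rewrite /normR normcJ. Qed.

Lemma normR_sqrC z : (normR z ^+ 2)%:C%C = z * conjC z :> CC R.
Proof. by rewrite rmorphXn /= normRE sqr_normc. Qed.

Definition moeb a z : CC R := (z - a) / (1 - conjC a * z).

Lemma moeb_den a z : disc a -> disc z -> 1 - conjC a * z != 0.
Proof.
rewrite !discE => a1 z1; rewrite -normR_gt0.
have := normR_sub 1 (conjC a * z); rewrite normR1 normRM normRJ.
have : normR a * normR z < 1.
  by rewrite (le_lt_trans _ z1)// ler_piMl ?normR_ge0// ltW.
by lra.
Qed.

Lemma moeb_denJ a z : disc a -> disc z -> 1 - a * conjC z != 0.
Proof.
move=> a1 z1; rewrite -conjC_eq0 conjCD conjCN conjCM conjC1 conjCK.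
exact: moeb_den.
Qed.

(** This identity carries the invariance of the weight: [moeb_weight] follows. *)
Lemma moeb_norm a z : disc a -> disc z ->
  1 - normR (moeb a z) ^+ 2 =
  (1 - normR a ^+ 2) * (1 - normR z ^+ 2) / normR (1 - conjC a * z) ^+ 2.
Proof.
move=> a1 z1; apply: complexI; rewrite fmorph_div rmorphM !rmorphB !rmorph1 /=.
rewrite !normR_sqrC /moeb !(conjCM, conjCD, conjCN, conjCV, conjC1, conjCK).
by field; rewrite moeb_denJ// moeb_den.
Qed.

Lemma disc_weight z : disc z = (0 < 1 - normR z ^+ 2) :> Prop.
Proof.
by rewrite discE; congr is_true; rewrite subr_gt0 expr_lt1// normR_ge0.
Qed.

Lemma moeb_disc a z : disc a -> disc z -> disc (moeb a z).
Proof.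
move=> a1 z1; rewrite disc_weight moeb_norm// divr_gt0//.
  by rewrite mulr_gt0 -?disc_weight.
by rewrite exprn_gt0// normR_gt0 moeb_den.
Qed.

Lemma discN a : disc a -> disc (- a).
Proof. by rewrite !discE normRN. Qed.

Lemma disc0 : disc (0 : CC R).
Proof. by rewrite discE normR0. Qed.

Lemma moebK a z : disc a -> disc z -> moeb (- a) (moeb a z) = z.
Proof.
move=> a1 z1; have d1 := moeb_den a1 z1.
have d2 := moeb_den (discN a1) (moeb_disc a1 z1).
rewrite /moeb conjCN in d2 *.
have aa : 1 - conjC a * a != 0 by exact: moeb_den.
have E : 1 - - conjC a * ((z - a) / (1 - conjC a * z)) =
    (1 - conjC a * a) / (1 - conjC a * z) by field.
by rewrite E; field; rewrite d1.
Qed.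

Lemma moebNK a z : disc a -> disc z -> moeb a (moeb (- a) z) = z.
Proof. by move=> a1 z1; have := moebK (discN a1) z1; rewrite opprK. Qed.

Lemma moeb0 a : moeb a 0 = - a.
Proof. by rewrite /moeb mulr0 subr0 divr1 sub0r. Qed.

Lemma moeb_aa a : moeb a a = 0.
Proof. by rewrite /moeb subrr mul0r. Qed.

Definition moeb_deriv a z : CC R := (1 - a * conjC a) / (1 - conjC a * z) ^+ 2.

Lemma moeb_frac a z : disc a -> disc z ->
  frac_at (moeb a) z (moeb_deriv a z) (conjC a / (1 - conjC a * z)).
Proof.
move=> a1 z1; have d1 := moeb_den a1 z1.
exists (1 - normR z); first by rewrite subr_gt0 -discE.
move=> h hz; have dzh : disc (z + h).
  by rewrite discE (le_lt_trans (normRD _ _))// -ltrBrDl.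
have d2 := moeb_den a1 dzh.
have E : 1 - conjC a / (1 - conjC a * z) * h = (1 - conjC a * (z + h)) / (1 - conjC a * z).
  by field.
rewrite E; split; first by rewrite mulf_neq0// invr_neq0.
rewrite /moeb /moeb_deriv; field.
by rewrite d1.
Qed.

Lemma moeb_weight a z : disc a -> disc z ->
  (1 - normR z ^+ 2) * normR (moeb_deriv a z) = 1 - normR (moeb a z) ^+ 2.
Proof.
move=> a1 z1; rewrite moeb_norm// /moeb_deriv normRM normRV normRX.
rewrite (_ : 1 - a * conjC a = ((1 - normR a ^+ 2)%:C)%C); last first.
  by rewrite rmorphB rmorph1 /= normR_sqrC.
by rewrite normR_real gtr0_norm -?disc_weight// mulrCA mulrA.
Qed.

End Moebius.

(** * Local extrema of quotients of analytic functions *)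

Section Extremum.
Context {R : realType}.
Implicit Types (s p q : CC R -> CC R) (z w h c : CC R) (d e r : R).

Definition near_cst s z := exists2 e, 0 < e & forall w, normR (w - z) < e -> s w = s z.

(** Local quotients of analytic functions allow the extremum principle to be
    applied to quotients without inverting power series. *)
Definition quot_at s z := exists p q, [/\ analytic_at p z, analytic_at q z, q z != 0 &
  exists2 e, 0 < e & forall w, normR (w - z) < e -> s w * q w = p w].

Lemma analytic_quot s z : analytic_at s z -> quot_at s z.
Proof.
move=> sz; exists s, (fun=> (1 : CC R)); split.
- exact: sz.
- exact: analytic_cst.
- exact: oner_neq0.
- by exists 1; [exact: ltr01|move=> w _; rewrite mulr1].
Qed.

Lemma quot_sub s z c : quot_at s z -> quot_at (fun w => s w - c) z.
Proof.
move=> [p [q [pz qz q0 [e e0 he]]]]; exists ((- c) *: q + p), q.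
split; [exact: analytic_at_linear|exact: qz|exact: q0|].
exists e => [//|w /he wE]; rewrite -[RHS]/(- c * q w + p w) -wE; ring.
Qed.

Lemma quot_comp_frac s mu z c (d : CC R) : frac_at mu z c d -> quot_at s (mu z) -> quot_at (s \o mu) z.
Proof.
move=> fmu [p [q [pz qz q0 [e e0 he]]]]; exists (p \o mu), (q \o mu); split.
- exact: analytic_comp_frac fmu pz.
- exact: analytic_comp_frac fmu qz.
- exact: q0.
- have [d1 d10 hd] := derR_cts (derR_frac fmu) e0.
  by exists d1 => // w /hd /he.
Qed.

Lemma cts_nonzero q z : ctsV q z -> q z != 0 ->
  forall e, 0 < e -> exists2 d, 0 < d & forall w, normR (w - z) < d ->
    normR (q w - q z) <= e /\ normR (q z) / 2 <= normR (q w).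
Proof.
move=> qz q0 e e0; have q1 : 0 < normR (q z) / 2 by rewrite divr_gt0// normR_gt0.
have [|d d0 hd] := qz (Num.min e (normR (q z) / 2)); first by rewrite lt_min e0.
exists d => // w /hd; rewrite lt_min => /andP[h1 h2]; split; first exact: ltW.
have := normR_sub (q z) (q w); rewrite normR_distC.
by move: h2; lra.
Qed.

Lemma quot_cts s z : quot_at s z -> ctsV s z.
Proof.
move=> [p [q [/analytic_cts pz /analytic_cts qz q0 [e e0 he]]]] eps eps0.
have Q0 : 0 < normR (q z) by rewrite normR_gt0.
pose C := normR (s z) + 1; have C0 : 0 < C by rewrite ltr_wpDl ?normR_ge0.
pose t := eps * normR (q z) / 8.
have t0 : 0 < t by rewrite divr_gt0// mulr_gt0.
have [d1 d10 h1] := pz _ t0.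
have [d2 d20 h2] := cts_nonzero qz q0 (divr_gt0 t0 C0).
exists (Num.min e (Num.min d1 d2)); first by rewrite !lt_min e0 d10.
move=> w; rewrite !lt_min => /and3P[/he wE /h1 {}h1 /h2[{}h2 h3]].
have zE : s z * q z = p z by apply: he; rewrite subrr normR0.
have E : (s w - s z) * q w = (p w - p z) - s z * (q w - q z).
  by rewrite -wE -zE; ring.
have : normR (s w - s z) * normR (q w) < 2 * t + t.
  rewrite -normRM E (le_lt_trans (normRB _ _))// ltrD//.
    by rewrite (lt_trans h1)// ltr_pMl// ltr1n.
  rewrite normRM (@le_lt_trans _ _ (normR (s z) * (t / C)))//.
    by rewrite ler_wpM2l ?normR_ge0.
  rewrite mulrCA gtr_pMr// ltr_pdivrMr// mul1r /C.
  by rewrite ltrDl.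
have := ler_wpM2l (normR_ge0 (s w - s z)) h3.
move=> h4 h5; have : normR (s w - s z) * (normR (q z) / 2) < eps * (normR (q z) / 2).
  by rewrite (le_lt_trans h4)// (lt_trans h5)// /t; have := mulr_gt0 eps0 Q0; lra.
by rewrite ltr_pM2r// divr_gt0.
Qed.

Lemma complex_root k (u : CC R) : (0 < k)%N -> exists v : CC R, v ^+ k = u.
Proof. by move=> k0; exists (k.-root u); rewrite rootCK. Qed.

(** To leading order [s (z + h) = s z * (1 + u h^k)] with [u <> 0], unless [s] is
    constant near [z]; a [k]-th root of a suitable number of modulus 1 makes [u h^k]
    positive or negative. *)
Lemma quot_extremum s z : quot_at s z -> s z != 0 -> near_cst s z \/
  forall e, 0 < e ->
    (exists2 w, normR (w - z) < e & normR (s z) < normR (s w)) /\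
    (exists2 w, normR (w - z) < e & normR (s w) < normR (s z)).
Proof.
move=> [p [q [pz qz q0 [e1 e10 he]]]] s0.
have zE : s z * q z = p z by apply: he; rewrite subrr normR0.
have qc := analytic_cts qz.
pose D := (- s z) *: q + p.
have DE w : D w = p w - s z * q w by rewrite addrC /D -mulNr.
have [a [M [K [M0 K0 Da]]]] := analytic_taylor (analytic_at_linear (- s z) qz pz).
have Q0 : 0 < normR (q z) by rewrite normR_gt0.
have S0 : 0 < normR (s z) by rewrite normR_gt0.
have [a0|] := pselect (forall n, a n = 0).
  left; have [d2 d20 h2] := cts_nonzero qc q0 ltr01.
  have [|d3 d30 h3] := @taylor_zero _ _ D z a _ a0; first by exists M, K.
  exists (Num.min e1 (Num.min d2 d3)); first by rewrite !lt_min e10 d20.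
  move=> w; rewrite !lt_min => /and3P[/he wE /h2[_ hq] /h3 D0].
  have qw : q w != 0 by rewrite -normR_gt0 (lt_le_trans _ hq)// divr_gt0.
  apply: (mulIf qw); rewrite wE; apply/eqP.
  by rewrite -subr_eq0 -DE D0.
move=> /existsNP/cid[n0 /eqP an0].
have [k ak kmin] := @ex_minnP (fun n => a n != 0) (ex_intro _ n0 an0).
have k0 : (0 < k)%N.
  case: k ak {kmin} => // /eqP; rewrite -(taylor_value (z := z) (f := D)); last by exists M, K.
  by rewrite DE zE subrr.
right=> e e0.
(* [s (z + h) / s z - 1 = u h^k] up to an error at most half as large *)
pose u := a k / (s z * q z).
have u0 : u != 0 by rewrite mulf_neq0// invr_neq0// mulf_neq0.
have U0 : 0 < normR u by rewrite normR_gt0.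
have [d2 d20 h2] := cts_nonzero qc q0 (divr_gt0 Q0 (ltr0Sn _ 7)).
have [t [t0 te tE]] : exists t : R, [/\ 0 < t, t < e & forall h, normR h = t ->
    t ^+ k * normR u <= 1 /\ exists2 v, s (z + h) = s z * (1 + v) &
      normR (v - h ^+ k * u) <= 2^-1 * (t ^+ k * normR u)].
  have A0 : 0 < normR (a k) by rewrite normR_gt0.
  pose B := 8 * (M * K ^+ k.+1).
  have B0 : 0 <= B by rewrite !mulr_ge0 ?exprn_ge0// ltW.
  have B1 : 0 < B + 1 by rewrite ltr_wpDl.
  pose m := Num.min e (Num.min e1 (Num.min d2 (Num.min 1 (Num.min K^-1
    (Num.min (normR (a k) / (B + 1)) (normR u)^-1))))).
  have m0 : 0 < m by rewrite !lt_min e0 e10 d20 ltr01 !invr_gt0 K0 U0 divr_gt0.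
  pose t := m / 2; have t0 : 0 < t by rewrite divr_gt0.
  have tm : t < m by rewrite ltr_pdivrMr// ltr_pMr// ltr1n.
  move: (tm); rewrite !lt_min => /and5P[te te1 td2 t1 /and3P[tK tB tU]].
  exists t; split => // h hE; split.
    apply: (@le_trans _ _ (t * normR u)); last by rewrite -ler_pdivlMr// div1r ltW.
    by rewrite ler_wpM2r ?normR_ge0// ler_iXnr// ltW.
  have hz : z + h - z = h by rewrite addrAC subrr add0r.
  have := he (z + h); rewrite hz hE => /(_ te1) hs.
  have := h2 (z + h); rewrite hz hE => /(_ td2)[hq1 hq2].
  set q' := q (z + h) in hs hq1 hq2.
  have Q'0 : 0 < normR q' by rewrite (lt_le_trans _ hq2)// divr_gt0.
  have q'0 : q' != 0 by rewrite -normR_gt0.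
  exists (D (z + h) / (s z * q')).
    apply: (mulIf q'0); rewrite hs -/q'; have := DE (z + h); rewrite -/q' => ->.
    by field; rewrite ?s0 ?q'0.
  have hDa : normR (D (z + h) - h ^+ k *: a k) <= M * (K * t) ^+ k.+1.
    have tK1 : K * normR h <= 1 by rewrite hE mulrC -ler_pdivlMr// div1r ltW.
    have := Da h k.+1 tK1; rewrite hE psumS /psum big1 ?add0r// => -[i ik] _ /=.
    have [->|ai] := eqVneq (a i) 0; first by rewrite scaler0.
    by have := kmin i ai; rewrite leqNgt ik.
  rewrite (_ : _ - _ = (D (z + h) - h ^+ k * a k) / (s z * q') +
     h ^+ k * u * ((q z - q') / q')); last by rewrite /u; field; rewrite ?s0 ?q0 ?q'0.
  rewrite (le_trans (normRD _ _))//.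
  have g1 : normR (h ^+ k * u * ((q z - q') / q')) <= 4^-1 * (t ^+ k * normR u).
    rewrite normRM normRM normRX hE mulrC ler_wpM2r ?mulr_ge0 ?exprn_ge0 ?normR_ge0 ?(ltW t0)//.
    rewrite normRM normRV ler_pdivrMr// normR_distC.
    by move: hq1 hq2; lra.
  have g2 : normR ((D (z + h) - h ^+ k * a k) / (s z * q')) <= 4^-1 * (t ^+ k * normR u).
    rewrite normRM normRV ler_pdivrMr; last by rewrite normRM mulr_gt0.
    rewrite (le_trans hDa)// normRM.
    have -> : normR u = normR (a k) / (normR (s z) * normR (q z)).
      by rewrite /u normRM normRV normRM.
    apply: (@le_trans _ _ (4^-1 * (t ^+ k * (normR (a k) / (normR (s z) * normR (q z)))) *
       (normR (s z) * (normR (q z) / 2)))); last first.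
      rewrite ler_wpM2l ?mulr_ge0 ?invr_ge0 ?exprn_ge0 ?mulr_ge0 ?normR_ge0 ?(ltW t0) ?(ltW m0)//.
      by rewrite ler_wpM2l ?normR_ge0.
    rewrite [leRHS](_ : _ = 8^-1 * (t ^+ k * normR (a k))); last first.
      by field; rewrite !gt_eqF.
    rewrite exprMn (exprS t) -ler_pdivrMl ?invr_gt0// invrK.
    rewrite (_ : 8 * _ = t ^+ k * (t * B)); last by rewrite /B; ring.
    rewrite ler_wpM2l ?exprn_ge0 ?(ltW t0)//.
    apply: (@le_trans _ _ (t * (B + 1))); first by rewrite ler_wpM2l ?(ltW t0)// lerDl.
    by rewrite -ler_pdivlMr// ltW.
  by move: g1 g2; lra.
have [w1 hw1] := complex_root ((normR u)%:C%C / u) k0.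
have [w2 hw2] := complex_root (- ((normR u)%:C%C / u)) k0.
have n1 w : normR (w ^+ k) = 1 -> normR w = 1.
  by rewrite normRX => /eqP; rewrite pexpr_eq1 ?normR_ge0// => /eqP.
have nu : normR ((normR u)%:C%C / u) = 1.
  by rewrite normRM normRV normR_real ger0_norm ?normR_ge0// divff// gt_eqF.
pose tC : CC R := t%:C%C.
have tCE : normR tC = t by rewrite normR_real gtr0_norm.
have tau0 : 0 < t ^+ k * normR u by rewrite mulr_gt0// exprn_gt0.
split.
  have hE : normR (tC * w1) = t by rewrite normRM tCE n1 ?hw1// mulr1.
  have [_ [v sE hv]] := tE _ hE.
  exists (z + tC * w1); first by rewrite addrAC subrr add0r hE.
  have E : (tC * w1) ^+ k * u = (t ^+ k * normR u)%:C%C.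
    by rewrite exprMn hw1 rmorphM rmorphXn /= -mulrA divfK.
  rewrite E in hv.
  rewrite sE normRM ltr_pMr//.
  have h1 := Re_le_normR (1 + v); rewrite raddfD /= in h1.
  have h3 := Re_le_normR ((t ^+ k * normR u)%:C%C - v).
  rewrite raddfB /= normR_distC in h3.
  by move: h1 h3 hv tau0; lra.
have hE : normR (tC * w2) = t by rewrite normRM tCE n1 ?mulr1// hw2 normRN.
have [t1 [v sE hv]] := tE _ hE.
exists (z + tC * w2); first by rewrite addrAC subrr add0r hE.
have E : (tC * w2) ^+ k * u = - (t ^+ k * normR u)%:C%C.
  by rewrite exprMn hw2 mulrN mulNr rmorphM rmorphXn /= -mulrA divfK.
rewrite E opprK in hv.
rewrite sE normRM gtr_pMr//.
pose tau := t ^+ k * normR u.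
have := normRD (v + (tau%:C)%C) ((1 - tau)%:C)%C.
rewrite normR_real ger0_norm ?subr_ge0//.
rewrite [X in normR X](_ : _ = 1 + v); last by rewrite rmorphB rmorph1 /=; ring.
rewrite -/tau in hv t1 tau0 *.
by move: hv tau0; lra.
Qed.

End Extremum.

(** * The maximum principle and bijections of the disc *)

Section Automorphisms.
Context {R : realType}.
Implicit Types (s p q : CC R -> CC R) (z w h c a : CC R) (d e r : R).

Lemma ctsR_cst (x : R) z : ctsR (fun=> x) z.
Proof. by move=> e e0; exists 1 => // w _; rewrite subrr normr0. Qed.

Lemma ctsR_opp (H : CC R -> R) z : ctsR H z -> ctsR (fun w => - H w) z.
Proof.
move=> Hz e /Hz[d d0 hd]; exists d => // w /hd.
by rewrite -opprD normrN.
Qed.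

Lemma ctsR_subr (H : CC R -> R) x z : ctsR H z -> ctsR (fun w => H w - x) z.
Proof.
move=> Hz e /Hz[d d0 hd]; exists d => // w /hd.
by rewrite opprB addrA subrK.
Qed.

Lemma ctsR_dist c z : ctsR (fun w => normR (w - c)) z.
Proof.
move=> e e0; exists e => // w; apply: le_lt_trans.
by have := normR_dist (w - c) (z - c); rewrite opprB addrA subrK.
Qed.

(** The maximum principle: consider a maximum point at the greatest distance
    from the center. If it were interior, [H] would be constant near it and there would
    be maximum points farther away. *)
Lemma ball_max_boundary c r (H : CC R -> R) : 0 < r ->
  (forall z, normR (z - c) <= r -> ctsR H z) ->
  (forall z, normR (z - c) < r ->
     (exists2 e, 0 < e & forall w, normR (w - z) < e -> H w <= H z) ->
     exists2 e, 0 < e & forall w, normR (w - z) < e -> H w = H z) ->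
  exists2 x, normR (x - c) = r & forall z, normR (z - c) <= r -> H z <= H x.
Proof.
move=> r0 Hc Hmax.
have cc : normR (c - c) <= r by rewrite subrr normR0 ltW.
have [||x1 [x1r _] Hx1] := @EVT_ball R c r (fun=> 0) H.
- by move=> z zr; split; [exact: ctsR_cst|exact: Hc].
- by exists c.
(* [H x1] is the maximum; among the points where it is reached, take the farthest *)
have [||x [xr kx] Hx] := @EVT_ball R c r (fun w => H w - H x1) (fun w => normR (w - c)).
- by move=> z zr; split; [apply: ctsR_subr; exact: Hc|exact: ctsR_dist].
- by exists x1; rewrite ?subrr.
have xM z : normR (z - c) <= r -> H z <= H x.
  by move=> zr; rewrite (le_trans (Hx1 _ zr (lexx _)))// -subr_ge0.
exists x => //; apply/eqP; rewrite eq_le xr leNgt; apply/negP => xltr.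
have [|e e0 he] := Hmax x xltr.
  exists (r - normR (x - c)); first by rewrite subr_gt0.
  move=> w wx; apply: xM; have := normRD (w - x) (x - c); rewrite addrA subrK.
  by move: wx; lra.
pose t := Num.min e (r - normR (x - c)) / 2.
have m0 : 0 < Num.min e (r - normR (x - c)) by rewrite lt_min e0 subr_gt0.
have t0 : 0 < t by rewrite divr_gt0.
have : t < Num.min e (r - normR (x - c)) by rewrite ltr_pdivrMr// ltr_pMr// ltr1n.
rewrite lt_min => /andP[te tr].
have [w wx wc] : exists2 w, normR (w - x) = t & normR (w - c) = normR (x - c) + t.
  have [->|xc] := eqVneq x c.
    exists (c + t%:C%C); rewrite addrAC subrr add0r normR_real gtr0_norm//.
    by rewrite normR0 add0r.
  have X0 : 0 < normR (x - c) by rewrite normR_gt0 subr_eq0.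
  exists (c + ((1 + t / normR (x - c))%:C)%C * (x - c)).
    rewrite (_ : _ - x = ((t / normR (x - c))%:C)%C * (x - c)); last first.
      by rewrite rmorphD rmorph1 /=; ring.
    rewrite normRM normR_real ger0_norm; first by rewrite divfK// gt_eqF.
    by rewrite divr_ge0 ?normR_ge0// ltW.
  rewrite addrAC subrr add0r normRM normR_real ger0_norm; last first.
    by rewrite addr_ge0// divr_ge0 ?normR_ge0// ltW.
  by rewrite mulrDl mul1r divfK// gt_eqF.
have := Hx w; rewrite wc => h.
have : normR (x - c) + t <= normR (x - c).
  apply: h; first by move: tr; lra.
  by rewrite he ?wx// subr_ge0 -subr_ge0 kx.
by rewrite gerDl leNgt t0.
Qed.

Lemma quot_max s c r : 0 < r -> (forall z, normR (z - c) <= r -> quot_at s z) ->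
  exists2 x, normR (x - c) = r & forall z, normR (z - c) <= r -> normR (s z) <= normR (s x).
Proof.
move=> r0 qs; apply: (@ball_max_boundary c r (fun z => normR (s z))) => //.
  by move=> z /qs/quot_cts/ctsV_normR.
move=> z /ltW/qs sz [e e0 he]; have [s0|s0] := eqVneq (s z) 0.
  by exists e => // w /he; rewrite s0 normR0 => h; apply/eqP; rewrite eq_le h normR_ge0.
have [[d d0 hd]|/(_ e e0)[[w /he + wz] _]] := quot_extremum sz s0.
  by exists d => // w /hd ->.
by rewrite leNgt wz.
Qed.

Lemma quot_min s c r : 0 < r -> (forall z, normR (z - c) <= r -> quot_at s z /\ s z != 0) ->
  exists2 x, normR (x - c) = r & forall z, normR (z - c) <= r -> normR (s x) <= normR (s z).
Proof.
move=> r0 qs; have [||x xr Hx] := @ball_max_boundary c r (fun z => - normR (s z)) r0.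
- by move=> z /qs[/quot_cts/ctsV_normR sz _]; exact: ctsR_opp.
- move=> z /ltW/qs[sz s0] [e e0 he].
  have [[d d0 hd]|/(_ e e0)[_ [w /he + wz]]] := quot_extremum sz s0.
    by exists d => // w /hd ->.
  by rewrite lerN2 leNgt wz.
by exists x => // z /Hx; rewrite lerN2.
Qed.

Section Bijection.
Variable s : CC R -> CC R.
Hypothesis qs : forall z, disc z -> quot_at s z.
Hypothesis sbij : set_bij disc disc s.

Lemma bij_disc z : disc z -> disc (s z).
Proof. by move=> z1; have [h _ _] := sbij; apply: h. Qed.

Lemma bij_inj z w : disc z -> disc w -> s z = s w -> z = w.
Proof. by move=> z1 w1; have [_ h _] := sbij; apply: h; rewrite inE. Qed.

Lemma bij_surj w : disc w -> exists2 z, disc z & s z = w.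
Proof. by move=> w1; have [_ _ /(_ w w1)[z]] := sbij; exists z. Qed.

(** The open mapping property, from the minimum principle for [s - w]: if [s]
    stays away from [s z0] on a circle and [s z0] is close to [w], then [|s - w|] is
    smaller at the center than on the circle, so it has a zero inside. *)
Lemma bij_open z0 r : 0 < r -> (forall z, normR (z - z0) <= r -> disc z) ->
  exists2 d, 0 < d & forall w, normR (w - s z0) < d ->
    exists2 z, normR (z - z0) <= r & s z = w.
Proof.
move=> r0 rd; have z0d : disc z0 by apply: rd; rewrite subrr normR0 ltW.
pose H z := - normR (s z - s z0).
have Hc z : normR (z - z0) <= r -> ctsR H z.
  move=> /rd/qs/quot_sub/quot_cts/ctsV_normR sz; exact: ctsR_opp.
have [||x [xr kx] Hx] := @EVT_ball R z0 r (fun w => normR (w - z0) - r) H.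
- by move=> z zr; split; [apply: ctsR_subr; exact: ctsR_dist|exact: Hc].
- exists (z0 + r%:C%C); by rewrite addrAC subrr add0r normR_real gtr0_norm// subrr.
have mu0 : 0 < normR (s x - s z0).
  rewrite normR_gt0 subr_eq0; apply/negP => /eqP/(bij_inj (rd _ xr) z0d) xz.
  by move: kx; rewrite xz subrr normR0 sub0r oppr_ge0 leNgt r0.
exists (normR (s x - s z0) / 2); first by rewrite divr_gt0.
move=> w wz; apply: contrapT => nw.
have [z zr|y yr Hy] := @quot_min (fun z => s z - w) z0 r r0.
  split; first by apply: quot_sub; apply/qs/rd.
  by rewrite subr_eq0; apply/negP => /eqP sz; apply: nw; exists z.
have h1 := Hy z0; rewrite subrr normR0 in h1; have {}h1 := h1 (ltW r0).
have h2 : normR (s x - s z0) <= normR (s y - s z0).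
  by have := Hx y; rewrite yr lexx subrr lexx /H lerN2 => /(_ isT isT).
have h3 := normRD (s y - w) (w - s z0); rewrite addrA subrK in h3.
by rewrite (normR_distC (s z0)) in h1; move: h1 h2 h3 wz; lra.
Qed.

(** The inverse of [s] is continuous by [bij_open], so it maps the closed disc of
    radius [r] into a closed disc of radius less than 1. *)
Lemma bij_proper r : 0 <= r -> r < 1 ->
  exists2 rho, rho < 1 & forall z, disc z -> rho < normR z -> r < normR (s z).
Proof.
move=> r0 r1.
pose t w := xget 0 [set z | disc z /\ s z = w].
have tP w : disc w -> disc (t w) /\ s (t w) = w.
  by move=> /bij_surj[z zd zw]; apply: (xgetPex 0 (P := [set z | disc z /\ s z = w])); exists z.
have tc w : disc w -> ctsR (fun w => normR (t w)) w.
  move=> wd e e0; have [td st] := tP _ wd.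
  have td1 : 0 < 1 - normR (t w) by rewrite subr_gt0 -discE.
  pose r' := Num.min e (1 - normR (t w)) / 2.
  have m0 : 0 < Num.min e (1 - normR (t w)) by rewrite lt_min e0.
  have r'0 : 0 < r' by rewrite divr_gt0.
  have : r' < Num.min e (1 - normR (t w)) by rewrite ltr_pdivrMr// ltr_pMr// ltr1n.
  rewrite lt_min => /andP[r'e r't].
  have bd z : normR (z - t w) <= r' -> disc z.
    rewrite discE => zr; have := normRD (z - t w) (t w); rewrite subrK.
    by move: zr r't; lra.
  have [d d0 hd] := bij_open r'0 bd.
  exists d => // v; rewrite -{1}st => /hd[z zr szv].
  have vd : disc v by rewrite -szv; apply/bij_disc/bd.
  have [tvd stv] := tP _ vd.
  have <- : z = t v by apply: bij_inj; rewrite ?stv//; exact: bd.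
  by rewrite (le_lt_trans (normR_dist _ _))// (le_lt_trans zr).
have [||x [xr _] Hx] := @EVT_ball R 0 r (fun=> 0) (fun w => normR (t w)).
- move=> z; rewrite subr0 => zr; split; first exact: ctsR_cst.
  by apply: tc; rewrite discE (le_lt_trans zr).
- by exists 0; rewrite ?subr0 ?normR0.
rewrite subr0 in xr.
exists (normR (t x)); first by rewrite -discE; apply: (tP _ _).1; rewrite discE (le_lt_trans xr).
move=> z zd; apply: contraTT; rewrite -!leNgt => sr.
have [tzd stz] := tP _ (bij_disc zd).
have <- : t (s z) = z by apply: bij_inj.
by apply: Hx; rewrite ?subr0.
Qed.

End Bijection.

End Automorphisms.

(** * The Schwarz lemma *)

Section Schwarz.
Context {R : realType}.
Implicit Types (s p q : CC R -> CC R) (z w h c a : CC R) (d e r : R).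

Lemma bernoulli (x : R) k : 0 <= x <= 1 -> 1 - k%:R * x <= (1 - x) ^+ k.
Proof.
move=> /andP[x0 x1]; elim: k => [|k IH]; first by rewrite mul0r subr0 expr0.
rewrite exprS -natr1; have kx : 0 <= (k%:R : R) * x ^+ 2 by rewrite mulr_ge0 ?exprn_ge0.
have := ler_wpM2l (_ : 0 <= 1 - x) IH; rewrite subr_ge0 => /(_ x1).
by move: kx; rewrite expr2; lra.
Qed.

Lemma analytic_mul_Xn (q : CC R -> CC R) z k : analytic_at q z ->
  analytic_at (fun w => w ^+ k * q w) z.
Proof.
move=> qz; elim: k => [|k IH].
  by apply: (analytic_eq_near ltr01 _ qz) => w _; rewrite expr0 mul1r.
apply: (analytic_eq_near ltr01 _ (analytic_mul_affine 0 1 IH)) => w _.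
by rewrite add0r mul1r exprS -mulrA.
Qed.

Lemma near_cst_derR s z : near_cst s z -> derR s z (0 : CC R).
Proof.
move=> [e e0 he] eps eps0; exists e => // h hh.
rewrite he ?subrr ?scaler0 ?subr0 ?normR0 ?mulr_ge0 ?normR_ge0 ?(ltW eps0)//.
by rewrite addrAC subrr add0r.
Qed.

(** By assumption 1 is the only root of [X^k - 1], which is then [(X - 1)^k]; the
    values at 0 and -1 exclude [k > 1]. *)
Lemma power_inj k : (0 < k)%N ->
  (forall r : R[i], r ^+ k = 1 -> r = 1) -> k = 1%N.
Proof.
move=> k0 inj; have [rs] := closed_field_poly_normal ('X^k - 1%:P : {poly R[i]}).
rewrite lead_coefXnsubC// scale1r => Er.
have rs1 : all (pred1 1) rs.
  apply/allP => r rrs /=; apply/eqP/inj.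
  have : root ('X^k - 1%:P : {poly R[i]}) r by rewrite Er root_prod_XsubC.
  by rewrite /root !hornerE subr_eq0 => /eqP.
have rsE : rs = nseq (size rs) 1 by apply/all_pred1P.
have size_rs : size rs = k.
  by have := congr1 (fun p : {poly R[i]} => size p) Er; rewrite size_XnsubC// size_prod_XsubC => -[].
rewrite rsE size_rs big_nseq iter_mulr_1 in Er.
have E0 : (-1 : R[i]) = (-1) ^+ k.
  have := congr1 (fun p : {poly R[i]} => p.[0]) Er.
  by rewrite /= horner_exp !hornerE expr0n gtn_eqF//= sub0r.
have E1 : (-1 : R[i]) ^+ k - 1 = (-1 - 1) ^+ k.
  have := congr1 (fun p : {poly R[i]} => p.[-1]) Er.
  by rewrite /= horner_exp !hornerE.
have : normR ((-1 - 1 : CC R) ^+ k) = normR (- 2 : CC R).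
  by rewrite -E1 -E0; congr normR; ring.
rewrite normRX (_ : -1 - 1 = - 2 :> CC R); last by ring.
rewrite normRN normR_nat.
case: k {E0 E1 Er size_rs inj} k0 => [//|[//|k]] _ h; exfalso.
have : (1 : R) <= 2 ^+ k by rewrite exprn_ege1// ler1n.
by move: h; rewrite !exprS; lra.
Qed.

Lemma le1_approach (x y : R) : x < 1 -> (forall r, x < r -> r < 1 -> r <= y) -> 1 <= y.
Proof.
move=> x1 h; rewrite leNgt; apply/negP => y1.
pose r := (Num.max x y + 1) / 2.
have m1 : Num.max x y < 1 by rewrite gt_max x1.
have r1 : r < 1 by rewrite /r; lra.
have mr : Num.max x y < r by rewrite /r; lra.
move: mr; rewrite gt_max => /andP[xr yr].
by have := h r xr r1; rewrite leNgt yr.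
Qed.

(** If [k] is the order of the zero of [s] at 0, then [s z / z^k] has modulus at most
    1 by the maximum principle, and at least 1 by the minimum principle because [s]
    is proper. Hence it is a constant, and [k = 1] by injectivity. *)
Lemma schwarz s : (forall z, disc z -> quot_at s z) -> set_bij disc disc s ->
  s 0 = 0 -> exists2 lam : CC R, normR lam = 1 & forall z, disc z -> s z = lam * z.
Proof.
move=> qs sbij s0.
have snz z : disc z -> z != 0 -> s z != 0.
  move=> zd; apply: contraNneq => sz; apply/eqP.
  by apply: (bij_inj sbij) => //; [exact: disc0|rewrite s0].
have [p [q [pz qz q0 [e e0 he]]]] := qs 0 disc0.
have [a pa] := analytic_taylor pz.
have [n0 an0] : exists n, a n != 0.
  apply: contrapT => /forallNP an.
  have [|d d0 hd] := taylor_zero pa.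
    by move=> n; have /negP := an n; rewrite negbK => /eqP.
  have [d2 d20 h2] := cts_nonzero (analytic_cts qz) q0 ltr01.
  pose m := Num.min e (Num.min d (Num.min d2 1)).
  have m0 : 0 < m by rewrite !lt_min e0 d0 d20 ltr01.
  pose t := m / 2; have t0 : 0 < t by rewrite divr_gt0.
  have : t < m by rewrite ltr_pdivrMr// ltr_pMr// ltr1n.
  rewrite !lt_min => /and4P[te td td2 t1].
  pose tC : CC R := t%:C%C.
  have tE : normR tC = t by rewrite normR_real gtr0_norm.
  have tn0 : tC != 0 by rewrite -normR_gt0 tE.
  have tdisc : disc tC by rewrite discE tE.
  have := he tC; rewrite subr0 tE => /(_ te); rewrite (hd tC) ?subr0 ?tE//.
  move/eqP; rewrite mulf_eq0 (negbTE (snz _ tdisc tn0)) /= => /eqP qt.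
  have := h2 tC; rewrite subr0 tE qt normR0 => /(_ td2)[_].
  by rewrite leNgt divr_gt0// normR_gt0.
have [k ak kmin] := @ex_minnP (fun n => a n != 0) (ex_intro _ n0 an0).
have p0 : p 0 = 0 by rewrite -he ?subr0 ?normR0// s0 mul0r.
have k0 : (0 < k)%N.
  by case: k ak {kmin} => // /eqP; rewrite -(taylor_value pa) p0.
have az i : (i < k)%N -> a i = 0.
  move=> ik; apply/eqP; apply: contraTT ik => ai; rewrite -leqNgt; exact: kmin.
(* [s z / z ^ k] with its limit at 0 *)
pose G z := if z == 0 then a k / q 0 else s z / z ^+ k.
have qG z : disc z -> quot_at G z /\ G z != 0.
  move=> zd; have [->|z0] := eqVneq z 0.
    split; last by rewrite /G eqxx mulf_neq0// invr_neq0.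
    exists (fun w => if w == 0 then a k else (w - 0) ^- k *: p w), q; split.
    - exact: taylor_analytic (taylor_div pa az).
    - exact: qz.
    - exact: q0.
    exists e => // w; rewrite /G; have [->|w0] := eqVneq w 0; first by rewrite divfK.
    move=> /he <-; rewrite subr0 /GRing.scale /=.
    by rewrite [RHS]mulrC [RHS]mulrAC.
  split; last by rewrite /G (negbTE z0) mulf_neq0 ?snz// invr_neq0// expf_neq0.
  have [p1 [q1 [p1z q1z q10 [e1 e10 he1]]]] := qs z zd.
  exists p1, (fun w => w ^+ k * q1 w); split.
  - exact: p1z.
  - exact: analytic_mul_Xn.
  - by rewrite mulf_neq0// expf_neq0.
  exists (Num.min e1 (normR z)); first by rewrite lt_min e10 normR_gt0.
  move=> w; rewrite lt_min => /andP[/he1 <- wz].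
  have w0 : w != 0 by apply: contraTneq wz => ->; rewrite sub0r normRN ltxx.
  by rewrite /G (negbTE w0) mulrA divfK// expf_neq0.
have Gle z : disc z -> normR (G z) <= 1.
  rewrite discE => z1; have [//|g1] := leP (normR (G z)) 1.
  have g0 : 0 < normR (G z) by rewrite (lt_trans _ g1).
  (* the circle of radius [1 - x] surrounds [z], and [(1 - x)^k > 1 / |G z|] *)
  pose x := Num.min (1 - normR z) ((1 - (normR (G z))^-1) / (2 * k%:R)).
  have kR : 0 < (2 * k%:R : R) by rewrite mulr_gt0// ltr0n.
  have y0 : 0 < 1 - (normR (G z))^-1 by rewrite subr_gt0 invf_lt1.
  have x0 : 0 < x by rewrite lt_min subr_gt0 z1 divr_gt0.
  have [xz xk] : x <= 1 - normR z /\ x * (2 * k%:R) <= 1 - (normR (G z))^-1.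
    by rewrite -ler_pdivlMr// !ge_min !lexx orbT.
  have x1 : x <= 1 by move: xz (normR_ge0 z); lra.
  have k1 : (1 : R) <= k%:R by rewrite ler1n.
  have xlt1 : x < 1.
    have gi : 0 < (normR (G z))^-1 by rewrite invr_gt0.
    have xx : x * 2 <= x * (2 * k%:R) by rewrite ler_wpM2l ?(ltW x0)// ler_peMr.
    by move: xk xx x0; lra.
  have [||w wr Hw] := @quot_max _ G 0 (1 - x).
  - by rewrite subr_gt0.
  - move=> v; rewrite subr0 => vr; apply: (qG _ _).1; rewrite discE.
    by move: vr x0; lra.
  rewrite subr0 in wr; have := Hw z; rewrite subr0 => {}Hw.
  have {}Hw : normR (G z) <= normR (G w) by apply: Hw; move: xz; lra.
  have w0 : w != 0 by rewrite -normR_gt0 wr subr_gt0.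
  have sw : normR (s w) < 1 by rewrite -discE; apply: bij_disc => //; rewrite discE wr; move: x0; lra.
  have rk0 : 0 < (1 - x) ^+ k by rewrite exprn_gt0// subr_gt0.
  rewrite /G (negbTE w0) normRM normRV normRX wr ler_pdivlMr// -/(G z) in Hw.
  have b : 1 - k%:R * x <= (1 - x) ^+ k by apply: bernoulli; rewrite (ltW x0).
  have b2 : (normR (G z))^-1 < (1 - x) ^+ k.
    by apply: lt_le_trans b; move: xk y0; rewrite mulrCA [x * _]mulrC; lra.
  have : 1 < normR (G z) * (1 - x) ^+ k by rewrite -ltr_pdivrMl// mulr1.
  by rewrite ltNge (le_trans Hw)// ltW.
have Gge z : disc z -> 1 <= normR (G z).
  rewrite discE => z1; apply: (@le1_approach 0); first exact: ltr01.
  move=> r r0 r1; have [rho rho1 Hrho] := bij_proper qs sbij (ltW r0) r1.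
  pose m := Num.max rho (normR z).
  have m1 : m < 1 by rewrite gt_max rho1.
  pose t := (m + 1) / 2.
  have mt : m < t by rewrite /t; lra.
  have t1 : t < 1 by rewrite /t; lra.
  move: (mt); rewrite gt_max => /andP[rhot zt].
  have t0 : 0 < t by rewrite (le_lt_trans _ zt)// normR_ge0.
  have [|w wt Hw] := @quot_min _ G 0 t t0.
    by move=> v; rewrite subr0 => vt; apply: qG; rewrite discE (le_lt_trans vt).
  rewrite subr0 in wt; have := Hw z; rewrite subr0 => /(_ (ltW zt)); apply: le_trans.
  have w0 : w != 0 by rewrite -normR_gt0 wt.
  have wd : disc w by rewrite discE wt.
  rewrite /G (negbTE w0) normRM normRV normRX wt.
  have sr : r < normR (s w) by apply: Hrho; rewrite ?wt.
  rewrite ler_pdivlMr ?exprn_gt0// (le_trans _ (ltW sr))//.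
  by rewrite ler_piMr ?(ltW r0)// exprn_ile1// ltW.
have Gcst z : disc z -> G z = G 0.
  apply: zero_derivative_cst => w wd; apply: near_cst_derR.
  have [Gw Gw0] := qG w wd; have [//|h] := quot_extremum Gw Gw0.
  have [|[v vw Gv] _] := h (1 - normR w); first by rewrite subr_gt0 -discE.
  have vd : disc v.
    by rewrite discE; have := normRD (v - w) w; rewrite subrK; move: vw; lra.
  by have := lt_le_trans Gv (Gle _ vd); rewrite ltNge Gge.
have sE z : disc z -> s z = G 0 * z ^+ k.
  move=> zd; have [->|z0] := eqVneq z 0; first by rewrite s0 expr0n gtn_eqF// mulr0.
  by rewrite -(Gcst z zd) /G (negbTE z0) divfK// expf_neq0.
have G01 : normR (G 0) = 1.
  by apply/eqP; rewrite eq_le Gle ?Gge//; exact: disc0.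
exists (G 0) => // z zd; rewrite sE//; congr (_ * _).
have -> : k = 1%N; last by rewrite expr1.
apply: power_inj => // r rk.
have r1 : normR (r : CC R) = 1.
  have /eqP : normR (r : CC R) ^+ k = 1 by rewrite -normRX rk normR1.
  by rewrite pexpr_eq1 ?normR_ge0// => /eqP.
have h2 : normR (2^-1 : CC R) = 2^-1 by rewrite normRV normR_nat.
have d1 : disc (2^-1 : CC R) by rewrite discE h2 invf_lt1// ltr1n.
have d2 : disc (r / 2 : CC R) by rewrite discE normRM r1 mul1r h2 invf_lt1// ltr1n.
have : (r / 2 : CC R) = 2^-1.
  by apply: (bij_inj sbij) => //; rewrite !sE// expr_div_n rk mul1r exprVn.
by move/(congr1 (fun x => x * 2)); rewrite divfK ?mulVf// pnatr_eq0.
Qed.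

Lemma quot_bij_moeb s : (forall z, disc z -> quot_at s z) -> set_bij disc disc s ->
  exists lam a : CC R, [/\ normR lam = 1, disc a & forall z, disc z -> s z = lam * moeb a z].
Proof.
move=> qs sbij; have [a ad sa] := bij_surj sbij disc0.
have [|||lam lam1 Hlam] := @schwarz (s \o moeb (- a)).
- move=> z zd; apply: (quot_comp_frac (moeb_frac (discN ad) zd)).
  by apply/qs/moeb_disc => //; exact: discN.
- split.
  + by move=> z zd; apply/(bij_disc sbij)/moeb_disc => //; exact: discN.
  + move=> z w; rewrite !inE => zd wd /(bij_inj sbij) h.
    have := congr1 (moeb a) (h (moeb_disc (discN ad) zd) (moeb_disc (discN ad) wd)).
    by rewrite !moebNK.
  + move=> w /(bij_surj sbij)[z zd <-]; exists (moeb a z); first exact: moeb_disc.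
    by rewrite /= moebK.
- by rewrite /= moeb0 opprK.
exists lam, a; split => // z zd.
have := Hlam (moeb a z) (moeb_disc ad zd); rewrite /comp moebK//.
Qed.

End Schwarz.

(** * The little Bloch space *)

Section BstarBasics.
Context {R : realType} {E : normedModType R[i]}.
Implicit Types (f g : Bstar E) (z w a : CC R) (x y : E) (c : R[i]).

Lemma Bstar_analytic f z : disc z -> analytic_at f z.
Proof. by move=> zd; have := Bstar_funP f; rewrite inE => -[h _ _]; exact: h. Qed.

Lemma Bstar_vanish f (e : R) : 0 < e ->
  exists2 r : R, r < 1 & forall z, r < normR z < 1 -> bloch_weight f z < e.
Proof. by move=> e0; have := Bstar_funP f; rewrite inE => -[_ h _]; exact: h. Qed.

Lemma Bstar_out f z : ~ disc z -> f z = 0.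
Proof. by move=> zd; have := Bstar_funP f; rewrite inE => -[_ _ h]; exact: h. Qed.

Lemma Bstar_eq f g : (forall z, disc z -> f z = g z) -> f = g.
Proof.
move=> fg; apply: val_inj => /=; apply/funext => z.
by have [/fg//|zd] := pselect (disc z); rewrite !Bstar_out.
Qed.

Lemma BstarP c f g z : (c *: f + g : Bstar E) z = c *: f z + g z.
Proof. by []. Qed.

Lemma BstarD f g z : (f + g : Bstar E) z = f z + g z.
Proof. by []. Qed.

Lemma BstarN f z : (- f : Bstar E) z = - f z.
Proof. by []. Qed.

Lemma BstarZ c f z : (c *: f : Bstar E) z = c *: f z.
Proof. by []. Qed.

Lemma Bstar0 z : (0 : Bstar E) z = 0.
Proof. by []. Qed.

Definition dB f z : E := derive1 f z.

Lemma dB_derR f z : disc z -> derR f z (dB f z).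
Proof. by move=> zd; apply/analytic_derR/Bstar_analytic. Qed.

Lemma dBP c f g z : disc z -> dB (c *: f + g) z = c *: dB f z + dB g z.
Proof.
move=> zd; apply: derR_derive1.
exact: (derR_lin c (dB_derR f zd) (dB_derR g zd)).
Qed.

Lemma dB0 z : disc z -> dB 0 z = 0.
Proof.
by move=> zd; have := dBP (-1) 0 0 zd; rewrite scaler0 addr0 scaleN1r addNr.
Qed.

Lemma dBD f g z : disc z -> dB (f + g) z = dB f z + dB g z.
Proof. by move=> zd; have := dBP 1 f g zd; rewrite !scale1r. Qed.

Lemma dBZ c f z : disc z -> dB (c *: f) z = c *: dB f z.
Proof. by move=> zd; have := dBP c f 0 zd; rewrite addr0 dB0// addr0. Qed.

Lemma dBN f z : disc z -> dB (- f) z = - dB f z.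
Proof. by move=> zd; rewrite -scaleN1r dBZ// scaleN1r. Qed.

Lemma dBB f g z : disc z -> dB (f - g) z = dB f z - dB g z.
Proof. by move=> zd; rewrite dBD// dBN. Qed.

Lemma disc_open z : disc z -> exists2 d : R, 0 < d & forall w, normR (w - z) < d -> disc w.
Proof.
rewrite discE => z1; exists (1 - normR z); first by rewrite subr_gt0.
move=> w wz; rewrite discE; have := normRD (w - z) z; rewrite subrK.
by move: wz; lra.
Qed.

Lemma dB_analytic f z : disc z -> analytic_at (dB f) z.
Proof.
move=> /disc_open[d d0 hd]; apply: (analytic_derive1 d0) => w /hd.
exact: Bstar_analytic.
Qed.

Lemma wtE f z : bloch_weight f z = (1 - normR z ^+ 2) * normR (dB f z).
Proof. by []. Qed.

Lemma wt_ge0 f z : disc z -> 0 <= bloch_weight f z.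
Proof.
by rewrite disc_weight => zd; rewrite wtE mulr_ge0 ?normR_ge0// ltW.
Qed.

Lemma wt_eq0 f z : disc z -> (bloch_weight f z == 0) = (dB f z == 0).
Proof.
by rewrite disc_weight => zd; rewrite wtE mulf_eq0 gt_eqF//= normR_eq0.
Qed.

Lemma wt_lin c f g z : disc z -> bloch_weight (c *: f + g : Bstar E) z <=
  normR (c : CC R) * bloch_weight f z + bloch_weight g z.
Proof. by move=> zd; apply: bloch_weight_linear => //; exact: Bstar_analytic. Qed.

Lemma wt_cts f z : disc z -> ctsR (bloch_weight f) z.
Proof.
move=> zd; apply/ctsRP; rewrite /prop_for /continuous_at.
apply: (@cvgM R _ (nbhs z) _ (fun w : CC R => 1 - normR w ^+ 2) (fun w => normR (dB f w))).
  have cn : {for z, continuous (fun w : CC R => normR w)}.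
    apply/ctsRP => e e0; exists e => // w; apply: le_lt_trans; exact: normR_dist.
  by apply: cvgB; [exact: cvg_cst|apply: cvgM].
by have /ctsRP := ctsV_normR (analytic_cts (dB_analytic f zd)).
Qed.

Definition is_peak f p := disc p /\ forall w, disc w -> bloch_weight f w <= bloch_weight f p.

(** The weight is small near the boundary, so it suffices to maximize it on a
    smaller closed disc. *)
Lemma exists_peak f : exists p, is_peak f p.
Proof.
have [[w0 w0d fw0]|nf] := pselect (exists2 w, disc w & 0 < bloch_weight f w); last first.
  exists 0; split; first exact: disc0.
  move=> w wd; rewrite (le_trans _ (wt_ge0 _ disc0))// leNgt; apply/negP => fw.
  by apply: nf; exists w.
have [r r1 hr] := Bstar_vanish f fw0.
pose r' := Num.max r (normR w0).
have r'1 : r' < 1 by rewrite gt_max r1 -discE.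
have [||p [pr _] hp] := @EVT_ball R 0 r' (fun=> 0) (bloch_weight f).
- move=> z; rewrite subr0 => zr; split; first exact: ctsR_cst.
  by apply: wt_cts; rewrite discE (le_lt_trans zr).
- by exists w0; rewrite // subr0 le_max lexx orbT.
rewrite subr0 in pr; exists p; split; first by rewrite discE (le_lt_trans pr).
move=> w; rewrite discE => wd; have [wr|rw] := leP (normR w) r'.
  by apply: hp; rewrite ?subr0.
have w0p : bloch_weight f w0 <= bloch_weight f p.
  by apply: hp; rewrite ?subr0// le_max lexx orbT.
rewrite (le_trans _ w0p)// ltW// hr// wd andbT.
by rewrite (le_lt_trans _ rw)// le_max lexx.
Qed.

Definition peak f := xget 0 [set p | is_peak f p].

Lemma peakP f : is_peak f (peak f).
Proof. by apply: (xgetPex 0 (P := [set p | is_peak f p])); exact: exists_peak. Qed.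

Definition beta f : R := bloch_weight f (peak f).

Lemma wt_le_beta f z : disc z -> bloch_weight f z <= beta f.
Proof. by have [_ h] := peakP f; exact: h. Qed.

Lemma beta_ge0 f : 0 <= beta f.
Proof. by apply: wt_ge0; have [] := peakP f. Qed.

Lemma peak_beta f p : is_peak f p -> bloch_weight f p = beta f.
Proof.
move=> [pd hp]; apply/eqP; rewrite eq_le wt_le_beta//= hp//.
by have [] := peakP f.
Qed.

Lemma beta_le f (M : R) : (forall w, disc w -> bloch_weight f w <= M) -> beta f <= M.
Proof. by move=> h; apply: h; have [] := peakP f. Qed.

Lemma beta_peak f p : disc p -> bloch_weight f p = beta f -> is_peak f p.
Proof. by move=> pd fp; split => // w /wt_le_beta; rewrite fp. Qed.

Definition nB f : R := normR (f 0) + beta f.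

Lemma bloch_normE f : bloch_norm f = (nB f)%:E.
Proof.
rewrite /bloch_norm /nB EFinD; congr (_ + _)%E; apply/eqP; rewrite eq_le.
have [pd hp] := peakP f; apply/andP; split.
  apply: ge_ereal_sup => _ [z zd <-]; rewrite lee_fin.
  exact: wt_le_beta.
by apply: ereal_sup_ubound; exists (peak f).
Qed.

Lemma cst_of_dB0 f : (forall w, disc w -> dB f w = 0) -> forall z, disc z -> f z = f 0.
Proof.
by move=> f0; apply: zero_derivative_cst => w wd; rewrite -(f0 w wd); exact: dB_derR.
Qed.

Lemma nB_eq0 f : nB f = 0 -> f = 0.
Proof.
move=> /eqP; rewrite paddr_eq0 ?normR_ge0 ?beta_ge0// => /andP[f0 b0].
apply: Bstar_eq => z zd; rewrite cst_of_dB0//; first by apply/eqP; rewrite -normR_eq0.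
move=> w wd; apply/eqP; rewrite -wt_eq0// eq_le wt_ge0// andbT -(eqP b0).
exact: wt_le_beta.
Qed.

(** Membership in the little Bloch space of the restriction of [F] to the disc, with no
    condition on the values outside. *)
Definition blochfun (F : CC R -> E) :=
  (forall z, disc z -> analytic_at F z) /\
  forall e : R, 0 < e -> exists2 r : R, r < 1 &
    forall z, r < normR z < 1 -> bloch_weight F z < e.

Lemma derive1_eq_near (F G : CC R -> E) z (d : R) : 0 < d -> analytic_at F z ->
  (forall w, normR (w - z) < d -> F w = G w) -> derive1 G z = derive1 F z.
Proof.
move=> d0 Fz FG; apply: derR_derive1 => e e0.
have [d1 d10 h1] := analytic_derR Fz e0.
exists (Num.min d d1); first by rewrite lt_min d0.
move=> h; rewrite lt_min => /andP[hd /h1].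
by rewrite !FG ?subrr ?normR0// addrAC subrr add0r.
Qed.

(** The element with the values of [F] on the disc, when [F] satisfies [blochfun]. Taking
    the proof of [blochfun] out of the construction keeps the elements below
    easy to compare. *)
Definition toB (F : CC R -> E) : Bstar E :=
  xget 0 [set g : Bstar E | forall z, disc z -> g z = F z].

Lemma toBE F z : blochfun F -> disc z -> toB F z = F z.
Proof.
move=> [aF wF]; pose G w := if w \in disc then F w else 0.
have FG z' : disc z' -> exists2 d : R, 0 < d & forall w, normR (w - z') < d -> F w = G w.
  move=> /disc_open[d d0 hd]; exists d => // w /hd wd.
  by rewrite /G mem_set.
have GB : G \in little_bloch.
  rewrite inE; split=> [z' zd|e e0|z' zd].
  - by have [d d0 hd] := FG _ zd; apply: (analytic_eq_near d0 hd); exact: aF.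
  - have [r r1 hr] := wF _ e0; exists r => // w wr.
    have wd : disc w by rewrite discE; case/andP: wr.
    have [d d0 hd] := FG _ wd.
    by rewrite /bloch_weight (derive1_eq_near d0 (aF _ wd) hd); exact: hr.
  - by rewrite /G memNset.
have : [set g : Bstar E | forall z, disc z -> g z = F z] (toB F).
  apply: xgetPex; exists (MkBstar GB) => z' zd /=.
  by rewrite /G mem_set.
by apply.
Qed.

Lemma dB_toB F z : blochfun F -> disc z -> dB (toB F) z = derive1 F z.
Proof.
move=> FB zd; have [d d0 hd] := disc_open zd.
by apply: (derive1_eq_near d0 (FB.1 z zd)) => w /hd wd; rewrite toBE.
Qed.

Lemma wt_toB F z : blochfun F -> disc z -> bloch_weight (toB F) z = bloch_weight F z.
Proof. by move=> FB zd; rewrite wtE dB_toB. Qed.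

End BstarBasics.

(** * Powers, compositions and peaking functions *)

Section BstarElements.
Context {R : realType} {E : normedModType R[i]}.
Implicit Types (f g : Bstar E) (z w a lam : CC R) (x y : E) (c : R[i]).

Lemma near_boundary (e : R) : 0 < e -> exists2 r : R, r < 1 &
  forall z : CC R, r < normR z < 1 -> 1 - normR z ^+ 2 < e.
Proof.
move=> e0; exists (1 - e / 2); first by move: e0; lra.
move=> z /andP[h1 h2]; have h0 := normR_ge0 z.
rewrite expr2 (_ : 1 - _ = (1 - normR z) * (1 + normR z)); last by ring.
have : (1 - normR z) * (1 + normR z) <= (1 - normR z) * 2.
  by rewrite ler_wpM2l//; move: h2; lra.
by move: h1; lra.
Qed.

Lemma blochfun_bounded (F : CC R -> E) (B : R) :
  (forall z, disc z -> analytic_at F z) ->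
  (forall z, disc z -> normR (derive1 F z) <= B) -> blochfun F.
Proof.
move=> aF FB; have B0 : 0 <= B.
  by rewrite (le_trans _ (FB 0 disc0))// normR_ge0.
have B1 : 0 < B + 1 by rewrite ltr_wpDl.
split=> // e e0; have [r r1 hr] := near_boundary (divr_gt0 e0 B1).
exists r => // z rz; have zd : disc z by rewrite discE; case/andP: rz.
have := hr z rz; rewrite ltr_pdivlMr// => h; apply: le_lt_trans h.
rewrite /bloch_weight ler_wpM2l//; first by rewrite ltW// -disc_weight.
by rewrite (le_trans (FB z zd))// lerDl.
Qed.

Definition cstB x : Bstar E := toB (fun=> x).
Definition powB n x : Bstar E := toB (fun w : CC R => w ^+ n *: x).

Lemma derR_pow n x z : derR (fun w : CC R => w ^+ n *: x) z ((n%:R * z ^+ n.-1) *: x).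
Proof.
move=> e e0; pose s := normR z + 1.
have s0 : 0 < s by rewrite ltr_wpDl ?normR_ge0.
pose B := (4 * s) ^+ n / s ^+ 2 * normR x.
have B0 : 0 <= B by rewrite mulr_ge0 ?normR_ge0// divr_ge0 ?exprn_ge0 ?mulr_ge0// ltW.
have B1 : 0 < B + 1 by rewrite ltr_wpDl.
exists (Num.min s (e / (B + 1))); first by rewrite lt_min s0 divr_gt0.
move=> h; rewrite lt_min => /andP[hs he].
rewrite (_ : _ - _ = mono_rem z h n *: x); last by rewrite /mono_rem; lmod_eq R[i].
rewrite normRZ; have zs : normR z <= s by rewrite lerDl.
have := mono_rem_le n (ltW s0) zs (ltW hs).
rewrite -ler_pdivlMr ?exprn_gt0// => /(ler_wpM2r (normR_ge0 x))/le_trans; apply.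
rewrite [leLHS](_ : _ = B * normR h * normR h); last by rewrite /B; ring.
rewrite ler_wpM2r ?normR_ge0// (@le_trans _ _ ((B + 1) * normR h))//.
  by rewrite ler_wpM2r ?normR_ge0// lerDl.
by rewrite mulrC -ler_pdivlMr// ltW.
Qed.

Lemma analytic_pow n x z : analytic_at (fun w : CC R => w ^+ n *: x) z.
Proof.
elim: n => [|n IH].
  by apply: (analytic_eq_near ltr01 _ (analytic_cst x z)) => w _; rewrite expr0 scale1r.
apply: (analytic_eq_near ltr01 _ (analytic_mul_affine 0 1 IH)) => w _.
by rewrite add0r mul1r scalerA -exprS.
Qed.

Lemma blochfun_pow n x : blochfun (fun w : CC R => w ^+ n *: x).
Proof.
apply: (@blochfun_bounded _ (n%:R * normR x)) => [z _|z zd]; first exact: analytic_pow.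
rewrite (derR_derive1 (derR_pow n x z)) normRZ normRM normR_nat normRX.
rewrite ler_wpM2r ?normR_ge0// ler_piMr// exprn_ile1 ?normR_ge0//.
by rewrite ltW// -discE.
Qed.

Lemma powBE n x z : disc z -> powB n x z = z ^+ n *: x.
Proof. by move=> zd; rewrite toBE//; exact: blochfun_pow. Qed.

Lemma dB_powB n x z : disc z -> dB (powB n x) z = (n%:R * z ^+ n.-1) *: x.
Proof.
move=> zd; rewrite dB_toB//; first exact/derR_derive1/derR_pow.
exact: blochfun_pow.
Qed.

Lemma cstB_pow x : cstB x = powB 0 x.
Proof. by rewrite /cstB /powB; congr toB; apply/funext => z; rewrite expr0 scale1r. Qed.

Lemma cstBE x z : disc z -> cstB x z = x.
Proof. by move=> zd; rewrite cstB_pow powBE// expr0 scale1r. Qed.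

Lemma dB_cstB x z : disc z -> dB (cstB x) z = 0.
Proof. by move=> zd; rewrite cstB_pow dB_powB// mul0r scale0r. Qed.

Lemma powB_linear n c x y : powB n (c *: x + y) = c *: powB n x + powB n y.
Proof. by apply: Bstar_eq => z zd; rewrite BstarP !powBE//; lmod_eq R[i]. Qed.

Lemma cstB_linear c x y : cstB (c *: x + y) = c *: cstB x + cstB y.
Proof. by rewrite !cstB_pow powB_linear. Qed.

Definition moebius lam a z : CC R := lam * moeb a z.

Lemma moebius_disc lam a z : normR lam = 1 -> disc a -> disc z -> disc (moebius lam a z).
Proof. by move=> l1 ad zd; rewrite discE /moebius normRM l1 mul1r -discE; exact: moeb_disc. Qed.

Lemma moebius_frac lam a z : disc a -> disc z ->
  frac_at (moebius lam a) z (lam * moeb_deriv a z) (conjC a / (1 - conjC a * z)).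
Proof.
move=> ad zd; have [e e0 he] := moeb_frac ad zd; exists e => // h /he[h0 hE].
by split => //; rewrite /moebius hE; ring.
Qed.

Lemma moebius_weight lam a z : normR lam = 1 -> disc a -> disc z ->
  (1 - normR z ^+ 2) * normR (lam * moeb_deriv a z) = 1 - normR (moebius lam a z) ^+ 2.
Proof. by move=> l1 ad zd; rewrite /moebius !(normRM lam) l1 !mul1r moeb_weight. Qed.

Definition compB lam a f : Bstar E := toB (f \o moebius lam a).

Lemma derR_compB lam a f z : normR lam = 1 -> disc a -> disc z ->
  derR (f \o moebius lam a) z ((lam * moeb_deriv a z) *: dB f (moebius lam a z)).
Proof.
move=> l1 ad zd; apply: derR_comp; first exact/dB_derR/moebius_disc.
exact: derR_frac (moebius_frac lam ad zd).
Qed.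

Lemma wt_comp lam a f z : normR lam = 1 -> disc a -> disc z ->
  bloch_weight (f \o moebius lam a) z = bloch_weight f (moebius lam a z).
Proof.
move=> l1 ad zd; rewrite /bloch_weight (derR_derive1 (derR_compB f l1 ad zd)).
by rewrite normRZ mulrA moebius_weight.
Qed.

(** By [moeb_norm], [1 - |sigma z|^2] is at most a constant times [1 - |z|^2], so that
    [sigma z] is near the boundary when [z] is. *)
Lemma blochfun_comp lam a f : normR lam = 1 -> disc a -> blochfun (f \o moebius lam a).
Proof.
move=> l1 ad; split=> [z zd|e e0].
  by apply: analytic_comp_frac (moebius_frac lam ad zd) _; exact/Bstar_analytic/moebius_disc.
have [r r1 hr] := Bstar_vanish f e0.
pose r0 := Num.max r 0.
have r01 : r0 < 1 by rewrite gt_max r1 ltr01.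
have r00 : 0 <= r0 by rewrite le_max lexx orbT.
have ka : 0 < (1 - normR a) ^+ 2 by rewrite exprn_gt0// subr_gt0 -discE.
have q0 : 0 < 1 - r0 ^+ 2 by rewrite subr_gt0 expr_lt1.
have [r' r'1 hr'] := near_boundary (mulr_gt0 ka q0).
exists r' => // z rz; have zd : disc z by rewrite discE; case/andP: rz.
have sd := moebius_disc l1 ad zd.
rewrite wt_comp//; apply: hr; apply/andP; split; last by rewrite -discE.
apply: (@le_lt_trans _ _ r0); first by rewrite le_max lexx.
rewrite -(@ltr_pXn2r _ 2)// ?nnegrE ?normR_ge0//.
suff : 1 - normR (moebius lam a z) ^+ 2 < 1 - r0 ^+ 2 by lra.
rewrite /moebius normRM l1 mul1r moeb_norm//.
have den : (1 - normR a) ^+ 2 <= normR (1 - conjC a * z) ^+ 2.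
  rewrite lerXn2r// ?nnegrE ?normR_ge0//; first by rewrite subr_ge0 ltW// -discE.
  have := normR_sub 1 (conjC a * z); rewrite normR1 normRM normRJ.
  have : normR a * normR z <= normR a by rewrite ler_piMr ?normR_ge0// ltW// -discE.
  by lra.
rewrite ltr_pdivrMr; last exact: lt_le_trans den.
apply: (@le_lt_trans _ _ (1 - normR z ^+ 2)).
  by rewrite ler_piMl//; [rewrite ltW// -disc_weight|rewrite gerBl exprn_ge0 ?normR_ge0].
by rewrite (lt_le_trans (hr' z rz))// mulrC ler_wpM2l// ltW.
Qed.

Lemma compBE lam a f z : normR lam = 1 -> disc a -> disc z ->
  compB lam a f z = f (moebius lam a z).
Proof. by move=> l1 ad zd; rewrite toBE//; exact: blochfun_comp. Qed.

Lemma dB_compB lam a f z : normR lam = 1 -> disc a -> disc z ->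
  dB (compB lam a f) z = (lam * moeb_deriv a z) *: dB f (moebius lam a z).
Proof.
move=> l1 ad zd; rewrite dB_toB//; last exact: blochfun_comp.
exact/derR_derive1/derR_compB.
Qed.

Lemma wt_compB lam a f z : normR lam = 1 -> disc a -> disc z ->
  bloch_weight (compB lam a f) z = bloch_weight f (moebius lam a z).
Proof.
move=> l1 ad zd; rewrite wt_toB ?wt_comp//; exact: blochfun_comp.
Qed.

(** [x] times a disc automorphism vanishing at [a], normalized at 0: the weight of this
    function has a strict maximum at [a]. *)
Definition mu a x : Bstar E := compB 1 a (powB 1 x) + cstB (a *: x).

Lemma mu0 a x : disc a -> mu a x 0 = 0.
Proof.
move=> ad; rewrite BstarD compBE ?normR1 ?cstBE//; try exact: disc0.
rewrite powBE; last by apply: moebius_disc; rewrite ?normR1//; exact: disc0.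
by rewrite /moebius moeb0 mul1r expr1 -scalerDl addNr scale0r.
Qed.

Lemma dB_mu a x z : disc a -> disc z -> dB (mu a x) z = moeb_deriv a z *: x.
Proof.
move=> ad zd; rewrite dBD// dB_cstB// addr0 dB_compB ?normR1// dB_powB; last first.
  by apply: moebius_disc; rewrite ?normR1.
by rewrite expr0 mul1r !mulr1 scale1r.
Qed.

Lemma mu_linear a c x y : disc a -> mu a (c *: x + y) = c *: mu a x + mu a y.
Proof.
move=> ad; apply: Bstar_eq => z zd.
have n1 : normR (1 : CC R) = 1 by exact: normR1.
rewrite BstarP !BstarD !compBE// !cstBE// !powBE; try exact: moebius_disc.
by lmod_eq R[i].
Qed.

Lemma wt_mu a x z : disc a -> disc z ->
  bloch_weight (mu a x) z = (1 - normR (moeb a z) ^+ 2) * normR x.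
Proof. by move=> ad zd; rewrite wtE dB_mu// normRZ mulrA moeb_weight. Qed.

Lemma wt_mu_aa a x : disc a -> bloch_weight (mu a x) a = normR x.
Proof. by move=> ad; rewrite wt_mu// moeb_aa normR0 expr0n subr0 mul1r. Qed.

Lemma mu_is_peak a x : disc a -> is_peak (mu a x) a.
Proof.
move=> ad; split => // w wd; rewrite wt_mu_aa// wt_mu//.
by rewrite ler_piMl ?normR_ge0// gerBl exprn_ge0 ?normR_ge0.
Qed.

Lemma beta_mu a x : disc a -> beta (mu a x) = normR x.
Proof. by move=> ad; rewrite -(peak_beta (mu_is_peak x ad)) wt_mu_aa. Qed.

(** This lower bound is what makes the peak of [mu a x] strict, quantitatively. *)
Lemma moeb_ge a w : disc a -> disc w -> normR (w - a) / 2 <= normR (moeb a w).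
Proof.
move=> ad wd; have d0 := moeb_den ad wd.
rewrite /moeb normRM normRV ler_wpM2l ?normR_ge0// lef_pV2 ?posrE ?normR_gt0//.
have := normRB 1 (conjC a * w); rewrite normR1 normRM normRJ.
have : normR a * normR w <= 1 * 1.
  by rewrite ler_pM ?normR_ge0// ltW// -discE.
by lra.
Qed.

Lemma peak_mu_uniq a x p : disc a -> x != 0 -> disc p ->
  normR x <= bloch_weight (mu a x) p -> p = a.
Proof.
move=> ad x0 pd; rewrite wt_mu// -subr_ge0.
rewrite (_ : _ - _ = - (normR (moeb a p) ^+ 2 * normR x)); last by ring.
rewrite oppr_ge0 => h; have : normR (moeb a p) ^+ 2 * normR x == 0.
  by rewrite eq_le h mulr_ge0 ?exprn_ge0 ?normR_ge0.
rewrite mulf_eq0 normR_eq0 (negbTE x0) orbF sqrf_eq0 => /eqP m0.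
have := moeb_ge ad pd; rewrite m0 => h1; apply/eqP; rewrite -subr_eq0 -normR_eq0.
by rewrite eq_le normR_ge0 andbT; move: h1; lra.
Qed.

Lemma moeb_deriv_aa a : disc a -> moeb_deriv a a = ((1 - normR a ^+ 2)^-1)%:C%C.
Proof.
move=> ad; have d0 := moeb_den ad ad.
rewrite fmorphV rmorphB rmorph1 /= normR_sqrC /moeb_deriv mulrC.
by rewrite [a * _]mulrC; field.
Qed.

(** These polynomials are the test functions by which evaluations of the derivative at
    distinct points are shown to be linearly independent. *)
Lemma separate z1 z2 z3 x : disc z1 -> disc z2 -> disc z3 -> z1 != z2 -> z1 != z3 ->
  exists G : Bstar E, [/\ G 0 = 0, dB G z1 = x, dB G z2 = 0 & dB G z3 = 0].
Proof.
move=> d1 d2 d3 z12 z13.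
pose k : CC R := ((z1 - z2) * (z1 - z3))^-1.
have h12 : z1 - z2 != 0 by rewrite subr_eq0.
have h13 : z1 - z3 != 0 by rewrite subr_eq0.
pose G : Bstar E := (k / 3) *: powB 3 x + ((- k * (z2 + z3) / 2) *: powB 2 x + (k * z2 * z3) *: powB 1 x).
have dG w : disc w -> dB G w = (k * (w - z2) * (w - z3)) *: x.
  move=> wd; rewrite /G dBP// dBP// dBZ// !dB_powB//= expr0 expr1 expr2 !scalerA -!scalerDl.
  by congr (_ *: _); field.
exists G; split.
- have z0 := @disc0 R; rewrite /G BstarP BstarP BstarZ !powBE// !expr0n /=.
  by rewrite !scale0r !scaler0 !addr0.
- by rewrite dG// -[RHS]scale1r -mulrA; congr (_ *: _); rewrite /k mulVf// mulf_neq0.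
- by rewrite dG// subrr mulr0 mul0r scale0r.
- by rewrite dG// subrr mulr0 scale0r.
Qed.

End BstarElements.

(** * Support functionals *)

Section SupportFunctionals.
Context {R : realType} {E : normedModType R[i]}.
Implicit Types (x y : E) (c : CC R).

Lemma eq_norm_of_Re (z : CC R) (M : R) : normR z <= M -> M <= complex.Re z -> z = M%:C%C.
Proof.
move=> zM Mz; have zz : normR z <= complex.Re z by exact: le_trans Mz.
rewrite [LHS]Re_eq_normR//; congr (_%:C)%C; apply/eqP.
by rewrite eq_le zM (le_trans Mz)// Re_le_normR.
Qed.

(** A support functional in terms of the real-valued norms, at an arbitrary vector; by
    homogeneity smoothness also gives uniqueness away from the unit sphere. *)
Definition suppR y (psi : E -> CC R) :=
  [/\ linear psi, forall x, normR (psi x) <= normR x & psi y = (normR y)%:C%C].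

Lemma suppRP y psi : suppR y psi <-> support_functional y psi.
Proof.
split=> -[lp bp py]; split => //.
- by move=> x; rewrite -!normRE lecR.
- by rewrite py normRE.
- by move=> x; rewrite -lecR !normRE.
- by rewrite py normRE.
Qed.

Lemma suppR_scale y psi (t : R) : 0 < t -> suppR (t%:C%C *: y) psi -> suppR y psi.
Proof.
move=> t0 [lp bp py]; split => //.
have tn0 : (t%:C)%C != 0 :> R[i] by rewrite eq_complex /= gt_eqF.
apply: (mulfI tn0); have := linZ lp (t%:C)%C y; rewrite py => E1.
rewrite -[LHS]/((t%:C)%C *: psi y) -E1 normRZ normR_real gtr0_norm//.
by rewrite rmorphM.
Qed.

Definition phi y : E -> CC R := xget (fun=> 0) [set psi | suppR y psi].

Section Smooth.
Hypothesis smoothE : smooth_space E.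

Lemma unit_dir y : y != 0 -> normR (((normR y)^-1)%:C%C *: y) = 1.
Proof.
move=> y0; have yp : 0 < normR y by rewrite normR_gt0.
by rewrite normRZ normR_real gtr0_norm ?invr_gt0// mulVf// gt_eqF.
Qed.

Lemma phiP y : y != 0 -> suppR y (phi y).
Proof.
move=> y0; have yp : 0 < normR y by rewrite normR_gt0.
apply: (xgetPex (fun=> 0) (P := [set psi | suppR y psi])).
have /smoothE[psi [/suppRP hpsi _]] : `|((normR y)^-1)%:C%C *: y| = 1.
  by rewrite -normRE unit_dir.
by exists psi; apply: suppR_scale hpsi; rewrite invr_gt0.
Qed.

Lemma phi_uniq y psi : y != 0 -> suppR y psi -> psi = phi y.
Proof.
move=> y0; have yp : 0 < normR y by rewrite normR_gt0.
have [psi0 [_ hu]] : exists! psi : E -> CC R,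
    support_functional (((normR y)^-1)%:C%C *: y) psi.
  by apply: smoothE; rewrite -normRE unit_dir.
have up psi' : suppR y psi' -> suppR (((normR y)^-1)%:C%C *: y) psi'.
  move=> [lp bp py]; split => //; rewrite linZ// py unit_dir//.
  by rewrite -[LHS]/(_ * _) -rmorphM /= mulVf// gt_eqF.
move=> /up/suppRP/hu <-; have := phiP y0.
by move=> /up/suppRP/hu.
Qed.

Lemma phi_lin y : y != 0 -> linear (phi y).
Proof. by move=> /phiP[]. Qed.

Lemma phi_le y x : y != 0 -> normR (phi y x) <= normR x.
Proof. by move=> /phiP[_ h _]. Qed.

Lemma phi_self y : y != 0 -> phi y y = (normR y)%:C%C.
Proof. by move=> /phiP[]. Qed.

Lemma phi_self_neq0 y : y != 0 -> phi y y != 0.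
Proof. by move=> y0; rewrite phi_self// eq_complex /= normR_eq0 (negbTE y0). Qed.

Lemma phi_phase c y x : normR c = 1 -> y != 0 -> phi (c *: y) x = conjC c * phi y x.
Proof.
move=> c1 y0; have c0 : c != 0 by rewrite -normR_gt0 c1.
have cy0 : c *: y != 0 by rewrite scaler_eq0 (negbTE c0).
have <- : (fun x => conjC c * phi y x) = phi (c *: y) => [|//].
apply: phi_uniq => //; split.
- by move=> k u v; rewrite (phi_lin y0) mulrDr /GRing.scale /=; ring.
- by move=> u; rewrite normRM normRJ c1 mul1r phi_le.
- rewrite (linZ (phi_lin y0)) phi_self// -[_ *: _]/(_ * _) mulrA.
  by rewrite [conjC c * c]mulrC -normR_sqrC c1 expr1n mul1r normRZ c1 mul1r.
Qed.

End Smooth.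

End SupportFunctionals.

(** * Functionals on the Bloch space and their images *)

Section BlochFunctionals.
Context {R : realType} {E : normedModType R[i]}.
Hypothesis smoothE : smooth_space E.
Implicit Types (f g G : Bstar E) (z w p : CC R) (a b x y : E) (c : CC R).

(** With [phi b] supporting [b], this functional is bounded by the weight at [z], and it
    reaches it for the functions with derivative [b] at [z]. *)
Definition Lz z b g : CC R := (1 - normR z ^+ 2)%:C%C * phi b (dB g z).

Definition Lam a z b g : CC R := phi a (g 0) + Lz z b g.

Lemma Lz_lin z b : disc z -> b != 0 -> linear (Lz z b : Bstar E -> CC R).
Proof.
move=> zd b0 k f g; rewrite /Lz dBP// (phi_lin smoothE b0) mulrDr.
by congr (_ + _); rewrite /GRing.scale /= mulrCA.
Qed.

Lemma Lam_lin a z b : disc z -> a != 0 -> b != 0 -> linear (Lam a z b : Bstar E -> CC R).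
Proof.
move=> zd a0 b0 k f g; rewrite /Lam Lz_lin// BstarP (phi_lin smoothE a0).
by rewrite scalerDr addrACA.
Qed.

Lemma Lz_le z b g : disc z -> b != 0 -> normR (Lz z b g) <= bloch_weight g z.
Proof.
move=> zd b0; have w0 : 0 < 1 - normR z ^+ 2 by rewrite -disc_weight.
by rewrite /Lz normRM normR_real gtr0_norm// ler_wpM2l ?(ltW w0)// phi_le.
Qed.

Lemma Lz_self z g : disc z -> dB g z != 0 -> Lz z (dB g z) g = (bloch_weight g z)%:C%C.
Proof. by move=> zd g0; rewrite /Lz phi_self// -rmorphM. Qed.

Lemma Lz0 z b g : b != 0 -> dB g z = 0 -> Lz z b g = 0.
Proof. by move=> b0 g0; rewrite /Lz g0 lin0 ?mulr0//; exact: phi_lin. Qed.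

Lemma Lz_mu z b x : disc z -> b != 0 -> Lz z b (mu z x) = phi b x.
Proof.
move=> zd b0; rewrite /Lz dB_mu// (linZ (phi_lin smoothE b0)) moeb_deriv_aa//.
rewrite -[_ *: _]/(_ * _) mulrA -rmorphM /= divff ?mul1r// gt_eqF//.
by rewrite -disc_weight.
Qed.

Lemma Lz_neq0 z b g : disc z -> b != 0 -> dB g z = b -> Lz z b g != 0.
Proof.
move=> zd b0 gb; rewrite /Lz gb mulf_neq0 ?phi_self_neq0//.
by rewrite eq_complex /= gt_eqF// -disc_weight.
Qed.

Lemma Lam_le a z b g : disc z -> a != 0 -> b != 0 -> normR (Lam a z b g) <= nB g.
Proof.
move=> zd a0 b0; rewrite (le_trans (normRD _ _))// lerD ?phi_le//.
by rewrite (le_trans (Lz_le _ _ _))// wt_le_beta.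
Qed.

Lemma beta_cst x : beta (cstB x : Bstar E) = 0.
Proof.
apply/eqP; rewrite eq_le beta_ge0 andbT; apply: beta_le => w wd.
by rewrite wtE dB_cstB// normR0 mulr0.
Qed.

Lemma nB_cst x : nB (cstB x : Bstar E) = normR x.
Proof. by rewrite /nB beta_cst addr0 cstBE//; exact: disc0. Qed.

Lemma nB_mu z x : disc z -> nB (mu z x) = normR x.
Proof. by move=> zd; rewrite /nB mu0// normR0 add0r beta_mu. Qed.

Lemma beta_cst_mu z a b : disc z -> beta (cstB a + mu z b) = normR b.
Proof.
move=> zd; have wtE' w : disc w -> bloch_weight (cstB a + mu z b : Bstar E) w = bloch_weight (mu z b) w.
  by move=> wd; rewrite !wtE dBD// dB_cstB// add0r.
have pk : is_peak (cstB a + mu z b) z.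
  split=> // w wd; rewrite !wtE'//; exact: (mu_is_peak b zd).2.
by rewrite -(peak_beta pk) wtE'// wt_mu_aa.
Qed.

Lemma nB_cst_mu z a b : disc z -> nB (cstB a + mu z b) = normR a + normR b.
Proof.
move=> zd; rewrite /nB beta_cst_mu// BstarD cstBE ?mu0 ?addr0//.
exact: disc0.
Qed.

(** Perturbing [mu z b] by [c g], with [c] small, changes the maximum of the weight by
    less than any multiple of [|c|]: near [z] because the weight of [g] is small there,
    elsewhere because the peak is strict. A support functional must then vanish at [g]. *)
Lemma supp_vanish z b (L : Bstar E -> CC R) g : disc z -> b != 0 ->
  linear L -> (forall h, normR (L h) <= nB h) -> L (mu z b) = (normR b)%:C%C ->
  g 0 = 0 -> dB g z = 0 -> L g = 0.
Proof.
move=> zd b0 lL bL Lb g0 gz; apply/eqP; apply: contraT => Lg0.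
have B0 : 0 < normR b by rewrite normR_gt0.
pose l := normR (L g); have l0 : 0 < l by rewrite normR_gt0.
have [eta eta0 heta] := wt_cts g zd (divr_gt0 l0 (ltr0Sn _ 1)).
have wz : bloch_weight g z = 0 by rewrite wtE gz normR0 mulr0.
(* the phase for which [L (mu z b + s u g) = |b| + s |L g|] *)
pose u : CC R := l%:C%C / L g.
have u1 : normR u = 1 by rewrite normRM normRV normR_real gtr0_norm// divff// gt_eqF.
(* at distance [eta] from the peak, the weight of [mu z b] has lost at least [d] *)
pose d := normR b * (eta / 2) ^+ 2.
have d0 : 0 < d by rewrite mulr_gt0// exprn_gt0// divr_gt0.
have C1 : 0 < beta g + 1 by rewrite ltr_wpDl ?beta_ge0.
pose s := d / (beta g + 1); have s0 : 0 < s by rewrite divr_gt0.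
have sb : s * beta g <= d.
  rewrite /s mulrAC ler_pdivrMr// ler_wpM2l ?(ltW d0)// lerDl//.
pose c : CC R := s%:C%C * u.
have cs : normR c = s by rewrite normRM u1 mulr1 normR_real gtr0_norm.
pose h : Bstar E := c *: g + mu z b.
have Lh : L h = (s * l + normR b)%:C%C.
  rewrite /h lL Lb rmorphD rmorphM /=; congr (_ + _).
  by rewrite -[_ *: _]/(_ * _) /c /u -mulrA divfK.
have hb : nB h <= normR b + s * (l / 2).
  rewrite /nB BstarP g0 scaler0 add0r mu0// normR0 add0r.
  apply: beta_le => w wd; rewrite (le_trans (wt_lin _ _ _ wd))// cs.
  have [wzn|wzf] := ltP (normR (w - z)) eta.
    have := heta w wzn; rewrite wz subr0 => /(le_lt_trans (ler_norm _)) hw.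
    rewrite addrC lerD//; last by rewrite ler_wpM2l ?(ltW s0)// ltW.
    by rewrite -(beta_mu b zd) wt_le_beta.
  have h1 : s * bloch_weight g w <= d.
    by apply: le_trans sb; rewrite ler_wpM2l ?(ltW s0)// wt_le_beta.
  have h2 : bloch_weight (mu z b) w <= normR b - d.
    rewrite wt_mu// mulrBl mul1r lerD2l lerN2 /d mulrC ler_wpM2r ?normR_ge0//.
    rewrite lerXn2r// ?nnegrE ?normR_ge0 ?divr_ge0 ?(ltW eta0)//.
    by apply: le_trans (moeb_ge zd wd); rewrite ler_wpM2r ?invr_ge0.
  have := mulr_gt0 s0 l0; move: h1 h2; lra.
have := le_trans (bL h) hb; rewrite Lh normR_real.
move=> /(le_trans (ler_norm _)); have := mulr_gt0 s0 l0; lra.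
Qed.

(** The norms of the two terms of [cstB a + mu z b] add up, so [L] supports both. On
    constants it is then [phi a], and [x |-> L (mu z x)] is [phi b]. Any [g] is a sum of a
    constant, of a [mu z x] and of a function to which [supp_vanish] applies. *)
Lemma supp_uniq a z b (L : Bstar E -> CC R) : disc z -> a != 0 -> b != 0 ->
  linear L -> (forall h, normR (L h) <= nB h) ->
  L (cstB a + mu z b) = (normR a + normR b)%:C%C -> L =1 Lam a z b.
Proof.
move=> zd a0 b0 lL bL Lab g.
have ba : normR (L (cstB a)) <= normR a by rewrite -nB_cst.
have bb : normR (L (mu z b)) <= normR b by rewrite -(nB_mu b zd).
have rab := congr1 (@complex.Re R) Lab; rewrite linD// raddfD /= in rab.
have ra := le_trans (Re_le_normR (L (cstB a))) ba.
have rb := le_trans (Re_le_normR (L (mu z b))) bb.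
have La : L (cstB a) = (normR a)%:C%C by apply: eq_norm_of_Re => //; move: rab rb; lra.
have Lb : L (mu z b) = (normR b)%:C%C by apply: eq_norm_of_Re => //; move: rab ra; lra.
have La' : (fun x => L (cstB x)) = phi a.
  apply: phi_uniq => //; split => // [k u v|x]; first by rewrite cstB_linear lL.
  by rewrite -nB_cst.
have Lb' : (fun x => L (mu z x)) = phi b.
  apply: phi_uniq => //; split => // [k u v|x]; first by rewrite mu_linear// lL.
  by rewrite -(nB_mu x zd).
pose t : CC R := (1 - normR z ^+ 2)%:C%C.
have w0 : 0 < 1 - normR z ^+ 2 by rewrite -disc_weight.
pose r := g - cstB (g 0) - t *: mu z (dB g z).
have r0 : r 0 = 0.
  have z0 := @disc0 R; rewrite /r !BstarD !BstarN BstarZ cstBE// mu0//.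
  by rewrite scaler0 subr0 subrr.
have rz : dB r z = 0.
  rewrite /r dBB// dBB// dB_cstB// subr0 dBZ// dB_mu// moeb_deriv_aa// scalerA.
  by rewrite -rmorphM /= divff ?gt_eqF// scale1r subrr.
have := supp_vanish zd b0 lL bL Lb r0 rz.
rewrite /r !(linB lL) (linZ lL) => /eqP; rewrite subr_eq0 => /eqP E1.
rewrite /Lam /Lz -La' -Lb' -[_ * _]/(t *: L _) -E1.
by rewrite addrC subrK.
Qed.

Definition isometric_pair (T Ti : Bstar E -> Bstar E) :=
  [/\ linear T, linear Ti, cancel T Ti & cancel Ti T] /\
  ((forall f, nB (T f) = nB f) /\ (forall f, nB (Ti f) = nB f)).

Lemma isometric_pair_sym T Ti : isometric_pair T Ti -> isometric_pair Ti T.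
Proof. by move=> [[? ? ? ?] [? ?]]. Qed.

(** The composition with [T] of a support functional at [T (cstB a + mu z b)] is
    [Lam a z b], by uniqueness. Also by uniqueness, this image has a nonzero value at 0 and
    a nonzero derivative: otherwise an arbitrary term of the missing kind could be
    added to a support functional there. *)
Lemma isometry_Lam T Ti a z b : isometric_pair T Ti -> disc z -> a != 0 -> b != 0 ->
  exists a' z' b', [/\ disc z', a' != 0, b' != 0 &
    forall g, Lam a' z' b' (T g) = Lam a z b g].
Proof.
move=> [[lT lTi TK TiK] [nT nTi]] zd a0 b0.
pose f : Bstar E := cstB a + mu z b; pose F := T f.
have A0 : 0 < normR a by rewrite normR_gt0.
have B0 : 0 < normR b by rewrite normR_gt0.
have nF : nB F = normR a + normR b by rewrite nT nB_cst_mu.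
have pull (L : Bstar E -> CC R) : linear L -> (forall h, normR (L h) <= nB h) ->
    L F = (nB F)%:C%C -> forall g, L (T g) = Lam a z b g.
  move=> lL bL LF g; have := @supp_uniq a z b (L \o T) zd a0 b0; apply.
  - by move=> k u v; rewrite /= lT lL.
  - by move=> h; rewrite /= -nT.
  - by rewrite /= -/f -/F LF nF.
have [p [pd ph]] := exists_peak F.
have bF : bloch_weight F p = beta F by apply: peak_beta.
have [Fp|Fp] := eqVneq (dB F p) 0.
  have bF0 : beta F = 0 by rewrite -bF wtE Fp normR0 mulr0.
  have F00 : F 0 != 0.
    by rewrite -normR_gt0; move: nF; rewrite /nB bF0; move: A0 B0; lra.
  have h1 := pull (fun g => phi (F 0) (g 0)).
  have h2 := pull (Lam (F 0) p b) (Lam_lin pd F00 b0) (fun h => Lam_le h pd F00 b0).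
  have /h1{}h1 : linear (fun g : Bstar E => phi (F 0) (g 0)).
    by move=> k u v; rewrite BstarP (phi_lin smoothE F00).
  have e1 : phi (F 0) (F 0) = (nB F)%:C%C by rewrite phi_self// /nB bF0 addr0.
  have {}h1 : forall g, phi (F 0) (T g 0) = Lam a z b g.
    apply: h1 => // h; rewrite (le_trans (phi_le _ _ _))// /nB lerDl beta_ge0//.
  have {}h2 : forall g, Lam (F 0) p b (T g) = Lam a z b g.
    by apply: h2; rewrite /Lam e1 Lz0// addr0.
  have := h2 (Ti (mu p b)); rewrite -h1 /Lam TiK => /eqP.
  rewrite -subr_eq0 addrAC subrr add0r Lz_mu// => /eqP bb.
  by have := phi_self_neq0 smoothE b0; rewrite bb eqxx.
have [F0|F0] := eqVneq (F 0) 0.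
  have h1 := pull (Lz p (dB F p)) (Lz_lin pd Fp).
  have h2 := pull (Lam a p (dB F p)) (Lam_lin pd a0 Fp) (fun h => Lam_le h pd a0 Fp).
  have e1 : Lz p (dB F p) F = (nB F)%:C%C.
    by rewrite Lz_self// bF /nB F0 normR0 add0r.
  have {}h1 : forall g, Lz p (dB F p) (T g) = Lam a z b g.
    apply: h1 => // h; rewrite (le_trans (Lz_le _ _ _))// /nB.
    by rewrite (le_trans (wt_le_beta _ pd))// lerDr normR_ge0.
  have {}h2 : forall g, Lam a p (dB F p) (T g) = Lam a z b g.
    by apply: h2; rewrite /Lam e1 F0 lin0 ?add0r//; exact: phi_lin.
  have := h2 (Ti (cstB a)); rewrite -h1 /Lam TiK => /eqP.
  rewrite -subr_eq0 addrK cstBE ?(negbTE (phi_self_neq0 smoothE a0))//.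
  exact: disc0.
exists (F 0), p, (dB F p); split => //.
apply: pull; [exact: Lam_lin|by move=> h; exact: Lam_le|].
by rewrite /Lam phi_self// Lz_self// bF -rmorphD.
Qed.

End BlochFunctionals.

(** * Isometries preserve constants and functions vanishing at 0 *)

Section IsometrySplitting.
Context {R : realType} {E : normedModType R[i]}.
Hypothesis smoothE : smooth_space E.
Implicit Types (f g F G H : Bstar E) (z w p : CC R) (a b x y : E) (c : CC R).

Lemma normR_i : normR ('i%C : CC R) = 1.
Proof.
by apply: complexI; rewrite normRE normc_def /= expr0n expr1n add0r sqrtr1.
Qed.

Lemma Lz_phase z c b g : normR c = 1 -> b != 0 -> Lz z (c *: b) g = conjC c * Lz z b g.
Proof. by move=> c1 b0; rewrite /Lz phi_phase//; ring. Qed.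

Lemma scale_phase_neq0 c b : normR c = 1 -> b != 0 -> c *: b != 0.
Proof.
by move=> c1 b0; rewrite scaler_eq0 (negbTE b0) orbF -(normR_eq0 (c : CC R)) c1 oner_eq0.
Qed.

Lemma Lz_opp z b g : b != 0 -> Lz z (- b) g = - Lz z b g.
Proof.
move=> b0; rewrite -scaleN1r Lz_phase ?normRN ?normR1//.
have -> : conjC (-1 : CC R) = -1 by rewrite conjCN; congr (- _); exact: conjC1.
by rewrite mulN1r.
Qed.

Lemma Lz_i z b g : b != 0 -> Lz z (('i%C : CC R) *: b) g = - ('i%C * Lz z b g).
Proof.
move=> b0; rewrite Lz_phase ?normR_i// -mulNr; congr (_ * _).
by rewrite /conjC /=; apply/eqP; rewrite eq_complex /= oppr0 !eqxx.
Qed.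

(** The functionals [Lam a z b], [Lam a z (- b)] and [Lam a z (i b)] are linearly dependent,
    and evaluations of the derivative at distinct points are not. *)
Lemma same_point T Ti a z b : isometric_pair T Ti -> disc z -> a != 0 -> b != 0 ->
  exists w a1 b1 a2 b2, [/\ disc w, [/\ a1 != 0, b1 != 0, a2 != 0 & b2 != 0],
    forall g, Lam a1 w b1 (T g) = Lam a z b g &
    forall g, Lam a2 w b2 (T g) = Lam a z (- b) g].
Proof.
move=> iT zd a0 b0; have [[lT lTi TK TiK] [nT nTi]] := iT.
have b0N : - b != 0 by rewrite oppr_eq0.
have b0i : ('i%C : CC R) *: b != 0 by apply: scale_phase_neq0 => //; exact: normR_i.
have [a1 [z1 [b1 [z1d a10 b10 h1]]]] := isometry_Lam smoothE iT zd a0 b0.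
have [a2 [z2 [b2 [z2d a20 b20 h2]]]] := isometry_Lam smoothE iT zd a0 b0N.
have [a3 [z3 [b3 [z3d a30 b30 h3]]]] := isometry_Lam smoothE iT zd a0 b0i.
(* with [P = phi a (g 0)] and [Q = Lz z b g], write [P - i Q] in terms of [P + Q] and
   [P - Q] *)
have dep G : 2 * Lam a3 z3 b3 G = (1 - 'i%C) * Lam a1 z1 b1 G + (1 + 'i%C) * Lam a2 z2 b2 G.
  rewrite -(TiK G) h1 h2 h3 /Lam Lz_opp// Lz_i//; ring.
have LamE x v y G : x != 0 -> G 0 = 0 -> Lam x v y G = Lz v y G.
  by move=> x0 G0; rewrite /Lam G0 lin0 ?add0r//; exact: phi_lin.
have i1 : 1 - 'i%C != 0 :> CC R by rewrite eq_complex /= subr0 oner_eq0.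
have i2 : 1 + 'i%C != 0 :> CC R by rewrite eq_complex /= addr0 oner_eq0.
have [z12|z12] := eqVneq z1 z2.
  by exists z1, a1, b1, a2, b2; split => //; rewrite z12.
exfalso; have [z13|z13] := eqVneq z1 z3.
  have z21 : z2 != z1 by rewrite eq_sym.
  have z23 : z2 != z3 by rewrite -z13.
  have [G [G0 G2 G1 G3]] := separate b2 z2d z1d z3d z21 z23.
  have := dep G; rewrite !LamE// (Lz0 smoothE b10 G1) (Lz0 smoothE b30 G3) !mulr0 add0r => /esym/eqP.
  by rewrite mulf_eq0 (negbTE i2) (negbTE (Lz_neq0 smoothE z2d b20 G2)).
have [G [G0 G1 G2 G3]] := separate b1 z1d z2d z3d z12 z13.
have := dep G; rewrite !LamE// (Lz0 smoothE b20 G2) (Lz0 smoothE b30 G3) !mulr0 addr0 => /esym/eqP.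
by rewrite mulf_eq0 (negbTE i1) (negbTE (Lz_neq0 smoothE z1d b10 G1)).
Qed.

Lemma cstB_of_dB0 f : (forall z, disc z -> dB f z = 0) -> f = cstB (f 0).
Proof. by move=> f0; apply: Bstar_eq => z zd; rewrite cstBE// cst_of_dB0. Qed.

(** Constants form a copy of [E], where each nonzero vector has a unique support
    functional. But the function [y (moeb w)^2], normalized at 0, belongs to the subspace
    considered and its weight has two maximum points, interchanged by the sign
    of [moeb w]; they give two functionals, separated by a third function. *)
Lemma no_constants T Ti w y : isometric_pair T Ti -> disc w -> y != 0 ->
  (forall H, H 0 = 0 -> dB H w = 0 -> Ti H = cstB (Ti H 0)) -> False.
Proof.
move=> [[lT lTi TK TiK] [nT nTi]] wd y0 K.
have n1 : normR (1 : CC R) = 1 by exact: normR1.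
have z0 := @disc0 R.
pose H := compB 1 w (powB 2 y) - cstB ((w ^+ 2) *: y).
have H0 : H 0 = 0.
  rewrite /H BstarD BstarN compBE// cstBE// powBE; last exact: moebius_disc.
  by rewrite /moebius mul1r moeb0 sqrrN subrr.
have wtH v : disc v -> bloch_weight H v = (1 - normR (moeb w v) ^+ 2) * (2 * normR (moeb w v) * normR y).
  move=> vd; have sd : disc (moebius 1 w v) by exact: moebius_disc.
  have -> : bloch_weight H v = bloch_weight (compB 1 w (powB 2 y)) v.
    by rewrite !wtE /H dBB// dB_cstB// subr0.
  rewrite wt_compB// wtE dB_powB// /moebius mul1r expr1 -scalerA !normRZ mulrA.
  by congr (_ * (_ * _ * _)); exact: (normR_nat 2).
have Hw : dB H w = 0.
  by apply/eqP; rewrite -wt_eq0// wtH// moeb_aa normR0 mulr0 mul0r mulr0.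
have [z1 hz1] := exists_peak H; have [z1d _] := hz1.
have u1d := moeb_disc wd z1d.
(* the point where [moeb w] takes the opposite value *)
pose z2 := moeb (- w) (- moeb w z1).
have z2d : disc z2 by apply: moeb_disc; exact: discN.
have mz2 : moeb w z2 = - moeb w z1 by rewrite moebNK//; exact: discN.
have bH : 0 < beta H.
  have hd : disc (2^-1 : CC R) by rewrite discE normRV normR_nat invf_lt1// ltr1n.
  have vd : disc (moeb (- w) 2^-1) by apply: moeb_disc => //; exact: discN.
  apply: lt_le_trans (wt_le_beta H vd).
  rewrite wtH// moebNK// normRV normR_nat !mulr_gt0// ?normR_gt0//.
  by rewrite subr_gt0 expr_lt1 ?invr_ge0// invf_lt1// ltr1n.
have w1 : bloch_weight H z1 = beta H by apply: peak_beta.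
have w2 : bloch_weight H z2 = beta H by rewrite -w1 !wtH// mz2 normRN.
have u10 : moeb w z1 != 0.
  by apply: contraTneq bH => u0; rewrite -w1 wtH// u0 normR0 mulr0 mul0r mulr0 ltxx.
have z21 : z2 != z1.
  apply: contra_neq u10 => e; have := mz2; rewrite e => /eqP.
  by rewrite -addr_eq0 -mulr2n mulrn_eq0 => /eqP.
have z2w : z2 != w.
  apply: contra_neq u10 => e; have := mz2; rewrite e moeb_aa => /esym/eqP.
  by rewrite oppr_eq0 => /eqP.
have bz1 : dB H z1 != 0 by rewrite -wt_eq0// w1 gt_eqF.
have bz2 : dB H z2 != 0 by rewrite -wt_eq0// w2 gt_eqF.
pose x := Ti H 0; have TiH : Ti H = cstB x by exact: K.
have Tx : T (cstB x) = H by rewrite -TiH TiK.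
have xH : normR x = beta H.
  by rewrite -nB_cst -TiH nTi /nB H0 normR0 add0r.
have x0 : x != 0 by rewrite -normR_gt0 xH.
have supp v : disc v -> dB H v != 0 -> bloch_weight H v = beta H ->
    (fun e => Lz v (dB H v) (T (cstB e))) = phi x.
  move=> vd bv wv; apply: phi_uniq => //; split.
  - by move=> k e1 e2; rewrite cstB_linear lT Lz_lin.
  - move=> e; rewrite (le_trans (Lz_le smoothE _ vd bv))//.
    rewrite (le_trans (wt_le_beta _ vd))// -(nB_cst e) -nT /nB lerDr normR_ge0//.
  - by rewrite Tx Lz_self// wv xH.
have [G [G0 G2 G1 Gw]] := separate (dB H z2) z2d z1d wd z21 z2w.
have e1 := congr1 (fun u : E -> CC R => u (Ti G 0)) (supp z1 z1d bz1 w1).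
have e2 := congr1 (fun u : E -> CC R => u (Ti G 0)) (supp z2 z2d bz2 w2).
rewrite /= -(K G G0 Gw) TiK in e1 e2.
have := Lz_neq0 smoothE z2d bz2 G2.
by rewrite e2 -e1 Lz0 ?eqxx.
Qed.

(** Otherwise, with [a = T^-1 G 0], the functional [g |-> phi a (g 0)] is carried to a
    functional involving the derivative at a point [w]; all the [Lam a z b] are then
    carried to functionals at this same [w]. So a function [H] with [H 0 = 0] and zero
    derivative at [w] satisfies [Lam a z b (T^-1 H) = 0] for all [z] and [b], hence
    [T^-1 H] is a constant, contradicting [no_constants]. *)
Lemma vanishing_preserved T Ti G : isometric_pair T Ti -> G 0 = 0 -> Ti G 0 = 0.
Proof.
move=> iT G0; have [[lT lTi TK TiK] [nT nTi]] := iT.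
apply/eqP; apply: contraT => a0; pose a := Ti G 0; exfalso.
have LamE x v b (F : Bstar E) : x != 0 -> F 0 = 0 -> Lam x v b F = Lz v b F.
  by move=> x0 F0; rewrite /Lam F0 lin0 ?add0r//; exact: phi_lin.
have [w [a1 [b1 [a2 [b2 [wd [a10 b10 a20 b20] h1 h2]]]]]] := same_point iT disc0 a0 a0.
have sum z b w' x1 y1 x2 y2 : b != 0 ->
    (forall g, Lam x1 w' y1 (T g) = Lam a z b g) ->
    (forall g, Lam x2 w' y2 (T g) = Lam a z (- b) g) ->
    forall F : Bstar E, Lam x1 w' y1 F + Lam x2 w' y2 F = 2 * phi a (Ti F 0).
  move=> b0 e1 e2 F; rewrite -{1 2}(TiK F) e1 e2 /Lam Lz_opp//; ring.
have s1 := sum _ _ _ _ _ _ _ a0 h1 h2.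
(* the carried functional does involve the derivative at [w] *)
have xw : phi b1 (dB G w) + phi b2 (dB G w) != 0.
  have := s1 G; rewrite !LamE// -mulrDr => e1.
  have : 2 * phi a a != 0 by rewrite mulf_neq0 ?pnatr_eq0// phi_self_neq0.
  by rewrite -/a -e1 mulf_eq0 negb_or => /andP[].
apply: (no_constants iT wd a0) => H H0 Hw; apply: cstB_of_dB0 => z zd.
apply/eqP; apply: contraT => b0; set b := dB (Ti H) z in b0.
have [w' [x1 [y1 [x2 [y2 [wd' [x10 y10 x20 y20] e1 e2]]]]]] := same_point iT zd a0 b0.
have s2 := sum _ _ _ _ _ _ _ b0 e1 e2.
have ww' : w = w'.
  apply/eqP; apply: contraT => ww'.
  have [F [F0 Fw Fw' _]] := separate (dB G w) wd wd' wd' ww' ww'.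
  have := s1 F; rewrite -s2 !LamE// (Lz0 smoothE y10 Fw') (Lz0 smoothE y20 Fw') addr0.
  rewrite /Lz Fw -mulrDr => /eqP; rewrite mulf_eq0 (negbTE xw) orbF eq_complex /=.
  by rewrite gt_eqF -?disc_weight.
have Hw' : dB H w' = 0 by rewrite -ww'.
have := e1 (Ti H); have := e2 (Ti H); rewrite TiK (LamE x1)// (LamE x2)//.
rewrite (Lz0 smoothE y10 Hw') (Lz0 smoothE y20 Hw') /Lam Lz_opp// => f1 f2.
have : 2 * Lz z b (Ti H) = 0.
  rewrite [LHS](_ : _ = (phi a (Ti H 0) + Lz z b (Ti H)) - (phi a (Ti H 0) - Lz z b (Ti H))); last by ring.
  by rewrite -f1 -f2 subrr.
by move/eqP; rewrite mulf_eq0 pnatr_eq0 (negbTE (Lz_neq0 smoothE zd b0 (erefl _))).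
Qed.

(** Let [c] be the value of [T x] at 0. Then [x] is the value of [T^-1 c] at 0, so
    [|x| <= |c|], while [|x| = |c| + beta (T x)]. *)
Lemma constants_preserved T Ti x : isometric_pair T Ti -> T (cstB x) = cstB (T (cstB x) 0).
Proof.
move=> iT; have [[lT lTi TK TiK] [nT nTi]] := iT.
apply: cstB_of_dB0 => z zd; pose f := T (cstB x); pose c := f 0.
have e1 : Ti (f - cstB c) 0 = 0.
  apply: (vanishing_preserved iT).
  by rewrite BstarD BstarN cstBE ?subrr//; exact: disc0.
have xc : x = Ti (cstB c) 0.
  move: e1; rewrite (linB lTi) TK BstarD BstarN cstBE; last exact: disc0.
  by move/eqP; rewrite subr_eq0 => /eqP.
have h1 : normR x <= normR c.
  by rewrite -(nB_cst c) -nTi xc /nB lerDl beta_ge0.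
have h2 : normR c + beta f = normR x by rewrite -[LHS]/(nB f) nT nB_cst.
apply/eqP; rewrite -wt_eq0// eq_le wt_ge0// andbT.
by apply: le_trans (wt_le_beta _ zd) _; move: h1 h2; rewrite /f; lra.
Qed.

Lemma isometry_Lz T Ti z b : isometric_pair T Ti -> disc z -> b != 0 ->
  exists z' b', [/\ disc z', b' != 0 & forall g, Lz z' b' (T g) = Lz z b g].
Proof.
move=> iT zd b0; have [[lT lTi TK TiK] [nT nTi]] := iT.
have [a' [z' [b' [zd' a0' b0' h]]]] := isometry_Lam smoothE iT zd b0 b0.
exists z', b'; split => // g; pose g0 := g - cstB (g 0).
have g00 : g0 0 = 0 by rewrite BstarD BstarN cstBE ?subrr//; exact: disc0.
have Tg00 : T g0 0 = 0 by exact: (vanishing_preserved (isometric_pair_sym iT)).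
have := h g0; rewrite /Lam g00 Tg00 (lin0 (phi_lin smoothE a0')) (lin0 (phi_lin smoothE b0)) !add0r.
rewrite /Lz /g0 (linB lT) dBB// dBB// dB_cstB// subr0.
by rewrite (constants_preserved _ iT) dB_cstB// subr0.
Qed.

Lemma Lz_point_uniq z1 z2 b1 b2 : disc z1 -> disc z2 -> b1 != 0 -> b2 != 0 ->
  (forall g, Lz z1 b1 g = Lz z2 b2 g) -> z1 = z2.
Proof.
move=> z1d z2d b10 b20 h; apply/eqP; apply: contraT => z12.
have [G [_ G1 G2 _]] := separate b1 z1d z2d z2d z12 z12.
have := Lz_neq0 smoothE z1d b10 G1.
by rewrite h (Lz0 smoothE b20 G2) eqxx.
Qed.

End IsometrySplitting.

(** * The action of an isometry on the points of the disc *)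

Section PointMap.
Context {R : realType} {E : normedModType R[i]}.
Hypothesis smoothE : smooth_space E.
Implicit Types (f g F G H : Bstar E) (z w p r : CC R) (a b x y u v : E) (c : CC R).

(** By compactness: away from [p] the supremum of the weight is attained, or is
    at most half the maximum. *)
Lemma near_peak_point F p (e : R) : is_peak F p -> (forall q, is_peak F q -> q = p) ->
  0 < beta F -> 0 < e -> exists2 d : R, 0 < d &
  forall w, disc w -> beta F - d < bloch_weight F w -> normR (w - p) < e.
Proof.
move=> Fp Fu b0 e0.
have [r r1 hr] := Bstar_vanish F (divr_gt0 b0 (ltr0Sn _ 1)).
pose r' := Num.max r 0.
have r'1 : r' < 1 by rewrite gt_max r1 ltr01.
have b2 : 0 < beta F / 2 by rewrite divr_gt0.
have far w : disc w -> beta F - beta F / 2 < bloch_weight F w -> normR w <= r'.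
  rewrite discE => wd wF; rewrite leNgt; apply/negP => rw.
  have := hr w; rewrite wd andbT (le_lt_trans _ rw) ?le_max ?lexx// => /(_ isT).
  by move: wF; lra.
have [[x xr xp]|nx] := pselect (exists2 x, normR x <= r' & e <= normR (x - p)); last first.
  exists (beta F / 2) => // w wd /(far w wd) wr; rewrite ltNge; apply/negP => wp.
  by apply: nx; exists w.
have [||y [yr ky] hy] := @EVT_ball R 0 r' (fun w => normR (w - p) - e) (bloch_weight F).
- move=> w; rewrite subr0 => wr; split; first by apply: ctsR_subr; exact: ctsR_dist.
  by apply: wt_cts; rewrite discE (le_lt_trans wr).
- by exists x; rewrite ?subr0// subr_ge0.
rewrite subr0 in yr.
have yd : disc y by rewrite discE (le_lt_trans yr).
have yF : bloch_weight F y < beta F.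
  rewrite lt_def wt_le_beta// andbT eq_sym; apply/negP => /eqP /(beta_peak yd) /Fu yp.
  by move: ky; rewrite yp subrr normR0 sub0r oppr_ge0 leNgt e0.
exists (Num.min (beta F / 2) (beta F - bloch_weight F y)); first by rewrite lt_min b2 subr_gt0.
move=> w wd wF; rewrite ltNge; apply/negP => wp.
have wr : normR w <= r'.
  apply: far => //; apply: le_lt_trans wF; rewrite lerD2l lerN2 ge_min lexx//.
have := hy w; rewrite subr0 subr_ge0 => /(_ wr wp).
have : bloch_weight F y < bloch_weight F w.
  by apply: le_lt_trans wF; rewrite lerBrDr -lerBrDl ge_min lexx orbT.
by rewrite ltNge => /negP.
Qed.

(** Take [r] minimizing the norm of [u - r v]. Were the minimum attained with
    [x0 = u - r v <> 0], then moving [r] slightly towards [kappa x0] would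
    decrease [|phi b (u - r v)| = |kappa b - r| |phi b v|] for all [b] near [x0], and with it
    the norm, reached at [b = u - r v]. *)
Lemma proportional_of_ratio u v (kappa : E -> CC R) :
  (forall b, b != 0 -> phi b u = kappa b * phi b v) ->
  (forall b, b != 0 -> forall e : R, 0 < e -> exists2 d : R, 0 < d &
     forall x, x != 0 -> normR (x - b) < d -> normR (kappa x - kappa b) < e) ->
  exists c, u = c *: v.
Proof.
move=> huv kc; have [v0|v0] := eqVneq v 0.
  exists 0; rewrite scale0r; apply/eqP; apply: contraT => u0.
  have := phi_self_neq0 smoothE u0; rewrite huv// v0 (lin0 (phi_lin smoothE u0)).
  by rewrite mulr0 eqxx.
have V0 : 0 < normR v by rewrite normR_gt0.
pose n (r : CC R) := normR (u - r *: v).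
have nl r r' : `|n r - n r'| <= normR (r - r') * normR v.
  rewrite -normRZ (le_trans (normR_dist _ _))//.
  by rewrite (_ : _ - _ = - ((r - r') *: v)) ?normRN//; lmod_eq R[i].
(* beyond this radius [|u - r v|] exceeds its value at 0 *)
pose rho := 2 * normR u / normR v.
have rho0 : 0 <= rho by rewrite divr_ge0 ?mulr_ge0 ?normR_ge0.
have [||r0 [_ _] hr0] := @EVT_ball R 0 rho (fun=> 0) (fun r => - n r).
- move=> r _; split; first exact: ctsR_cst.
  apply: ctsR_opp => e e0; exists (e / normR v); first by rewrite divr_gt0.
  by move=> w wr; rewrite (le_lt_trans (nl _ _))// -ltr_pdivlMr.
- by exists 0; rewrite ?subr0 ?normR0.
have n0 : n 0 = normR u by rewrite /n scale0r subr0.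
have rmin r : n r0 <= n r.
  have hle : forall r, normR r <= rho -> n r0 <= n r.
    by move=> r' hr'; rewrite -lerN2; apply: hr0; rewrite ?subr0.
  have [/hle//|rr] := leP (normR r) rho.
  apply: (le_trans (hle 0 _)); first by rewrite normR0.
  rewrite n0 /n normR_distC; have := normR_sub (r *: v) u; rewrite normRZ.
  by move: rr; rewrite /rho ltr_pdivrMr//; lra.
exists r0; apply/eqP; rewrite -subr_eq0; apply: contraT => x00.
set x0 := u - r0 *: v in x00.
have xE r b : b != 0 -> phi b (u - r *: v) = (kappa b - r) * phi b v.
  move=> b0; have lp := phi_lin smoothE b0.
  by rewrite (linB lp) (linZ lp) huv// mulrBl.
pose D := kappa x0 - r0.
have D0 : D != 0.
  apply: contraTneq (phi_self_neq0 smoothE x00) => e.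
  by rewrite {2}/x0 xE// -/D e mul0r eqxx.
have DR : 0 < normR D by rewrite normR_gt0.
have [d d0 hd] := kc x0 x00 _ (divr_gt0 DR (ltr0Sn _ 3)).
(* [x] below is within [d] of [x0] *)
pose s := Num.min 1 (d / (2 * normR D * normR v)).
have s0 : 0 < s by rewrite lt_min ltr01 divr_gt0 ?mulr_gt0.
have s1 : s <= 1 by rewrite ge_min lexx.
have sd : s * normR D * normR v < d.
  have : s <= d / (2 * normR D * normR v) by rewrite ge_min lexx orbT.
  rewrite ler_pdivlMr ?mulr_gt0// => h.
  have := mulr_gt0 (mulr_gt0 s0 DR) V0.
  by move: h; rewrite (_ : s * (2 * normR D * normR v) = 2 * (s * normR D * normR v)); [lra|ring].
pose r := r0 + s%:C%C * D.
pose x := u - r *: v.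
have x_0 : x != 0.
  by rewrite -normR_gt0 (lt_le_trans _ (rmin r))// normR_gt0.
have xx0 : normR (x - x0) < d.
  rewrite (_ : x - x0 = - ((s%:C%C * D : CC R) *: v)); last by rewrite /x /x0 /r; lmod_eq R[i].
  by rewrite normRN normRZ normRM normR_real gtr0_norm.
have kx := hd x x_0 xx0; set e := kappa x - kappa x0 in kx.
have f1 : normR (kappa x - r0) * normR (phi x v) <= normR x0.
  by rewrite -normRM -xE// phi_le.
have f2 : normR x0 <= normR (kappa x - r) * normR (phi x v).
  apply: le_trans (rmin r) _; rewrite -normRM -xE// -/x phi_self//.
  by rewrite normR_real ger0_norm ?normR_ge0.
have pv : 0 < normR (phi x v).
  rewrite normR_gt0; apply: contraTneq (phi_self_neq0 smoothE x_0) => pv0.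
  by rewrite {2}/x xE// pv0 mulr0 eqxx.
have := le_trans f1 f2; rewrite ler_pM2r//.
have -> : kappa x - r0 = D + e by rewrite /D /e; ring.
have -> : kappa x - r = ((1 - s)%:C)%C * (D + e) + s%:C%C * e.
  by rewrite /r /D /e rmorphB rmorph1 /=; ring.
move=> h; have := le_trans h (normRD _ _).
rewrite !normRM !normR_real (gtr0_norm s0) ger0_norm ?subr_ge0// => h1.
have h2 : s * normR (D + e) <= s * normR e by move: h1; lra.
rewrite ler_pM2l// in h2.
have := normR_sub D (- e); rewrite opprK normRN.
by move: h2 kx DR; lra.
Qed.

(** The point at which the image of [Lz z b] lives. *)
Definition image_point (T : Bstar E -> Bstar E) z b : CC R :=
  xget 0 [set z' | disc z' /\ exists b', b' != 0 /\ forall g, Lz z' b' (T g) = Lz z b g].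

Section OneIsometry.
Variables T Ti : Bstar E -> Bstar E.
Hypothesis iT : isometric_pair T Ti.

Lemma image_pointP z b : disc z -> b != 0 -> disc (image_point T z b) /\
  exists b', b' != 0 /\ forall g, Lz (image_point T z b) b' (T g) = Lz z b g.
Proof.
move=> zd b0.
apply: (xgetPex 0 (P := [set z' | disc z' /\ exists b', b' != 0 /\
   forall g, Lz z' b' (T g) = Lz z b g])).
by have [z' [b' [zd' b0' h]]] := isometry_Lz smoothE iT zd b0; exists z'; split=> //; exists b'.
Qed.

Lemma image_point_uniq z b z' b' : disc z -> b != 0 -> disc z' -> b' != 0 ->
  (forall g, Lz z' b' (T g) = Lz z b g) -> image_point T z b = z'.
Proof.
move=> zd b0 zd' b0' h; have [kd [c [c0 hc]]] := image_pointP zd b0.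
have [[_ _ _ TiK] _] := iT.
by apply: (Lz_point_uniq smoothE kd zd' c0 b0') => g; rewrite -(TiK g) hc h.
Qed.

Lemma beta_T_mu z b : disc z -> b != 0 -> beta (T (mu z b)) = normR b.
Proof.
move=> zd b0; have [[lT lTi TK TiK] [nT nTi]] := iT.
have F0 : T (mu z b) 0 = 0.
  apply: (vanishing_preserved smoothE (isometric_pair_sym iT)); exact: mu0.
by have := nT (mu z b); rewrite nB_mu// /nB F0 normR0 add0r.
Qed.

(** At any peak [p] of [T (mu z b)] there is a functional supporting that function, whose
    inverse image supports [mu z b], so it is [Lz z b]. *)
Lemma peak_T_mu z b p : disc z -> b != 0 -> is_peak (T (mu z b)) p -> p = image_point T z b.
Proof.
move=> zd b0 Fp; have [[lT lTi TK TiK] [nT nTi]] := iT.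
set F := T (mu z b) in Fp; have [pd _] := Fp.
have wF : bloch_weight F p = normR b by rewrite peak_beta// beta_T_mu.
have F0 : dB F p != 0 by rewrite -wt_eq0// wF normR_eq0.
have [q [c [qd c0 h]]] := isometry_Lz smoothE (isometric_pair_sym iT) pd F0.
have hF := h F; rewrite TK Lz_self// wF in hF.
have qz : q = z.
  apply: (peak_mu_uniq zd b0 qd); apply: le_trans (Lz_le smoothE _ qd c0).
  by rewrite hF normR_real ler_norm.
have cb : phi c = phi b.
  apply: phi_uniq => //; split; [exact: phi_lin|by move=> x; exact: phi_le|].
  by rewrite -hF qz Lz_mu.
apply/esym; apply: (image_point_uniq zd b0 pd F0) => g.
by rewrite -h TK qz /Lz cb.
Qed.

(** For [x] near [b], the functional at [image_point T z x] almost reaches the norm of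
    [T (mu z b)], so this point is near the peak, which is [image_point T z b]. *)
Lemma image_point_cts z b (e : R) : disc z -> b != 0 -> 0 < e -> exists2 d : R, 0 < d &
  forall x, x != 0 -> normR (x - b) < d -> normR (image_point T z x - image_point T z b) < e.
Proof.
move=> zd b0 e0; have [p pp] := exists_peak (T (mu z b)).
have pk := peak_T_mu zd b0 pp; rewrite -pk.
have B0 : 0 < beta (T (mu z b)) by rewrite beta_T_mu// normR_gt0.
have [|d d0 hd] := near_peak_point pp _ B0 e0.
  by move=> q /(peak_T_mu zd b0) ->.
exists (d / 2); first by rewrite divr_gt0.
move=> x x0 xb; have [kd [c [c0 hc]]] := image_pointP zd x0.
apply: hd => //; rewrite beta_T_mu//.
apply: lt_le_trans (Lz_le smoothE _ kd c0).
rewrite hc Lz_mu// (_ : b = x - (x - b)); last by lmod_eq R[i].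
rewrite (linB (phi_lin smoothE x0)) phi_self//.
have := normR_sub (normR x)%:C%C (phi x (x - b)).
rewrite normR_real ger0_norm ?normR_ge0// => h1.
have := phi_le smoothE (x - b) x0.
rewrite (_ : x - (x - b) = b); last by lmod_eq R[i].
have := normR_sub b x; rewrite normR_distC.
by move: h1 xb; lra.
Qed.

(** The functions [y w] and [y w^2 / 2] have derivatives [y] and [w y]: the ratio of
    the values at them of the functional carried from [Lz z b] is the point where it lives. *)
Lemma image_point_cst z b1 b2 : disc z -> b1 != 0 -> b2 != 0 -> image_point T z b1 = image_point T z b2.
Proof.
move=> zd b10 b20; have [[lT lTi TK TiK] [nT nTi]] := iT.
have [k1d [c1 [c10 h1]]] := image_pointP zd b10.
have [k2d [c2 [c20 h2]]] := image_pointP zd b20.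
(* a vector outside the kernels of both functionals *)
have [y [y1 y2]] : exists y, phi c1 y != 0 /\ phi c2 y != 0.
  have [e2|e2] := eqVneq (phi c2 c1) 0; last by exists c1; rewrite phi_self_neq0.
  have [e1|e1] := eqVneq (phi c1 c2) 0; last by exists c2; rewrite phi_self_neq0.
  exists (c1 + c2); rewrite (linD (phi_lin smoothE c10)) (linD (phi_lin smoothE c20)).
  by rewrite e1 e2 addr0 add0r !phi_self_neq0.
pose u := dB (Ti ((2^-1 : CC R) *: powB 2 y)) z; pose v := dB (Ti (powB 1 y)) z.
have w0 : ((1 - normR z ^+ 2)%:C)%C != 0 :> CC R.
  by rewrite eq_complex /= gt_eqF// -disc_weight.
have dv k : disc k -> dB (powB 1 y) k = y.
  by move=> kd; rewrite dB_powB// mulr1 scale1r.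
have two0 : (2 : R[i]) != 0 by rewrite pnatr_eq0.
have du k : disc k -> dB ((2^-1 : CC R) *: powB 2 y) k = k *: y.
  move=> kd; rewrite dBZ// dB_powB// expr1 scalerA mulrA mulVf ?mul1r//.
have [||rho hrho] := @proportional_of_ratio u v (image_point T z).
- move=> b b0; have [kd [c [c0 hc]]] := image_pointP zd b0; apply: (mulfI w0).
  rewrite -[LHS]/(Lz z b (Ti (2^-1 *: powB 2 y))) mulrCA -[X in _ * X]/(Lz z b (Ti (powB 1 y))).
  rewrite -!hc !TiK /Lz du// dv// (linZ (phi_lin smoothE c0)) -[_ *: _]/(_ * _).
  by ring.
- by move=> b b0 e e0; exact: image_point_cts.
have kr b : b != 0 -> phi b v != 0 -> image_point T z b = rho.
  move=> b0 pv; have [kd [c [c0 hc]]] := image_pointP zd b0; apply: (mulIf pv).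
  apply: (mulfI w0); rewrite mulrCA -[X in _ * X]/(Lz z b (Ti (powB 1 y))).
  rewrite -[rho * _]/(rho *: _) -(linZ (phi_lin smoothE b0)) -hrho.
  rewrite -[RHS]/(Lz z b (Ti (2^-1 *: powB 2 y))).
  rewrite -!hc !TiK /Lz du// dv// (linZ (phi_lin smoothE c0)) -[_ *: _]/(_ * _).
  by ring.
have pvn b (c : E) : b != 0 -> c != 0 -> disc (image_point T z b) ->
    (forall g, Lz (image_point T z b) c (T g) = Lz z b g) -> phi c y != 0 -> phi b v != 0.
  move=> b0 c0 kd hc; apply: contra_neq => pv.
  have := hc (Ti (powB 1 y)); rewrite TiK /Lz dv// -/v pv mulr0 => /eqP.
  rewrite mulf_eq0 => /orP[|/eqP//].
  by rewrite eq_complex /= gt_eqF// -disc_weight.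
by rewrite !kr//; [exact: pvn h2 y2|exact: pvn h1 y1].
Qed.

End OneIsometry.

End PointMap.

(** * The derivative of the image of a function *)

Section IsometryStructure.
Context {R : realType} {E : normedModType R[i]}.
Hypothesis smoothE : smooth_space E.
Hypothesis convexE : strictly_convex_space E.
Implicit Types (f g G H : Bstar E) (z w p r : CC R) (b x y u v : E) (c : CC R).

Lemma derR_linear (W : normedModType R[i]) (A : E -> W) (k : R) (F : CC R -> E) z D :
  0 <= k -> linear A -> (forall x, normR (A x) <= k * normR x) ->
  derR F z D -> derR (A \o F) z (A D).
Proof.
move=> k0 lA bA FD e e0; have k1 : 0 < k + 1 by rewrite ltr_wpDl.
have [d d0 hd] := FD _ (divr_gt0 e0 k1); exists d => // h /hd hh.
rewrite (_ : _ - _ = A (F (z + h) - F z - h *: D)); last first.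
  by rewrite !(linB lA) (linZ lA).
rewrite (le_trans (bA _))// (@le_trans _ _ ((k + 1) * (e / (k + 1) * normR h)))//.
  by rewrite ler_pM ?normR_ge0// lerDl.
by rewrite mulrA mulrCA divff ?mulr1// gt_eqF.
Qed.

(** If [phi] supports [F w], then [phi (F v)] has modulus at most [M = phi (F w)], so it
    is constant near [w]; by strict convexity [F] itself is constant there. *)
Lemma constant_norm (F : CC R -> E) (M : R) : (forall z, disc z -> analytic_at F z) ->
  (forall z, disc z -> normR (F z) = M) -> forall z, disc z -> F z = F 0.
Proof.
move=> aF nF; have [M0|M0] := eqVneq M 0.
  move=> z zd; have F0 w : disc w -> F w = 0.
    by move=> wd; apply/eqP; rewrite -normR_eq0 nF// M0.
  by rewrite !F0//; exact: disc0.
have Mp : 0 < M by rewrite lt_def M0/= -(nF 0 disc0) normR_ge0.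
apply: zero_derivative_cst => w wd.
have Fw0 : F w != 0 by rewrite -normR_gt0 nF.
have lp := phi_lin smoothE Fw0.
have [d d0 hd] := disc_open wd.
have qp : quot_at (phi (F w) \o F) w.
  apply: analytic_quot; apply: (@analytic_linear _ _ _ _ 1) => //; last exact: aF.
  by move=> x; rewrite mul1r phi_le.
have pw : phi (F w) (F w) = M%:C%C by rewrite phi_self// nF.
have [|[e e0 he]|h] := quot_extremum qp.
- exact: phi_self_neq0.
- have Fcst (v : CC R) : normR (v - w) < Num.min d e -> F v = F w.
    rewrite lt_min => /andP[/hd vd /he /= Fv]; apply: contrapT => nvw.
    pose t : R[i] := (M^-1)%:C%C.
    have t0 : t != 0 by rewrite eq_complex /= invr_eq0 (negbTE M0).
    have tn : normR (t : CC R) = M^-1 by rewrite normR_real gtr0_norm ?invr_gt0.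
    have n1 (x : CC R) : disc x -> `|t *: F x| = 1.
      by move=> xd; rewrite -normRE (normRZ (t : CC R)) tn nF// mulVf.
    have := convexE (n1 v vd) (n1 w wd).
    have tne : t *: F v <> t *: F w by move=> /(scalerI t0).
    move=> /(_ tne); rewrite -normRE -scalerDr (normRZ (t : CC R)) tn.
    rewrite (_ : 2 = (2%:R : R)%:C%C) ?ltcR; last by rewrite rmorph_nat.
    rewrite ltr_pdivrMl// => h2.
    have := phi_le smoothE (F v + F w) Fw0; rewrite (linD lp) Fv pw -rmorphD normR_real.
    by move=> /(le_trans (ler_norm _)); move: h2; lra.
  move=> eps eps0; exists (Num.min d e); first by rewrite lt_min d0.
  move=> k kd; rewrite Fcst ?subrr ?scaler0 ?subr0 ?normR0 ?mulr_ge0 ?normR_ge0 ?(ltW eps0)//.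
  by rewrite addrAC subrr add0r.
- have [[v /hd vd hv] _] := h d d0; exfalso; move: hv.
  rewrite /= pw normR_real gtr0_norm// ltNge => /negP; apply.
  by rewrite -(nF v vd) phi_le.
Qed.

Section PointMapSigma.
Variables (T Ti : Bstar E -> Bstar E) (e0 : E).
Hypothesis iT : isometric_pair T Ti.
Hypothesis e00 : e0 != 0.

Lemma image_point_Lz z b : disc z -> b != 0 ->
  exists c : E, c != 0 /\ forall g, Lz (image_point T z e0) c (T g) = Lz z b g.
Proof.
move=> zd b0; have [_ [c [c0 hc]]] := image_pointP smoothE iT zd b0.
by exists c; split=> // g; rewrite (image_point_cst smoothE iT zd e00 b0).
Qed.

Lemma wt_le_image_point z f : disc z -> bloch_weight f z <= bloch_weight (T f) (image_point T z e0).
Proof.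
move=> zd; have [kd _] := image_pointP smoothE iT zd e00.
have [f0|f0] := eqVneq (dB f z) 0.
  by rewrite wtE f0 normR0 mulr0 wt_ge0.
have [c [c0 hc]] := image_point_Lz zd f0; have := hc f; rewrite Lz_self// => h.
have := Lz_le smoothE (T f) kd c0; rewrite h normR_real => /(le_trans (ler_norm _)).
exact.
Qed.

End PointMapSigma.

Lemma image_pointK (T Ti : Bstar E -> Bstar E) (e0 : E) z : isometric_pair T Ti -> e0 != 0 -> disc z ->
  image_point T (image_point Ti z e0) e0 = z.
Proof.
move=> iT e00 zd; have iTi := isometric_pair_sym iT.
have [kd [c [c0 hc]]] := image_pointP smoothE iTi zd e00.
have [c' [c'0 hc']] := image_point_Lz iT e00 kd c0.
have [k'd _] := image_pointP smoothE iT kd e00.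
apply: (Lz_point_uniq smoothE k'd zd c'0 e00) => G.
by have [[_ _ _ TiK] _] := iT; rewrite -{1}(TiK G) hc' hc.
Qed.

(** Both inequalities come from [wt_le_image_point], applied to the isometry and to its
    inverse. *)
Lemma isometry_weight (T Ti : Bstar E -> Bstar E) (e0 : E) : isometric_pair T Ti -> e0 != 0 ->
  exists2 sigma : CC R -> CC R, set_bij disc disc sigma &
    forall f z, disc z -> bloch_weight (T f) z = bloch_weight f (sigma z).
Proof.
move=> iT e00; have iTi := isometric_pair_sym iT.
have kd z : disc z -> disc (image_point Ti z e0).
  by move=> zd; have [] := image_pointP smoothE iTi zd e00.
have kd' z : disc z -> disc (image_point T z e0).
  by move=> zd; have [] := image_pointP smoothE iT zd e00.
exists (fun z => image_point Ti z e0).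
  split; first exact: kd.
  - move=> z w; rewrite !inE => zd wd h.
    by rewrite -(image_pointK iT e00 zd) h image_pointK.
  - move=> w wd; exists (image_point T w e0); first exact: kd'.
    exact: image_pointK.
move=> f z zd; apply/eqP; rewrite eq_le.
have [[_ _ TK _] _] := iT.
have := wt_le_image_point iTi e00 (T f) zd; rewrite TK => -> /=.
have := wt_le_image_point iT e00 f (kd z zd).
by rewrite (image_pointK iT e00 zd).
Qed.

(** Since the weight is transported, [(T f)'(z)] depends only on [f'(sigma z)], through a
    linear map [A z] whose norm ratio is [|sigma'(z)|]; and [sigma] is the ratio of the
    images of [y w^2 / 2] and [y w]. *)
Lemma isometry_form (T Ti : Bstar E -> Bstar E) (e0 : E) : isometric_pair T Ti -> e0 != 0 ->
  exists (lam a : CC R) (V : E -> E), [/\ normR lam = 1, disc a,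
    [/\ linear V, forall x, normR (V x) = normR x & forall x, exists y, V y = x] &
    forall f z, disc z -> dB (T f) z = (lam * moeb_deriv a z) *: V (dB f (moebius lam a z))].
Proof.
move=> iT e00; have [[lT lTi TK TiK] [nT nTi]] := iT.
have [sigma sbij wT] := isometry_weight iT e00.
have sd z : disc z -> disc (sigma z) by move=> zd; exact: bij_disc sbij _ zd.
have local f g z : disc z -> dB f (sigma z) = dB g (sigma z) -> dB (T f) z = dB (T g) z.
  move=> zd fg; apply/eqP; rewrite -subr_eq0 -dBB// -(linB lT) -wt_eq0// wT//.
  have szd := sd z zd; by rewrite wt_eq0// dBB// fg subrr.
pose A z y := dB (T (powB 1 y)) z.
have dp1 y z : disc z -> dB (powB 1 y) z = y.
  by move=> zd; rewrite dB_powB// mulr1 scale1r.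
have TA f z : disc z -> dB (T f) z = A z (dB f (sigma z)).
  by move=> zd; apply: local => //; rewrite dp1//; exact: sd.
have lA z : disc z -> linear (A z).
  by move=> zd k x y; rewrite /A powB_linear lT dBP.
have nA z y : disc z -> (1 - normR z ^+ 2) * normR (A z y) = (1 - normR (sigma z) ^+ 2) * normR y.
  by move=> zd; rewrite -wtE wT// wtE dp1//; exact: sd.
have sq z : disc z -> quot_at sigma z.
  move=> zd; pose q := A z e0.
  have q0 : q != 0.
    have h : 0 < (1 - normR z ^+ 2) * normR q.
      rewrite nA// mulr_gt0 ?normR_gt0//; have := sd z zd; by rewrite disc_weight.
    by rewrite -normR_gt0 -(pmulr_rgt0 _ (_ : 0 < 1 - normR z ^+ 2)) -?disc_weight.
  have lp := phi_lin smoothE q0.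
  have an f : analytic_at (phi q \o dB (T f)) z.
    apply: (@analytic_linear _ _ _ _ 1) => //; last exact: dB_analytic.
    by move=> x; rewrite mul1r phi_le.
  exists (phi q \o dB (T ((2^-1 : CC R) *: powB 2 e0))), (phi q \o dB (T (powB 1 e0))).
  split; [exact: an|exact: an|exact: phi_self_neq0|].
  have [d d0 hd] := disc_open zd; exists d => // w /hd wd /=.
  have two0 : (2 : R[i]) != 0 by rewrite pnatr_eq0.
  have swd := sd w wd; rewrite (TA (2^-1 *: powB 2 e0) w wd) dBZ// dB_powB// expr1 scalerA mulrA mulVf// mul1r.
  by rewrite (linZ (lA w wd)) (linZ lp).
have [lam [a [lam1 ad sE]]] := quot_bij_moeb sq sbij.
have {}sE z : disc z -> sigma z = moebius lam a z by exact: sE.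
(* [sigma' z = k / (1 - conj a * z)^2] *)
pose k : CC R := lam * (1 - a * conjC a).
have aa : 1 - a * conjC a = ((1 - normR a ^+ 2)%:C)%C :> CC R.
  by rewrite rmorphB rmorph1 /= normR_sqrC.
have ap : 0 < 1 - normR a ^+ 2 by rewrite -disc_weight.
have nk : normR k = 1 - normR a ^+ 2.
  by rewrite normRM lam1 mul1r aa normR_real gtr0_norm.
have k0 : k != 0 by rewrite -normR_gt0 nk.
have z0 := @disc0 R.
(* [(1 - conj a * z)^2 * A z y] has constant norm *)
have Acst z y : disc z -> (1 - conjC a * z) ^+ 2 *: A z y = A 0 y.
  move=> zd; pose F (w : CC R) : E := (1 - conjC a * w) *: ((1 - conjC a * w) *: A w y).
  have FE w : F w = (1 - conjC a * w) ^+ 2 *: A w y by rewrite /F scalerA -expr2.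
  have aF w : disc w -> analytic_at F w.
    move=> wd; have aff (G' : CC R -> E) : analytic_at G' w ->
        analytic_at (fun v : CC R => (1 - conjC a * v) *: G' v) w.
      move=> /(analytic_mul_affine 1 (- conjC a)); apply: (analytic_eq_near ltr01) => v _.
      by rewrite mulNr.
    by apply/aff/aff/dB_analytic.
  have nF w : disc w -> normR (F w) = (1 - normR a ^+ 2) * normR y.
    move=> wd; have wp : 0 < 1 - normR w ^+ 2 by rewrite -disc_weight.
    have d0 := moeb_den ad wd.
    have dp : 0 < normR (1 - conjC a * w) by rewrite normR_gt0.
    rewrite FE (normRZ ((1 - conjC a * w) ^+ 2)) normRX.
    apply: (mulfI (_ : 1 - normR w ^+ 2 != 0)); first by rewrite gt_eqF.
    rewrite mulrCA nA// sE// -moebius_weight// normRM lam1 mul1r.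
    rewrite /moeb_deriv normRM normRV normRX aa normR_real gtr0_norm//.
    by field; rewrite gt_eqF.
  have := constant_norm aF nF zd; rewrite !FE => ->.
  by rewrite mulr0 subr0 expr1n scale1r.
exists lam, a, (fun y => k^-1 *: A 0 y); split => //.
  split.
  - by move=> c x y; rewrite (lA 0 z0); lmod_eq R[i].
  - move=> x; rewrite (normRZ (k^-1)) normRV nk.
    have := nA 0 x z0; rewrite normR0 expr0n subr0 mul1r => ->.
    rewrite sE// /moebius normRM lam1 mul1r moeb0 normRN mulrA mulVf ?mul1r// gt_eqF//.
  - move=> x; exists (dB (Ti (powB 1 (k *: x))) (sigma 0)).
    by rewrite -TA// TiK dp1// scalerA mulVf// scale1r.
move=> f z zd; rewrite TA// sE// -(Acst z _ zd) !scalerA.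
rewrite -[LHS]scale1r; congr (_ *: _).
rewrite /k /moeb_deriv; have := moeb_den ad zd.
have : lam != 0 by rewrite -normR_gt0 lam1.
have : 1 - a * conjC a != 0 by rewrite aa eq_complex /= gt_eqF.
by move=> h1 h2 h3; field; rewrite ?h1 ?h2 ?h3.
Qed.

End IsometryStructure.

(** * Weighted compositions are isometries *)

Section Converse.
Context {R : realType} {E : normedModType R[i]}.
Implicit Types (f g : Bstar E) (z w a lam : CC R) (x y : E).

Definition isometryE (U : E -> E) :=
  [/\ linear U, forall y, exists x, U x = y & forall x, normR (U x) = normR x].

Lemma isometryEP U : isometryE U <-> surjective_linear_isometry (fun x : E => `|x|) U.
Proof.
split=> -[lU sU nU]; split => // x; first by rewrite -!normRE nU.
by rewrite /normR nU.
Qed.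

Lemma isometryE_le U x : isometryE U -> normR (U x) <= 1 * normR x.
Proof. by move=> [_ _ nU]; rewrite nU mul1r. Qed.

Lemma isometryE_inv U : isometryE U -> exists2 W, isometryE W & forall x, U (W x) = x.
Proof.
move=> [lU sU nU]; pose W y := projT1 (cid (sU y)).
have UW y : U (W y) = y by exact: (projT2 (cid (sU y))).
have inj x y : U x = U y -> x = y.
  move=> e; apply/eqP; rewrite -subr_eq0 -normR_eq0 -nU (linB lU) e subrr.
  by rewrite normR0.
exists W => //; split.
- by move=> k x y; apply: inj; rewrite lU !UW.
- by move=> y; exists (U y); apply: inj; rewrite UW.
- by move=> x; rewrite -nU UW.
Qed.

Lemma moebius_inv lam a z : normR lam = 1 -> disc a -> disc z ->
  moebius lam a (moebius (conjC lam) (- (lam * a)) z) = z /\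
  moebius (conjC lam) (- (lam * a)) (moebius lam a z) = z.
Proof.
move=> l1 ad zd.
have ll : lam * conjC lam = 1 by rewrite -normR_sqrC l1 expr1n.
have inv w : moebius (conjC lam) (- (lam * a)) w = moeb (- a) (conjC lam * w).
  rewrite /moebius /moeb !conjCN conjCM !opprK mulrA; congr (_ / _).
    by rewrite mulrDr mulrA [conjC lam * lam]mulrC ll mul1r.
  by rewrite !mulNr !opprK mulrA [conjC a * conjC lam]mulrC.
have lzd : disc (conjC lam * z) by rewrite discE normRM normRJ l1 mul1r -discE.
split; rewrite inv.
  by rewrite /moebius moebNK// mulrA ll mul1r.
by rewrite /moebius mulrA [conjC lam * lam]mulrC ll mul1r moebK.
Qed.

Lemma disc_neg_mul lam a : normR lam = 1 -> disc a -> disc (- (lam * a)).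
Proof. by move=> l1; rewrite !discE normRN normRM l1 mul1r. Qed.

Lemma automorphism_moebius s : disc_automorphism s ->
  exists lam a, [/\ normR lam = 1, disc a & forall z, disc z -> s z = moebius lam a z].
Proof.
move=> [as' sbij]; apply: quot_bij_moeb => // z /as'; exact: analytic_quot.
Qed.

Definition mapB (W : E -> E) f : Bstar E := toB (W \o f).

Lemma mapB_blochfun W f : isometryE W -> blochfun (W \o f).
Proof.
move=> sW; have [lW _ nW] := sW; split=> [z zd|e e0].
  apply: (@analytic_linear _ _ _ _ 1) => //; last exact: Bstar_analytic.
  by move=> x; exact: isometryE_le.
have [r r1 hr] := Bstar_vanish f e0; exists r => // z rz.
have zd : disc z by rewrite discE; case/andP: rz.
have dW : derR (W \o f) z (W (dB f z)).
  apply: (@derR_linear _ _ _ _ 1) => //; last exact: dB_derR.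
  by move=> x; exact: isometryE_le.
by rewrite /bloch_weight (derR_derive1 dW) nW; exact: hr.
Qed.

Lemma weighted_composition_isometry (T : Bstar E -> Bstar E) (U V : E -> E) s :
  isometryE U -> isometryE V -> disc_automorphism s ->
  (forall f z, disc z -> T f z = U (f 0) + V (f (s z) - f (s 0))) ->
  surjective_linear_isometry bloch_norm T.
Proof.
move=> sU sV /automorphism_moebius[lam [a [l1 ad sE]]] TE.
have [lU _ nU] := sU; have [lV _ nV] := sV; have z0 := @disc0 R.
have {}TE f z : disc z -> T f z = U (f 0) + V (f (moebius lam a z) - f (moebius lam a 0)).
  by move=> zd; rewrite TE// !sE.
have l1' : normR (conjC lam) = 1 by rewrite normRJ.
have ad' := disc_neg_mul l1 ad.
have dT f z : disc z -> dB (T f) z = (lam * moeb_deriv a z) *: V (dB f (moebius lam a z)).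
  move=> zd; have [d d0 hd] := disc_open zd.
  apply: derR_derive1 => e e0.
  have dV : derR (V \o (f \o moebius lam a)) z (V ((lam * moeb_deriv a z) *: dB f (moebius lam a z))).
    apply: (@derR_linear _ _ _ _ 1) => //; last exact: derR_compB.
    by move=> x; exact: isometryE_le.
  have [d1 d10 h1] := dV e e0; exists (Num.min d d1); first by rewrite lt_min d0.
  move=> h; rewrite lt_min => /andP[hd1 /h1].
  rewrite (linZ lV) !TE//; last by apply: hd; rewrite addrAC subrr add0r.
  congr (_ <= _); congr normR; rewrite /= !(linB lV); lmod_eq R[i].
have wT f z : disc z -> bloch_weight (T f) z = bloch_weight f (moebius lam a z).
  by move=> zd; rewrite !wtE dT// normRZ nV mulrA moebius_weight.
split.
- move=> k f g; apply: Bstar_eq => z zd; rewrite BstarP !TE// !BstarP.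
  by rewrite lU !(linB lV) !lV; lmod_eq R[i].
- move=> g; have [W sW UW] := isometryE_inv sU; have [W' sW' VW'] := isometryE_inv sV.
  pose h := mapB W' (compB (conjC lam) (- (lam * a)) g).
  have hE z : disc z -> h (moebius lam a z) = W' (g z).
    move=> zd; have sd := moebius_disc l1 ad zd.
    rewrite /h /mapB toBE//; last exact: mapB_blochfun.
    by rewrite /= compBE// (moebius_inv l1 ad zd).2.
  exists (h - cstB (h 0) + cstB (W (g 0))); apply: Bstar_eq => z zd.
  have fE w : disc w -> (h - cstB (h 0) + cstB (W (g 0)) : Bstar E) w = h w - h 0 + W (g 0).
    by move=> wd; rewrite !BstarD BstarN !cstBE.
  rewrite TE// !fE//; try exact: moebius_disc.
  rewrite subrr add0r UW !hE//.
  rewrite (_ : _ - _ = W' (g z) - W' (g 0)); last by lmod_eq R[i].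
  by rewrite (linB lV) !VW'; lmod_eq R[i].
- move=> f; rewrite !bloch_normE; congr (_%:E); rewrite /nB.
  rewrite TE// subrr (lin0 lV) addr0 nU; congr (_ + _).
  apply/eqP; rewrite eq_le; apply/andP; split; apply: beta_le => w wd.
    by rewrite wT//; apply: wt_le_beta; exact: moebius_disc.
  have [e _] := moebius_inv l1 ad wd; rewrite -e -wT; last exact: moebius_disc.
  by apply: wt_le_beta; exact: moebius_disc.
Qed.

End Converse.

(** * Isometries are weighted compositions *)

Section Forward.
Context {R : realType} {E : normedModType R[i]}.
Hypothesis smoothE : smooth_space E.
Hypothesis convexE : strictly_convex_space E.
Implicit Types (f g : Bstar E) (z w a lam : CC R) (x y : E).

Lemma analytic_moebius lam a z : disc a -> disc z -> analytic_at (moebius lam a) z.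
Proof.
move=> ad zd; apply: (@analytic_comp_frac _ _ (fun w : CC R => w)) (moebius_frac lam ad zd) _.
apply: (analytic_eq_near ltr01 _ (analytic_mul_affine 0 1 (analytic_cst (1 : CC R) _))).
by move=> w _; rewrite add0r mul1r -[LHS]/(w * 1) mulr1.
Qed.

Lemma moebius_automorphism lam a : normR lam = 1 -> disc a -> disc_automorphism (moebius lam a).
Proof.
move=> l1 ad; split; first by move=> z zd; exact: analytic_moebius.
have l1' : normR (conjC lam) = 1 by rewrite normRJ.
have ad' := disc_neg_mul l1 ad.
split.
- by move=> z zd; exact: moebius_disc.
- move=> z w; rewrite !inE => zd wd h.
  by rewrite -(moebius_inv l1 ad zd).2 h (moebius_inv l1 ad wd).2.
- move=> w wd; exists (moebius (conjC lam) (- (lam * a)) w); first exact: moebius_disc.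
  exact: (moebius_inv l1 ad wd).1.
Qed.

Lemma isometric_pairP (T : Bstar E -> Bstar E) : surjective_linear_isometry bloch_norm T ->
  exists Ti, isometric_pair T Ti.
Proof.
move=> [lT sT nT].
have {}nT f : nB (T f) = nB f by have := nT f; rewrite !bloch_normE => -[].
have inj f g : T f = T g -> f = g.
  move=> e; apply/eqP; rewrite -subr_eq0; apply/eqP/nB_eq0.
  rewrite -nT (linB lT) e subrr /nB Bstar0 normR0 add0r.
  apply/eqP; rewrite eq_le beta_ge0 andbT; apply: beta_le => w wd.
  by rewrite wtE dB0// normR0 mulr0.
pose Ti g := projT1 (cid (sT g)).
have TiK g : T (Ti g) = g by exact: (projT2 (cid (sT g))).
exists Ti; split; last by split=> // f; rewrite -nT TiK.
split => //; last by move=> f; apply: inj; rewrite TiK.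
by move=> k f g; apply: inj; rewrite lT !TiK.
Qed.

(** Both sides have the same derivative by [isometry_form], and the same value at 0
    because [T] preserves the functions vanishing at 0. *)
Lemma isometry_composition (T : Bstar E -> Bstar E) :
  surjective_linear_isometry bloch_norm T ->
  exists (U V : E -> E) (s : CC R -> CC R), [/\ isometryE U, isometryE V, disc_automorphism s &
    forall f z, disc z -> T f z = U (f 0) + V (f (s z) - f (s 0))].
Proof.
move=> /isometric_pairP[Ti iT].
have z0 := @disc0 R.
have [[e0 e00]|E0] := pselect (exists x : E, x != 0); last first.
  have {}E0 x : x = 0.
    by apply/eqP; apply: contraT => x0; exfalso; apply: E0; exists x.
  have id_sli : isometryE (@id E) by split=> // y; exists y.
  exists id, id, (moebius 1 0); split => //.
    by apply: moebius_automorphism; rewrite ?normR1.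
  by move=> f z _; rewrite [LHS]E0 [RHS]E0.
have [lam [a [V [l1 ad [lV nV sV] dT]]]] := isometry_form smoothE convexE iT e00.
have [[lT lTi TK TiK] [nT nTi]] := iT.
pose U x := T (cstB x) 0.
have Tc x : T (cstB x) = cstB (U x) by exact: (constants_preserved smoothE x iT).
have Tic x : Ti (cstB x) = cstB (Ti (cstB x) 0).
  exact: (constants_preserved smoothE x (isometric_pair_sym iT)).
have vV : isometryE V by [].
have T0 f : T f 0 = U (f 0).
  have : T (f - cstB (f 0)) 0 = 0.
    apply: (vanishing_preserved smoothE (isometric_pair_sym iT)).
    by rewrite BstarD BstarN cstBE// subrr.
  by rewrite (linB lT) BstarD BstarN => /eqP; rewrite subr_eq0 => /eqP.
exists U, V, (moebius lam a); split => //.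
- split.
  + by move=> k x y; rewrite /U cstB_linear lT.
  + move=> y; exists (Ti (cstB y) 0); rewrite /U -Tic TiK cstBE//.
  + by move=> x; rewrite -[RHS]nB_cst -nT Tc nB_cst.
- exact: moebius_automorphism.
move=> f z zd.
pose D w := T f w - V (f (moebius lam a w)).
have D0 : D z = D 0.
  apply: zero_derivative_cst => // w wd e e0'.
  have dV : derR (V \o (f \o moebius lam a)) w (V ((lam * moeb_deriv a w) *: dB f (moebius lam a w))).
    apply: (@derR_linear _ _ _ _ 1) => //; last exact: derR_compB.
    by move=> x; exact: isometryE_le.
  have := derR_lin (-1) dV (dB_derR (T f) wd).
  rewrite dT// (linZ lV) scaleN1r addNr => /(_ e e0')[d d0 hd].
  exists d => // h /hd; congr (_ <= _); congr normR.
  by rewrite /D /=; lmod_eq R[i].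
have : T f z = D z + V (f (moebius lam a z)) by rewrite /D subrK.
by rewrite D0 /D T0 (linB lV) => ->; lmod_eq R[i].
Qed.

End Forward.

Theorem theorem4p8 (R : realType) (E : completeNormedModType R[i])
    (smoothE : smooth_space E) (convexE : strictly_convex_space E)
    (T : Bstar E -> Bstar E) :
  surjective_linear_isometry bloch_norm T <->
  exists (U V : E -> E) (sigma : CC R -> CC R),
    [/\ surjective_linear_isometry (fun x : E => `|x|) U,
        surjective_linear_isometry (fun x : E => `|x|) V,
        disc_automorphism sigma &
        forall (f : Bstar E) (z : CC R), disc z ->
          T f z = U (f 0) + V (f (sigma z) - f (sigma 0))].
Proof.
split=> [/(isometry_composition smoothE convexE)|] [U [V [s [hU hV hs TE]]]].
  by exists U, V, s; split => //; exact/isometryEP.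
by apply: weighted_composition_isometry TE => //; exact/isometryEP.
Qed.
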